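(* Let $\rho>0$ and let the standing assumptions (A0)–(A5) listed in the context hold. Then the minimization problems $$\vec u_{*,N}:=\operatorname{arg\,min}_{\vec f\in\mathbb{R}^N}\Psi_N^{\mathrm{full}}(\vec f)\quad(N\in\mathbb{N}),\qquad u_*:=\operatorname{arg\,min}_{f\in H^1(S^1)}\Psi^{\mathrm{full}}(f)$$ have unique solutions, and $\mathcal I_N\vec u_{*,N}\to u_*$ in $L^2$ as $N\to\infty$. Moreover, $u_*$ satisfies $$\mathcal K^*\big[\partial_1\Phi(\mathcal K u_*,g,\cdot)\big]+\rho(-\partial_t^2+\mathrm{Id})u_*=0\quad\text{in }H^{-1}(S^1).$$
   Context: $S^1$ is the interval $[0,1]$ with endpoints glued; functions on $S^1$ are identified with $1$-periodic functions on $\mathbb{R}$. All functions are real valued, $C=C(S^1)$, $L^2=L^2(S^1)$. $N\in\mathbb{N}$ is a positive integer, $t_i=i/N$, vectors in $\mathbb{R}^N$ are written $\vec f=(f_0,\dots,f_{N-1})$ with the periodic convention $f_N=f_0$. Data of the problem: a linear operator $\mathcal K$, a function $g$ on $S^1$, a function $w:\mathbb{R}\to\mathbb{R}$, a function $\Phi:\mathbb{R}\times\mathbb{R}\times S^1\to\mathbb{R}$, $(p,v,t)\mapsto\Phi(p,v,t)$; $\partial_1$ denotes differentiation in the first argument of $\Phi$. Put $$g_i=N\int_{\mathbb{R}}w(N(t-t_i))g(t)\,dt,\qquad 0\le i\le N-1,$$ $$\mathcal I_N:\mathbb{R}^N\to L^2,\quad (\mathcal I_N\vec f)(t)=f_m\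 \text{ for } t\in[m/N,(m+1)/N),$$ $$(\mathcal K_N\vec f)_i=N\int_{\mathbb{R}}w(N(t-t_i))(\mathcal K\mathcal I_N\vec f)(t)\,dt,\qquad (D_N\vec f)_i=N(f_{i+1}-f_i),$$ $$\Psi_N^{\mathrm{full}}(\vec f)=\frac{1}{N}\sum_{i=0}^{N-1}\Phi\big((\mathcal K_N\vec f)_i,g_i,t_i\big)+\frac{\rho}{2N}\sum_{i=0}^{N-1}\big[f_i^2+(D_N\vec f)_i^2\big],\quad \vec f\in\mathbb{R}^N,$$ $$\Psi^{\mathrm{full}}(f)=\int_{S^1}\Phi\big((\mathcal K f)(t),g(t),t\big)\,dt+\frac{\rho}{2}\int_{S^1}\big(f(t)^2+|f'(t)|^2\big)\,dt,\quad f\in H^1(S^1).$$ Standing assumptions: (A0) $\Phi$ is convex and continuous in its first argument and bounded from below (so that, with the positive definite quadratic term, $\Psi_N^{\mathrm{full}}$ is coercive and strongly convex). (A1) $w\in L^\infty(\mathbb{R})$ has compact support and $\int_{\mathbb{R}}w=1$. (A2) $\mathcal K$ and its $L^2$-adjoint $\mathcal K^*$ are bounded from $L^2$ to $C$; $g\in C$. (A3) There are $h_0>0$ and $c\ge0$ such that $\Phi(p,g(t)+h,t)\ge -c$ and $\partial_1^2\Phi(p,g(t)+h,t)\ge0$ for all $p\in\mathbb{R}$, $t\in S^1$, $|h|\le h_0$. (A4) $\Phi$ is locally Lipschitz in $(p,v,t)$, and $\partial_1\Phi$, $\partial_1^2\Phi$ are continuous in $(p,v,t)$. (A5) For some $p_0>0$,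 $\sup_{N\in\mathbb{N}}\sup_{0\le i\le N-1}\sup_{|p|\le p_0}|\partial_1^3\Phi(r_i+p,g_i,t_i)|<\infty$, where $r_i=(\mathcal K_N\vec u_{*,N})_i$ and $\vec u_{*,N}$ is the minimizer of $\Psi_N^{\mathrm{full}}$ on $\mathbb{R}^N$. *)

(* Defs.v *)
From HB Require Import structures.
From mathcomp Require Import all_boot all_order all_algebra.
From mathcomp Require Import all_classical all_reals all_analysis.

Set Implicit Arguments.
Unset Strict Implicit.
Unset Printing Implicit Defensive.

Import Order.TTheory GRing.Theory Num.Theory.
Import numFieldNormedType.Exports.

Local Open Scope classical_set_scope.
Local Open Scope ring_scope.

(* A function on the circle S^1 is a 1-periodic function R -> R, and an integral
   over S^1 is an integral over [0, 1]. Elements of L^2(S^1) and H^1(S^1) are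
   given by representatives; equality there is equality almost everywhere. *)

Section FunctionSpaces.
Context {R : realType}.
Local Notation mu := (@lebesgue_measure R).
Implicit Types f h phi : R -> R.

Definition intS1 f : R := \int[mu]_(t in `[0, 1]) f t.

Definition C_S1 : set (R -> R) := [set f : R -> R | periodic f 1 /\ continuous f].

Definition L2_S1 : set (R -> R) := [set f : R -> R |
  [/\ periodic f 1, measurable_fun [set: R] f &
      mu.-integrable `[0, 1] (fun t => (f t ^+ 2)%:E)]].

Definition L2norm f : R := Num.sqrt (intS1 (fun t => f t ^+ 2)).

Definition Cinfty_S1 : set (R -> R) := [set phi : R -> R |
  periodic phi 1 /\ forall (n : nat) (t : R), derivable (derive1n n phi) t 1].

Definition is_weak_derivative f h : Prop :=
  forall phi, Cinfty_S1 phi ->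
    intS1 (fun t => f t * derive1 phi t) = - intS1 (fun t => h t * phi t).

Definition H1_S1 : set (R -> R) := [set f : R -> R |
  L2_S1 f /\ exists h, L2_S1 h /\ is_weak_derivative f h].

(* A weak derivative is unique up to a null set; [wderiv f] is one of its
   representatives when f is in H^1(S^1), and 0 otherwise. *)
Definition wderiv f : R -> R :=
  xget (fun=> 0) [set h : R -> R | L2_S1 h /\ is_weak_derivative f h].

(* H^{-1}(S^1) is the dual of H^1(S^1): [Hm1_fun f] is the functional given by
   f in L^2(S^1), [Hm1_dt f] is its distributional derivative, and
   [Hm1_zero F] says that F vanishes in H^{-1}(S^1). *)
Definition Hm1_fun f : (R -> R) -> R :=
  fun phi => intS1 (fun t => f t * phi t).

Definition Hm1_dt f : (R -> R) -> R :=
  fun phi => - intS1 (fun t => f t * wderiv phi t).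

Definition Hm1_zero (F : (R -> R) -> R) : Prop :=
  forall phi, H1_S1 phi -> F phi = 0.

Definition L2_linear (K : (R -> R) -> R -> R) : Prop :=
  forall (a : R) f h, L2_S1 f -> L2_S1 h ->
    forall t, K (fun s => a * f s + h s) t = a * K f t + K h t.

(* Together with [L2_linear K], this implies that K f depends only on the class
   of f modulo equality almost everywhere. *)
Definition L2_to_C_bounded (K : (R -> R) -> R -> R) : Prop :=
  (forall f, L2_S1 f -> C_S1 (K f)) /\
  exists M : R, forall f, L2_S1 f -> forall t, `|K f t| <= M * L2norm f.

Definition L2_adjoint (K Kadj : (R -> R) -> R -> R) : Prop :=
  forall f h, L2_S1 f -> L2_S1 h ->
    intS1 (fun t => K f t * h t) = intS1 (fun t => f t * Kadj h t).

End FunctionSpaces.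

Definition is_argmin {T : Type} {R : realType} (D : set T) (F : T -> R) (x : T)
    : Prop :=
  D x /\ forall y, D y -> F x <= F y.

Section Functionals.
Context {R : realType}.
Local Notation mu := (@lebesgue_measure R).
Variables (K : (R -> R) -> R -> R) (g w : R -> R) (Phi : R -> R -> R -> R).
Variable rho : R.

Definition grid (N : nat) (i : 'I_N) : R := i%:R / N%:R.

Definition sample (N : nat) (f : R -> R) (i : 'I_N) : R :=
  N%:R * \int[mu]_t (w (N%:R * (t - grid i)) * f t).

(* The argument [t - floor t] of the indicator function makes the step
   function 1-periodic. *)
Definition interpN (N : nat) (f : 'rV[R]_N) (t : R) : R :=
  \sum_(m < N)
    f 0 m * \1_(`[m%:R / N%:R, m.+1%:R / N%:R[%classic : set R)
              (t - (Num.floor t)%:~R).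

Definition KN (N : nat) (f : 'rV[R]_N) (i : 'I_N) : R :=
  sample (K (interpN f)) i.

(* [ordS] is the cyclic successor on 'I_N, so that f_N = f_0. *)
Definition DN (N : nat) (f : 'rV[R]_N) (i : 'I_N) : R :=
  N%:R * (f 0 (ordS i) - f 0 i).

Definition PsiN (N : nat) (f : 'rV[R]_N) : R :=
  N%:R^-1 * \sum_(i < N) Phi (KN f i) (sample g i) (grid i)
  + rho / (2 * N%:R) * \sum_(i < N) (f 0 i ^+ 2 + DN f i ^+ 2).

Definition Psi (f : R -> R) : R :=
  intS1 (fun t => Phi (K f t) (g t) t)
  + rho / 2 * intS1 (fun t => f t ^+ 2 + wderiv f t ^+ 2).

Definition d1 (n : nat) (p v t : R) : R :=
  derive1n n (fun q => Phi q v t) p.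

Definition convex_bounded_below : Prop :=
  [/\ forall v t : R, convex_function (E := R^o) setT (fun p => Phi p v t),
      forall v t : R, continuous (fun p => Phi p v t) &
      exists b : R, forall p v t, b <= Phi p v t].

Definition admissible_window : Prop :=
  [/\ w \in Lfun mu +oo%E,
      exists2 A : set R, compact A & \forall t \ae mu, ~ A t -> w t = 0 &
      \int[mu]_t w t = 1].

Definition nonneg_near_data : Prop :=
  exists (h0 c : R), [/\ 0 < h0, 0 <= c &
    forall p t h : R, `|h| <= h0 ->
      - c <= Phi p (g t + h) t /\ 0 <= d1 2 p (g t + h) t].

Definition regular_integrand : Prop :=
  [/\ forall z : R * R * R, exists2 U, nbhs z U &
        [lipschitz Phi x.1.1 x.1.2 x.2 | x in U],
      forall p v t : R, derivable (fun q => Phi q v t) p 1,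
      forall p v t : R, derivable (fun q => d1 1 q v t) p 1,
      continuous (fun z : R * R * R => d1 1 z.1.1 z.1.2 z.2) &
      continuous (fun z : R * R * R => d1 2 z.1.1 z.1.2 z.2)].

(* The bound is required at every minimizer of the discrete functional; such
   a minimizer exists and is unique. *)
Definition third_derivative_bound : Prop :=
  exists (p0 M : R), 0 < p0 /\
    forall (N : nat) (u : 'rV[R]_N), (0 < N)%N -> is_argmin setT (@PsiN N) u ->
      forall (i : 'I_N) (p : R), `|p| <= p0 ->
        derivable (fun q => d1 2 q (sample g i) (grid i)) (KN u i + p) 1 /\
        `|d1 3 (KN u i + p) (sample g i) (grid i)| <= M.

End Functionals.

(* Main.v *)
Require Import Defs.
From HB Require Import structures.
From mathcomp Require Import all_boot all_order all_algebra.
From mathcomp Require Import all_classical all_reals all_analysis.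
From mathcomp Require Import measurable_realfun ess_sup_inf.
From mathcomp Require Import ring lra.

Set Implicit Arguments.
Unset Strict Implicit.
Unset Printing Implicit Defensive.

Import Order.TTheory GRing.Theory Num.Theory.
Import numFieldNormedType.Exports.

Local Open Scope classical_set_scope.
Local Open Scope ring_scope.

(* Direct method plus Gamma-convergence. A vector of R^N is lifted to the periodic
   piecewise linear interpolant of its values, whose weak derivative is the step
   function of its difference quotients; conversely a function of H^1(S^1), which
   has a continuous primitive as representative, is sampled at the grid points.
   A bound on the discrete H^1 norm makes the step functions relatively compact in
   L^2, so their images under K are equicontinuous and the discrete functionals
   are uniformly consistent with the continuous one. Hence the lifted discrete
   minimizers are a minimizing sequence of Psi; by strong convexity it is Cauchy in
   H^1(S^1), and its limit is the minimizer. The Euler-Lagrange equation is the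
   vanishing of the Gateaux derivative of Psi at that limit. *)

(** * Integration over [0, 1] and its subintervals *)

Section IntegrableOnInterval.
Context {R : realType}.
Local Notation mu := (@lebesgue_measure R).
Implicit Types f h : R -> R.

(** The obstacle is consistency. [KN] averages [K (interpN f)] over windows of width of order 1/N,
    and an operator merely bounded from L^2 to C gives no common modulus of continuity on a bounded
    set of L^2. The quadratic term supplies one: under a bound on the discrete H^1 norm, uniform in
    N, every step function on a fine grid is L^2-close to a bounded set of step functions on one
    fixed coarse grid, where the finitely many continuous images of the coarse cells decide. The
    discrete minimizers obey such a bound by comparison with recovery vectors of the zero function.

    No weak limits are taken: by the midpoint inequality two almost minimizers are close in H^1, and
    completeness of L^2 provides the limit.

    Since H^1 is defined by testing against smooth periodic functions, the continuous representative
    rests on the fundamental lemma, hence on smooth periodic functions that approximate indicators.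
    Norms occur squared, as [sqS1], so that estimates stay polynomial. *)

Definition L1 f : Prop := mu.-integrable `[0, 1] (EFin \o f).

Lemma L1_measurable f : L1 f -> measurable_fun (`[0, 1] : set R) f.
Proof. by move=> /measurable_int/measurable_EFinP. Qed.

Lemma eq_L1 f h : (forall t, 0 <= t <= 1 -> f t = h t) -> L1 f -> L1 h.
Proof.
move=> fh; apply: eq_integrable => //= t; rewrite inE/= in_itv/= => t01.
by rewrite fh.
Qed.

Lemma le_L1 f h : measurable_fun (`[0, 1] : set R) f -> L1 h ->
  (forall t, 0 <= t <= 1 -> `|f t| <= h t) -> L1 f.
Proof.
move=> mf Lh fh; apply: (le_integrable _ _ _ Lh) => //; first exact/measurable_EFinP.
move=> t /=; rewrite in_itv/= => t01.
by rewrite lee_fin (le_trans (fh t t01))// ler_norm.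
Qed.

Lemma L1D f h : L1 f -> L1 h -> L1 (fun t => f t + h t).
Proof. by move=> Lf Lh; exact: (integrableD _ Lf Lh). Qed.

Lemma L1Z a f : L1 f -> L1 (fun t => a * f t).
Proof. by move=> Lf; exact: (integrableZl _ a Lf). Qed.

Lemma L1B f h : L1 f -> L1 h -> L1 (fun t => f t - h t).
Proof. by move=> Lf Lh; exact: (integrableB _ Lf Lh). Qed.

Lemma L1_norm f : L1 f -> L1 (fun t => `|f t|).
Proof. by move=> Lf; exact: (integrable_norm Lf). Qed.

Lemma L1_bounded f (M : R) : measurable_fun (`[0, 1] : set R) f ->
  (forall t, 0 <= t <= 1 -> `|f t| <= M) -> L1 f.
Proof.
move=> mf fM; apply: measurable_bounded_integrable => //.
  by rewrite /= lebesgue_measure_itv/= lte_fin ltr01 oppr0 adde0 ltry.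
exists M; split; first exact: num_real.
move=> x Mx t /=; rewrite in_itv/= => t01.
by rewrite (le_trans (fM _ t01))// ltW.
Qed.

Lemma L1M f h M : L1 f -> measurable_fun (`[0, 1] : set R) h ->
  (forall t, 0 <= t <= 1 -> `|h t| <= M) -> L1 (fun t => f t * h t).
Proof.
move=> Lf mh hM; apply: (@le_L1 _ (fun t => M * `|f t|)).
- by apply: measurable_funM => //; exact: L1_measurable.
- exact/L1Z/L1_norm.
- by move=> t /hM ?; rewrite normrM mulrC ler_wpM2r.
Qed.

Lemma L1_cst a : L1 (fun=> a).
Proof. by apply: (@L1_bounded _ `|a|). Qed.

Lemma L1_continuous f : continuous f -> L1 f.
Proof.
move=> cf; apply: continuous_compact_integrable; first exact: segment_compact.
exact: continuous_subspaceT.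
Qed.

Lemma intS1D f h : L1 f -> L1 h ->
  intS1 (fun t => f t + h t) = intS1 f + intS1 h.
Proof. by move=> Lf Lh; exact: RintegralD. Qed.

Lemma intS1B f h : L1 f -> L1 h ->
  intS1 (fun t => f t - h t) = intS1 f - intS1 h.
Proof. by move=> Lf Lh; exact: RintegralB. Qed.

Lemma intS1Z a f : L1 f -> intS1 (fun t => a * f t) = a * intS1 f.
Proof. by move=> Lf; exact: RintegralZl. Qed.

Lemma eq_intS1 f h : (forall t, 0 <= t <= 1 -> f t = h t) -> intS1 f = intS1 h.
Proof.
by move=> fh; apply: eq_Rintegral => t; rewrite inE/= in_itv/= => /fh.
Qed.

Lemma le_intS1 f h : L1 f -> L1 h ->
  (forall t, 0 <= t <= 1 -> f t <= h t) -> intS1 f <= intS1 h.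
Proof.
by move=> Lf Lh fh; apply: le_Rintegral => // t /=; rewrite in_itv/= => /fh.
Qed.

Lemma intS1_ge0 f : (forall t, 0 <= t <= 1 -> 0 <= f t) -> 0 <= intS1 f.
Proof.
by move=> f0; apply: Rintegral_ge0 => // t /=; rewrite in_itv/= => /f0.
Qed.

Lemma intS1_cst (a : R) : intS1 (fun=> a) = a.
Proof.
rewrite /intS1 Rintegral_cst//= lebesgue_measure_itv/= lte_fin ltr01/=.
by rewrite subr0 mulr1.
Qed.

Lemma normr_intS1_le f M : L1 f -> (forall t, 0 <= t <= 1 -> `|f t| <= M) ->
  `|intS1 f| <= M.
Proof.
move=> Lf fM; apply: (le_trans (le_normr_Rintegral _ Lf)) => //.
rewrite -[leRHS](intS1_cst M); apply: le_intS1 => //; first exact: L1_norm.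
exact: L1_cst.
Qed.

Lemma L1_subitv f (a b : R) (x y : bool) : 0 <= a -> b <= 1 -> L1 f ->
  mu.-integrable [set` Interval (BSide x a) (BSide y b)] (EFin \o f).
Proof.
move=> a0 b1; apply: integrableS => //.
by move=> t; move: x y => [] []; rewrite /= !in_itv/= => /andP[? ?]; lra.
Qed.

Lemma Rintegral_chasles f (a b c : R) : 0 <= a -> a <= b -> b <= c -> c <= 1 ->
  L1 f ->
  \int[mu]_(t in `[a, c]) f t
    = \int[mu]_(t in `[a, b]) f t + \int[mu]_(t in `[b, c]) f t.
Proof.
move=> a0 ab bc c1 Lf.
rewrite -(@Rintegral_itv_obnd_cbnd _ b); last by apply: L1_subitv => //; lra.
rewrite -(@Rintegral_itvB _ _ (BLeft a) (BRight c) b) ?bnd_simp//.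
  by rewrite addrC subrK.
exact: L1_subitv.
Qed.

Lemma fine_mu_itv (a b : R) : a <= b -> fine (mu `[a, b]) = b - a.
Proof.
move=> ab; rewrite lebesgue_measure_itv/= lte_fin.
by case: ltP => [_ //|ba]/=; lra.
Qed.

(** The square of [f] minus its mean [c] over [a, b] has a nonnegative integral. A one-point
    interval is set apart because [c] divides by b - a. *)
Lemma sqr_Rintegral_le f (a b : R) : 0 <= a -> a <= b -> b <= 1 ->
  L1 f -> L1 (fun t => f t ^+ 2) ->
  (\int[mu]_(t in `[a, b]) f t) ^+ 2
    <= (b - a) * \int[mu]_(t in `[a, b]) (f t ^+ 2).
Proof.
move=> a0; rewrite le_eqVlt => /predU1P[<-|ab] b1 Lf Lf2.
  by rewrite set_itv1 !Rintegral_set1 expr0n/= mulr0.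
set J := \int[mu]_(t in `[a, b]) f t; set Q := \int[mu]_(t in _) _.
set c := J / (b - a).
have ba0 : 0 < b - a by lra.
have LfI := @L1_subitv _ a b true false a0 b1 Lf.
have Lf2I := @L1_subitv _ a b true false a0 b1 Lf2.
have LcI (k : R) := @L1_subitv _ a b true false a0 b1 (L1_cst k).
have : 0 <= \int[mu]_(t in `[a, b]) (f t - c) ^+ 2.
  by apply: Rintegral_ge0 => t _; exact: sqr_ge0.
have -> : \int[mu]_(t in `[a, b]) (f t - c) ^+ 2
    = \int[mu]_(t in `[a, b]) (f t ^+ 2 + ((- 2 * c) * f t + c ^+ 2)).
  by apply: eq_Rintegral => t _; ring.
have LcfI : mu.-integrable `[a, b] (EFin \o (fun t => - 2 * c * f t)).
  exact: (integrableZl _ (- 2 * c) LfI).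
rewrite RintegralD//; last exact: (integrableD _ LcfI (LcI _)).
rewrite (RintegralD _ LcfI (LcI _))//.
rewrite RintegralZl// Rintegral_cst// fine_mu_itv ?(ltW ab)// -/J -/Q.
rewrite (_ : c ^+ 2 * (b - a) = c * J); last by rewrite /c; field; lra.
move=> H.
rewrite (_ : J ^+ 2 = (b - a) * (c * J)); last by rewrite /c; field; lra.
by rewrite ler_pM2l//; lra.
Qed.

Lemma Rintegral_itv_le f (a b : R) : 0 <= a -> b <= 1 ->
  L1 f -> (forall t, 0 <= f t) -> \int[mu]_(t in `[a, b]) f t <= intS1 f.
Proof.
move=> a0 b1 Lf f0; rewrite /intS1 /Rintegral fine_le//.
- by apply: integrable_fin_num => //; exact: L1_subitv.
- exact: integrable_fin_num.
apply: ge0_subset_integral => //.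
- by case/integrableP : Lf.
- by move=> t _; rewrite lee_fin.
- by move=> t; rewrite /= !in_itv/= => /andP[? ?]; lra.
Qed.

(** Endpoints are null. They have to be ignored because a step function may jump at the right end of
    a closed cell. *)
Lemma Rintegral_itvoo_eq f h (a b : R) :
  L1 f -> L1 h -> 0 <= a -> b <= 1 ->
  (forall t, a < t < b -> f t = h t) ->
  \int[mu]_(t in `[a, b]) f t = \int[mu]_(t in `[a, b]) h t.
Proof.
move=> Lf Lh a0 b1 fh; congr fine.
have mf k : L1 k -> measurable_fun (`]a, b[ : set R) k.
  move=> Lk; apply: measurable_funS (L1_measurable Lk) => //.
  by move=> t; rewrite /= !in_itv/= => /andP[? ?]; lra.
apply: eq_integral_itv_bounded; [exact: mf|exact: mf|].
by move=> t; rewrite inE/= => /fh.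
Qed.

Lemma intS1_cells f (N : nat) : (0 < N)%N -> L1 f ->
  intS1 f = \sum_(i < N) \int[mu]_(t in `[i%:R / N%:R, i.+1%:R / N%:R]) f t.
Proof.
move=> N0 Lf; have N0' : 0 < N%:R :> R by rewrite ltr0n.
have H m : (m <= N)%N -> \int[mu]_(t in `[0, m%:R / N%:R]) f t =
    \sum_(i < m) \int[mu]_(t in `[i%:R / N%:R, i.+1%:R / N%:R]) f t.
  elim: m => [_|m IH mN].
    by rewrite mul0r set_itv1 Rintegral_set1 big_ord0.
  rewrite big_ord_recr/= -IH; last exact: ltnW.
  apply: Rintegral_chasles => //.
  - by rewrite ler_pM2r ?invr_gt0// ler_nat.
  - by rewrite ler_pdivrMr// mul1r ler_nat.
by rewrite -H// divff// gt_eqF.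
Qed.

End IntegrableOnInterval.

(** * The space L^2 of the circle *)

Section SquareIntegrable.
Context {R : realType}.
Local Notation mu := (@lebesgue_measure R).
Implicit Types f h : R -> R.

Definition sqS1 f : R := intS1 (fun t => f t ^+ 2).

Lemma L2_sqr f : L2_S1 f -> L1 (fun t => f t ^+ 2).
Proof. by case. Qed.

Lemma L2_measurable f (D : set R) : L2_S1 f -> measurable_fun D f.
Proof. by case=> _ mf _; exact: measurable_funTS. Qed.

Lemma L2_mul f h : L2_S1 f -> L2_S1 h -> L1 (fun t => f t * h t).
Proof.
move=> Lf Lh; apply: (@le_L1 _ _ (fun t => f t ^+ 2 + h t ^+ 2)).
- by apply: measurable_funM; exact: L2_measurable.
- by apply: L1D; exact: L2_sqr.
- move=> t _; rewrite ler_norml; apply/andP; split.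
    by have := sqr_ge0 (f t + h t); nra.
  by have := sqr_ge0 (f t - h t); nra.
Qed.

Lemma C_S1_L2 f : C_S1 f -> L2_S1 f.
Proof.
move=> [pf cf]; split=> //; first exact: continuous_measurable_fun.
by apply: L1_continuous => t; apply: cvgM; exact: cf.
Qed.

Lemma L2_cst (a : R) : L2_S1 (fun=> a).
Proof. by apply: C_S1_L2; split=> // t; exact: cvg_cst. Qed.

Lemma L2_L1 f : L2_S1 f -> L1 f.
Proof.
move=> Lf; apply: eq_L1 (L2_mul Lf (L2_cst 1)) => t _; exact: mulr1.
Qed.

Lemma L2_lin a f h : L2_S1 f -> L2_S1 h -> L2_S1 (fun t => a * f t + h t).
Proof.
move=> Lf Lh; split.
- by move=> t; case: Lf Lh => [-> _ _] [-> _ _].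
- apply: measurable_funD; last exact: L2_measurable.
  by apply: measurable_funM => //; exact: L2_measurable.
- apply: (@eq_L1 _ (fun t => a ^+ 2 * f t ^+ 2
      + (2 * a * (f t * h t) + h t ^+ 2))); first by move=> t _; ring.
  apply: L1D; first exact/L1Z/L2_sqr.
  by apply: L1D; [exact/L1Z/L2_mul|exact: L2_sqr].
Qed.

Lemma eq_L2 f h : f =1 h -> L2_S1 f -> L2_S1 h.
Proof. by move=> /funext ->. Qed.

Lemma L2D f h : L2_S1 f -> L2_S1 h -> L2_S1 (fun t => f t + h t).
Proof.
by move=> Lf Lh; apply: eq_L2 (L2_lin 1 Lf Lh) => t; rewrite mul1r.
Qed.

Lemma L2B f h : L2_S1 f -> L2_S1 h -> L2_S1 (fun t => f t - h t).
Proof.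
by move=> Lf Lh; apply: eq_L2 (L2_lin (-1) Lh Lf) => t; rewrite mulN1r addrC.
Qed.

Lemma sqS1_ge0 f : 0 <= sqS1 f.
Proof. by apply: intS1_ge0 => t _; exact: sqr_ge0. Qed.

Lemma sqS1_lin a f h : L2_S1 f -> L2_S1 h ->
  sqS1 (fun t => a * f t + h t)
    = a ^+ 2 * sqS1 f + 2 * a * intS1 (fun t => f t * h t) + sqS1 h.
Proof.
move=> Lf Lh; rewrite /sqS1 -!intS1Z.
- rewrite -!intS1D.
  + by apply: eq_intS1 => t _; ring.
  + by apply: L1D; [exact/L1Z/L2_sqr|exact/L1Z/L2_mul].
  + exact: L2_sqr.
  + exact/L1Z/L2_sqr.
  + exact/L1Z/L2_mul.
- exact: L2_mul.
- exact: L2_sqr.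
Qed.

Lemma eq_sqS1 f h : (forall t, 0 <= t <= 1 -> f t = h t) -> sqS1 f = sqS1 h.
Proof. by move=> fh; apply: eq_intS1 => t /fh ->. Qed.

Lemma sqS1_BC f h : sqS1 (fun t => f t - h t) = sqS1 (fun t => h t - f t).
Proof. by apply: eq_intS1 => t _; ring. Qed.

(** Parallelogram law without the norm of the difference; the factors 2 are the price of avoiding
    square roots. *)
Lemma sqS1_D_le f h : L2_S1 f -> L2_S1 h ->
  sqS1 (fun t => f t + h t) <= 2 * sqS1 f + 2 * sqS1 h.
Proof.
move=> Lf Lh.
have := sqS1_ge0 (fun t => -1 * f t + h t); rewrite sqS1_lin//.
have := sqS1_lin 1 Lf Lh.
under [in LHS]eq_sqS1 do rewrite mul1r.
by move=> -> H; lra.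
Qed.

Lemma sqS1_triangle f h k : L2_S1 f -> L2_S1 h -> L2_S1 k ->
  sqS1 (fun t => f t - k t)
    <= 2 * sqS1 (fun t => f t - h t) + 2 * sqS1 (fun t => h t - k t).
Proof.
move=> Lf Lh Lk.
have := sqS1_D_le (L2B Lf Lh) (L2B Lh Lk); apply: le_trans.
by rewrite le_eqVlt; apply/orP; left; apply/eqP; apply: eq_intS1 => t _; ring.
Qed.

Lemma sqS1_bounded f M : L2_S1 f -> (forall t, 0 <= t <= 1 -> f t ^+ 2 <= M) ->
  sqS1 f <= M.
Proof.
move=> Lf fM; rewrite -(intS1_cst M); apply: le_intS1 => //.
  exact: L2_sqr.
exact: L1_cst.
Qed.

Lemma cauchy_schwarz f h : L2_S1 f -> L2_S1 h ->
  intS1 (fun t => f t * h t) ^+ 2 <= sqS1 f * sqS1 h.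
Proof.
move=> Lf Lh.
set I := intS1 _.
have Q a : 0 <= a ^+ 2 * sqS1 f + 2 * a * I + sqS1 h.
  by rewrite /I -sqS1_lin//; exact: sqS1_ge0.
have [f0|f0] := eqVneq (sqS1 f) 0.
  rewrite f0 mul0r.
  have [->|I0] := eqVneq I 0; first by rewrite expr0n.
  (* With a null [f] the quadratic is affine in its argument, and this argument would give it the
     value -1. *)
  have := Q (- (sqS1 h + 1) / (2 * I)).
  rewrite f0 mulr0 add0r (_ : 2 * _ * I = - (sqS1 h + 1)); last by field.
  by move=> ?; lra.
have f0' : 0 < sqS1 f by rewrite lt_neqAle eq_sym f0 sqS1_ge0.
(* The minimizer of the quadratic. *)
have := Q (- I / sqS1 f).
rewrite (_ : _ + _ + _ = sqS1 h - I ^+ 2 / sqS1 f); last by field.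
by rewrite subr_ge0 ler_pdivrMr// mulrC.
Qed.

End SquareIntegrable.

(** * Fractional parts and periodic extension *)

Section PeriodicExtension.
Context {R : realType}.
Local Notation mu := (@lebesgue_measure R).
Implicit Types F f h : R -> R.

Definition fracp (t : R) : R := t - (Num.floor t)%:~R.

Lemma fracp_itv t : 0 <= fracp t < 1.
Proof.
have := floor_itv t; rewrite intrD -[1%:~R]/(1 : R) /fracp => /andP[? ?].
by apply/andP; split; lra.
Qed.

Lemma fracp_id t : 0 <= t < 1 -> fracp t = t.
Proof.
move=> t01; rewrite /fracp (_ : Num.floor t = 0) ?subr0//.
by apply: floor_def; rewrite add0r.
Qed.

Lemma fracpD1 t : fracp (t + 1) = fracp t.
Proof.
have /andP[t0 t1] := floor_itv t.
rewrite /fracp (_ : Num.floor (t + 1) = Num.floor t + 1).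
  by rewrite intrD -[1%:~R]/(1 : R); ring.
apply: floor_def; move: t0 t1; rewrite !intrD -[1%:~R]/(1 : R) => t0 t1.
by apply/andP; split; lra.
Qed.

Lemma measurable_fracp : measurable_fun [set: R] fracp.
Proof.
apply: measurable_funB => //; apply: nondecreasing_measurable => // x y xy.
by rewrite ler_int le_floor.
Qed.

(** Only the values of [F] on [0, 1) count: at 1 the extension takes the value F 0. *)
Definition per F : R -> R := fun t => F (fracp t).

Lemma perE F t : 0 <= t < 1 -> per F t = F t.
Proof. by move=> t01; rewrite /per fracp_id. Qed.

Lemma per1 F : per F 1 = F 0.
Proof. by rewrite /per -[1 in LHS]add0r fracpD1 fracp_id// lexx ltr01. Qed.

Lemma periodic_per F : periodic (per F) 1.
Proof. by move=> t; rewrite /per fracpD1. Qed.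

Lemma measurable_per F : measurable_fun (`[0, 1] : set R) F ->
  measurable_fun [set: R] (per F).
Proof.
rewrite (_ : per F = F \o fracp)// => mF.
apply: (measurable_comp (F := (`[0, 1]%classic : set R))) => //.
  by move=> _ [t _ <-]; rewrite /= in_itv/=; have /andP[-> /ltW ->] := fracp_itv t.
exact: measurable_fracp.
Qed.

Lemma L2_bounded f (M : R) : periodic f 1 -> measurable_fun [set: R] f ->
  (forall t, `|f t| <= M) -> L2_S1 f.
Proof.
move=> pf mf fM; split => //; apply: (@L1_bounded _ _ (M ^+ 2)).
  by apply: measurable_funX; exact: measurable_funTS.
by move=> t _; rewrite normrX lerXn2r ?nnegrE ?(le_trans _ (fM t)).
Qed.

Lemma L2_per F (M : R) : measurable_fun (`[0, 1] : set R) F ->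
  (forall t, 0 <= t <= 1 -> `|F t| <= M) -> L2_S1 (per F).
Proof.
move=> mF FM; apply: (@L2_bounded _ M).
- exact: periodic_per.
- exact: measurable_per.
- by move=> t; apply: FM; have /andP[-> /ltW ->] := fracp_itv t.
Qed.

End PeriodicExtension.

(** * Step functions on the uniform grid *)

Section StepFunctions.
Context {R : realType}.
Local Notation mu := (@lebesgue_measure R).

Lemma interpN_in (N : nat) (f : 'rV[R]_N) (m : 'I_N) (t : R) : (0 < N)%N ->
  m%:R / N%:R <= t < m.+1%:R / N%:R -> interpN f t = f 0 m.
Proof.
move=> N0 /andP[mt tm]; have N0' : 0 < N%:R :> R by rewrite ltr0n.
have t01 : 0 <= t < 1.
  rewrite (le_trans _ mt) ?divr_ge0// (lt_le_trans tm)//.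
  by rewrite ler_pdivrMr// mul1r ler_nat.
rewrite /interpN -/(fracp t) fracp_id// (bigD1 m)//= indicE mem_set; last first.
  by rewrite /= in_itv/= mt tm.
rewrite mulr1 big1 ?addr0// => i im.
rewrite indicE memNset ?mulr0//= in_itv/= => /andP[it ti].
move: im; rewrite neq_ltn => /orP[im|mi].
- have : i.+1%:R / N%:R <= m%:R / N%:R :> R by rewrite ler_pM2r ?invr_gt0// ler_nat.
  by move=> ?; lra.
- have : m.+1%:R / N%:R <= i%:R / N%:R :> R by rewrite ler_pM2r ?invr_gt0// ler_nat.
  by move=> ?; lra.
Qed.

Lemma cell_exists (N : nat) (t : R) : (0 < N)%N -> 0 <= t < 1 ->
  exists m : 'I_N, m%:R / N%:R <= t < m.+1%:R / N%:R.
Proof.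
move=> N0 /andP[t0 t1]; have N0' : 0 < N%:R :> R by rewrite ltr0n.
have Nt0 : 0 <= N%:R * t by rewrite mulr_ge0.
have /andP[a b] := truncn_itv Nt0.
have mN : (Num.truncn (N%:R * t) < N)%N.
  rewrite -(ltr_nat R) (le_lt_trans a)// -[ltRHS]mulr1.
  by rewrite ltr_pM2l.
by exists (Ordinal mN); rewrite /= ler_pdivrMr// ltr_pdivlMr// (mulrC t) a.
Qed.

Lemma interpN_periodic (N : nat) (f : 'rV[R]_N) : periodic (interpN f) 1.
Proof.
by move=> t; apply: eq_bigr => m _; rewrite -/(fracp (t + 1)) fracpD1.
Qed.

Lemma measurable_interpN (N : nat) (f : 'rV[R]_N) :
  measurable_fun [set: R] (interpN f).
Proof.
apply: measurable_sum => m; apply: measurable_funM => //.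
by apply: measurableT_comp => //; exact: measurable_fracp.
Qed.

Lemma interpN_bounded (N : nat) (f : 'rV[R]_N) (t : R) :
  `|interpN f t| <= \sum_(m < N) `|f 0 m|.
Proof.
apply: (le_trans (ler_norm_sum _ _ _)); apply: ler_sum => m _.
rewrite normrM ler_piMr// indicE ger0_norm//.
by case: (_ \in _).
Qed.

Lemma L2_interpN (N : nat) (f : 'rV[R]_N) : L2_S1 (interpN f).
Proof.
apply: (L2_bounded (interpN_periodic f) (measurable_interpN f)).
exact: interpN_bounded.
Qed.

(** A general [G] covers both the mean ([G] the identity) and the squared norm. *)
Lemma intS1_interpN (N : nat) (f : 'rV[R]_N) (G : R -> R) : (0 < N)%N ->
  L1 (fun t => G (interpN f t)) ->
  intS1 (fun t => G (interpN f t)) = N%:R^-1 * \sum_(i < N) G (f 0 i).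
Proof.
move=> N0 LG; have N0' : 0 < N%:R :> R by rewrite ltr0n.
rewrite (intS1_cells N0 LG) mulr_sumr; apply: eq_bigr => i _.
rewrite (@Rintegral_itvoo_eq _ _ (fun=> G (f 0 i)))//.
- rewrite Rintegral_cst// fine_mu_itv; last first.
    by rewrite ler_pM2r ?invr_gt0// ler_nat.
  by rewrite -mulrBl -natrB// subSnn mul1r mulrC.
- exact: L1_cst.
- by rewrite ler_pdivrMr// mul1r ler_nat.
- by move=> t /andP[/ltW it ti]; rewrite (@interpN_in _ _ i)// it.
Qed.

Lemma sqS1_interpN (N : nat) (f : 'rV[R]_N) : (0 < N)%N ->
  sqS1 (interpN f) = N%:R^-1 * \sum_(i < N) f 0 i ^+ 2.
Proof.
move=> N0; apply: (@intS1_interpN _ _ (fun x => x ^+ 2) N0).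
exact/L2_sqr/L2_interpN.
Qed.

End StepFunctions.

(** * Primitives of L^2 functions *)

Section Primitive.
Context {R : realType}.
Local Notation mu := (@lebesgue_measure R).
Implicit Types f h : R -> R.

Local Notation TR := (measurableTypeR R).

Definition prim h (t : R) : R := \int[mu]_(s in `[0, t]) h s.

Lemma prim0 h : prim h 0 = 0.
Proof. by rewrite /prim set_itv1 Rintegral_set1. Qed.

Lemma prim1 h : prim h 1 = intS1 h.
Proof. by []. Qed.

Lemma primB h (s t : R) : L1 h -> 0 <= s -> s <= t -> t <= 1 ->
  prim h t - prim h s = \int[mu]_(x in `[s, t]) h x.
Proof.
by move=> Lh s0 st t1; rewrite /prim (@Rintegral_chasles _ h 0 s t)//; ring.
Qed.

(** Cauchy-Schwarz on [s, t] makes a primitive Hoelder continuous of exponent 1/2; this is the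
    source of the rate 1/N in [lift_close] and [nodes_close]. *)
Lemma sqr_primB_le h (s t : R) : L2_S1 h -> 0 <= s <= 1 -> 0 <= t <= 1 ->
  (prim h t - prim h s) ^+ 2 <= `|t - s| * sqS1 h.
Proof.
move=> Lh; wlog st : s t / s <= t.
  move=> H s01 t01; have [st|/ltW ts] := leP s t; first exact: H.
  by rewrite -sqrrN opprB distrC H.
move=> /andP[s0 s1] /andP[t0 t1]; rewrite ger0_norm ?subr_ge0//.
rewrite primB//; last exact: L2_L1.
apply: le_trans (sqr_Rintegral_le s0 st t1 (L2_L1 Lh) (L2_sqr Lh)) _.
rewrite ler_wpM2l ?subr_ge0//; apply: Rintegral_itv_le => //.
- exact: L2_sqr.
- by move=> x; exact: sqr_ge0.
Qed.

Lemma prim_within_continuous h : L1 h -> {within `[0, 1], continuous (prim h)}.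
Proof. by move=> Lh; exact: parameterized_integral_continuous. Qed.

Lemma measurable_prim h : L1 h -> measurable_fun (`[0, 1] : set R) (prim h).
Proof.
move=> Lh; apply: subspace_continuous_measurable_fun => //.
exact: prim_within_continuous.
Qed.

Lemma normr_prim_le h t : L2_S1 h -> 0 <= t <= 1 -> `|prim h t| <= 1 + sqS1 h.
Proof.
move=> Lh t01; have := @sqr_primB_le _ 0 t Lh _ t01.
rewrite lexx ler01 prim0 !subr0 => /(_ isT).
have /andP[t0 t1] := t01; rewrite (ger0_norm t0).
have q0 := sqS1_ge0 h.
have : t * sqS1 h <= sqS1 h by rewrite ler_piMl.
move=> a b; rewrite ler_norml; apply/andP; split; nra.
Qed.

(** The H^1 function with value [c] at 0 and derivative [h]; the graph closes up on the circle when
    [h] has mean zero. *)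
Definition primS1 (c : R) h : R -> R := per (fun t => c + prim h t).

Lemma L2_primS1 c h : L2_S1 h -> L2_S1 (primS1 c h).
Proof.
move=> Lh; apply: (@L2_per _ _ (`|c| + (1 + sqS1 h))).
  by apply: measurable_funD => //; apply: measurable_prim; exact: L2_L1.
move=> t t01; rewrite (le_trans (ler_normD _ _))// lerD2l.
exact: normr_prim_le.
Qed.

Lemma primS1E c h t : intS1 h = 0 -> 0 <= t <= 1 -> primS1 c h t = c + prim h t.
Proof.
move=> h0 /andP[t0]; rewrite le_eqVlt => /predU1P[->|t1].
  by rewrite /primS1 per1 prim0 prim1 h0.
by rewrite /primS1 perE// t0.
Qed.

Lemma sqr_primS1B_le c h (s t : R) : L2_S1 h -> intS1 h = 0 ->
  0 <= s <= 1 -> 0 <= t <= 1 ->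
  (primS1 c h t - primS1 c h s) ^+ 2 <= `|t - s| * sqS1 h.
Proof.
move=> Lh h0 s01 t01; rewrite !primS1E//.
rewrite (_ : _ - _ = prim h t - prim h s); last by ring.
exact: sqr_primB_le.
Qed.

(** A Sobolev embedding: F(t)^2 <= 2 (F(t) - F(s))^2 + 2 F(s)^2 is averaged over s, the increment
    being controlled by the Hoelder estimate. *)
Lemma sqr_primS1_le c h (t : R) : L2_S1 h -> intS1 h = 0 -> 0 <= t <= 1 ->
  primS1 c h t ^+ 2 <= 2 * sqS1 h + 2 * sqS1 (primS1 c h).
Proof.
move=> Lh h0 t01; set F := primS1 c h.
have LF : L2_S1 F by exact: L2_primS1.
rewrite -(intS1_cst (F t ^+ 2)) -[X in X + _](intS1_cst (2 * sqS1 h)).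
rewrite -[X in _ + X]intS1Z; last exact: L2_sqr.
rewrite -intS1D; [|exact: L1_cst|exact/L1Z/L2_sqr].
apply: le_intS1; first exact: L1_cst.
  by apply: L1D; [exact: L1_cst|exact/L1Z/L2_sqr].
move=> s s01.
have := sqr_primS1B_le c Lh h0 s01 t01; rewrite -/F => H.
have : `|t - s| * sqS1 h <= sqS1 h.
  rewrite ler_piMl ?sqS1_ge0// ler_norml.
  by move: s01 t01 => /andP[? ?] /andP[? ?]; apply/andP; split; lra.
by have := sqr_ge0 (F t - 2 * F s); nra.
Qed.

Lemma continuous_bounded01 f : continuous f ->
  exists M : R, forall t : R, 0 <= t <= 1 -> `|f t| <= M.
Proof.
move=> cf; have cnf : {within `[0, 1], continuous (fun t => `|f t|)}.
  by apply: continuous_subspaceT => t; apply: cvg_norm; exact: cf.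
have [c _ cM] := EVT_max ler01 cnf.
by exists `|f c| => t t01; apply: cM; rewrite in_itv.
Qed.

End Primitive.

(** * Integration by parts for primitives of integrable functions *)

Section IntegrationByParts.
Context {R : realType}.
Local Notation mu := (@lebesgue_measure R).
Local Notation TR := (measurableTypeR R).
Implicit Types f h : R -> R.

(* Fubini on the triangle [s <= t]. *)
Lemma ibp_prim h (phi psi : R -> R) : L1 h ->
  (forall t : R, is_derive t (1 : R) phi (psi t)) ->
  continuous psi ->
  intS1 (fun t => prim h t * psi t)
    = phi 1 * intS1 h - intS1 (fun t => h t * phi t).
Proof.
move=> Lh dphi' cphi'.
have dphi (t : R) : derivable phi t 1 by case: (dphi' t).
have cphi : continuous phi.
  by move=> t; apply: differentiable_continuous; apply/derivable1_diffP.
have [M0 phiM] : exists M : R, forall t : R, 0 <= t <= 1 -> `|phi t| <= M.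
  exact: continuous_bounded01.
have Lhphi : L1 (fun t => h t * phi t).
  apply: (L1M Lh _ phiM).
  by apply: measurable_funTS; exact: continuous_measurable_fun.
(* Extension by zero lets Fubini run on the whole plane; the kernel [k] is h(s) psi(t) on the
   triangle. *)
pose a : R -> R := h \_ `[0, 1]; pose b : R -> R := psi \_ `[0, 1].
pose T : set (TR * TR) := [set z : TR * TR | z.1 <= z.2].
pose k (z : TR * TR) := (a z.1 * b z.2 * \1_T z)%:E.
have mh := L1_measurable Lh.
have ma : measurable_fun [set: TR] a by apply/(measurable_restrictT h).
have mb : measurable_fun [set: TR] b.
  apply/(measurable_restrictT psi) => //.
  by apply: measurable_funTS; exact: continuous_measurable_fun.
have mT : measurable T.
  by rewrite -[T]setTI; apply: measurable_fun_le.
have mk : measurable_fun [set: TR * TR] k.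
  apply/measurable_EFinP; apply: measurable_funM => //.
  by apply: measurable_funM; apply: measurableT_comp.
have mk' : measurable_fun [set: TR * TR] (abse \o k) by exact: measurableT_comp.
have mna : measurable_fun [set: TR] (fun x => `|a x|%:E).
  by apply/measurable_EFinP; exact: measurableT_comp.
have mnb : measurable_fun [set: TR] (fun x => `|b x|%:E).
  by apply/measurable_EFinP; exact: measurableT_comp.
have La : mu.-integrable [set: R] (EFin \o a).
  by rewrite /a -restrict_EFin; apply/(integrable_mkcond _ _).1.
have Lb : mu.-integrable [set: R] (EFin \o b).
  rewrite /b -restrict_EFin; apply/(integrable_mkcond _ _).1 => //.
  exact: L1_continuous.
have ik : ((mu \x mu)%E).-integrable [set: TR * TR] k.
  apply/integrable12ltyP => //.
  apply: (@le_lt_trans _ _ (\int[mu]_x (`|a x|%:E * \int[mu]_y `|b y|%:E))%E).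
    apply: ge0_le_integral => //.
    - by move=> x _; apply: integral_ge0.
    - apply: (measurable_fun_fubini_tonelli_F (abse \o k)).
      + exact: mk'.
      + by move=> z; exact: abse_ge0.
    - exact: emeasurable_funM.
    - move=> x _; rewrite -ge0_integralZl//.
      apply: ge0_le_integral => //.
      + exact: measurableT_comp mk' _.
      + exact: emeasurable_funM.
      + move=> y _; rewrite lee_fin !normrM ler_piMr ?mulr_ge0//.
        by rewrite indicE; case: (_ \in _); rewrite ?normr1 ?normr0.
  have /integrableP[_ Lb'] := Lb; have /integrableP[_ La'] := La.
  rewrite ge0_integralZr//; last 1 first.
  - exact: integral_ge0.
  apply: lte_mul_pinfty => //; first exact: integral_ge0.
  by rewrite ge0_fin_numE//; exact: integral_ge0.
have inT (x y : R) : ((x, y) \in T) = (x <= y).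
  by apply/idP/idP; rewrite inE.
(* Integrating out the variable of [h] leaves [prim h] times [psi]. *)
have E1 y : (\int[mu]_x k (x, y) = ((EFin \o (fun t => prim h t * psi t)%R) \_ `[0%R, 1%R]) y)%E.
  rewrite patchE; case: ifPn => [|y01]; last first.
    by apply: integral0_eq => x _; rewrite /k /b patchE (negbTE y01) mulr0 mul0r.
  rewrite inE/= in_itv/= => y01.
  transitivity (\int[mu]_(x in `[0%R, y]) (h x * psi y)%:E)%E.
    rewrite [RHS]integral_mkcond; apply: eq_integral => x _.
    rewrite /k /a /b !patchE !indicE inT !mem_setE/= !in_itv/= y01.
    move: y01 => /andP[y0 y1].
    have [x0|x0] := leP 0 x; last by rewrite !mul0r.
    have [xy|xy] := leP x y; last by rewrite mulr0.
    by rewrite (le_trans xy y1) mulr1.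
  have Lhy : mu.-integrable `[0, y] (EFin \o h) by apply: L1_subitv => //; lra.
  rewrite -[LHS]fineK; last first.
    apply: integrable_fin_num => //.
    exact: (integrableZr _ (psi y) Lhy).
  by congr EFin; apply: RintegralZr.
(* Integrating out the variable of [psi] leaves [h] times an increment of [phi]. *)
have E2 x : (\int[mu]_y k (x, y) = ((EFin \o (fun t => h t * (phi 1 - phi t))%R) \_ `[0%R, 1%R]) x)%E.
  rewrite patchE; case: ifPn => [|x01]; last first.
    by apply: integral0_eq => y _; rewrite /k /a patchE (negbTE x01) !mul0r.
  rewrite inE/= in_itv/= => x01.
  transitivity (\int[mu]_(y in `[x, 1%R]) (h x * psi y)%:E)%E.
    rewrite [RHS]integral_mkcond; apply: eq_integral => y _.
    rewrite /k /a /b !patchE !indicE inT !mem_setE/= !in_itv/= x01.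
    move: x01 => /andP[x0 x1].
    have [xy|xy] := leP x y; last by rewrite mulr0.
    rewrite (le_trans x0 xy); have [y1|y1] := leP y 1; last by rewrite mulr0 mul0r.
    by rewrite mulr1.
  have Lhx : mu.-integrable `[x, 1] (EFin \o psi).
    by apply: L1_subitv; [lra|lra|exact: L1_continuous].
  rewrite -[LHS]fineK; last first.
    apply: integrable_fin_num => //.
    exact: (integrableZl _ (h x) Lhx).
  congr EFin; rewrite -/(Rintegral mu `[x, 1] (fun y => h x * psi y)).
  rewrite RintegralZl//; congr (_ * _).
  have /andP[_] := x01; rewrite le_eqVlt => /predU1P[->|x1].
    by rewrite set_itv1 Rintegral_set1 subrr.
  rewrite /Rintegral (@continuous_FTC2 _ _ phi)//.
  - exact: continuous_subspaceT.
  - split.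
    + by move=> *; exact: dphi.
    + exact/cvg_at_right_filter/cphi.
    + exact/cvg_at_left_filter/cphi.
  - by move=> t _; rewrite derive1E derive_val.
have := Fubini ik.
under eq_integral do rewrite E2.
under [in RHS]eq_integral do rewrite E1.
rewrite -!integral_mkcond => /(congr1 fine) H.
rewrite /intS1 -[LHS]H -/(intS1 (fun t => h t * (phi 1 - phi t))).
rewrite -intS1Z// -intS1B//; last exact: L1Z.
by apply: eq_intS1 => t _; ring.
Qed.
End IntegrationByParts.

(** * Smooth periodic bumps and the fundamental lemma *)

Section SmoothBumps.
Context {R : realType}.
Local Notation mu := (@lebesgue_measure R).

(** Membership in a class stable under differentiation replaces a formula for the n-th
    derivative. *)
Lemma smooth_of_closed (A : set (R -> R)) :
  (forall f, A f -> exists2 g, A g & forall t : R, is_derive t (1 : R) f (g t)) ->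
  forall f, A f -> forall (n : nat) (t : R), derivable (derive1n n f) t 1.
Proof.
move=> HA f Af; have An : forall n, A (derive1n n f).
  elim=> [//|n /HA[g Ag dg]].
  rewrite derive1nS (_ : derive1 _ = g)//.
  by apply/funext => t; rewrite derive1E; have [_ ->] := dg t.
by move=> n t; have [g _ /(_ t)[]] := HA _ (An n).
Qed.

(** Both sines change sign under t -> t + 1, so the product has period 1; inside (0, 1) it is
    positive on (a, b) and negative outside [a, b]. *)
Definition bumpq (a b t : R) : R := sin (pi * (t - a)) * sin (pi * (b - t)).

(** The logistic function of k times [bumpq]: as k grows it tends to the indicator of [a, b] at
    almost every point of [0, 1], while staying smooth and periodic. *)
Definition bump (a b k t : R) : R := (1 + expR (- (k * bumpq a b t)))^-1.

(** The algebra generated by the trigonometric factors and the bump. The logistic equation y' = y (1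
    - y) makes it stable under differentiation, as [smooth_of_closed] requires. *)
Inductive bump_algebra (a b k : R) : (R -> R) -> Prop :=
| BumpCst c : bump_algebra a b k (fun=> c)
| BumpSinl : bump_algebra a b k (fun t => sin (pi * (t - a)))
| BumpCosl : bump_algebra a b k (fun t => cos (pi * (t - a)))
| BumpSinr : bump_algebra a b k (fun t => sin (pi * (b - t)))
| BumpCosr : bump_algebra a b k (fun t => cos (pi * (b - t)))
| BumpBump : bump_algebra a b k (bump a b k)
| BumpD f g : bump_algebra a b k f -> bump_algebra a b k g ->
    bump_algebra a b k (fun t => f t + g t)
| BumpM f g : bump_algebra a b k f -> bump_algebra a b k g ->
    bump_algebra a b k (fun t => f t * g t).

Lemma is_derive_affl (a t : R) : is_derive t (1 : R) (fun t => pi * (t - a)) pi.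
Proof.
rewrite (_ : (fun t => pi * (t - a)) = (pi \*: (id - cst a))); last first.
  by apply/funext => x.
by apply: is_derive_eq; rewrite subr0 [LHS]mulr1.
Qed.

Lemma is_derive_affr (b t : R) :
  is_derive t (1 : R) (fun t => pi * (b - t)) (- pi).
Proof.
rewrite (_ : (fun t => pi * (b - t)) = (pi \*: (cst b - id))); last first.
  by apply/funext => x.
by apply: is_derive_eq; rewrite sub0r [LHS]mulrN1.
Qed.

Lemma is_derive_sinl (a t : R) :
  is_derive t (1 : R) (fun t => sin (pi * (t - a))) (pi * cos (pi * (t - a))).
Proof.
rewrite mulrC; apply: (@is_derive1_comp _ sin (fun t => pi * (t - a))).
exact: is_derive_affl.
Qed.

Lemma is_derive_cosl (a t : R) :
  is_derive t (1 : R) (fun t => cos (pi * (t - a))) (- pi * sin (pi * (t - a))).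
Proof.
rewrite mulNr mulrC -mulNr; apply: (@is_derive1_comp _ cos (fun t => pi * (t - a))).
exact: is_derive_affl.
Qed.

Lemma is_derive_sinr (b t : R) :
  is_derive t (1 : R) (fun t => sin (pi * (b - t))) (- pi * cos (pi * (b - t))).
Proof.
rewrite mulrC; apply: (@is_derive1_comp _ sin (fun t => pi * (b - t))).
exact: is_derive_affr.
Qed.

Lemma is_derive_cosr (b t : R) :
  is_derive t (1 : R) (fun t => cos (pi * (b - t))) (pi * sin (pi * (b - t))).
Proof.
rewrite mulrC -mulrNN; apply: (@is_derive1_comp _ cos (fun t => pi * (b - t))).
exact: is_derive_affr.
Qed.

Lemma is_derive_bumpq (a b t : R) : is_derive t (1 : R) (bumpq a b)
  (pi * cos (pi * (t - a)) * sin (pi * (b - t))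
   + - pi * sin (pi * (t - a)) * cos (pi * (b - t))).
Proof.
have d1 := is_derive_sinl a t; have d2 := is_derive_sinr b t.
apply: (is_derive_eq (is_deriveM d1 d2)).
by rewrite /= /GRing.scale/=; ring.
Qed.

Lemma bump_den_gt0 (a b k t : R) : 0 < 1 + expR (- (k * bumpq a b t)).
Proof. by rewrite ltr_wpDr ?expR_ge0. Qed.

Lemma is_derive_bump (a b k t : R) : is_derive t (1 : R) (bump a b k)
  (k * (bump a b k t * (1 + - 1 * bump a b k t)) *
   (pi * cos (pi * (t - a)) * sin (pi * (b - t))
     + - pi * sin (pi * (t - a)) * cos (pi * (b - t)))).
Proof.
have dq := is_derive_bumpq a b t.
have dk : is_derive t (1 : R) (fun t => - (k * bumpq a b t))
    (- (k * derive1 (bumpq a b) t)).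
  rewrite (_ : (fun t => - (k * bumpq a b t)) = (- (k \*: bumpq a b))); last first.
    by apply/funext => x.
  by apply: is_derive_eq; rewrite derive1E derive_val.
have de := @is_derive1_comp _ expR (fun t => - (k * bumpq a b t)) t _ _
  (is_derive_expR (- (k * bumpq a b t))) dk.
have dd : is_derive t (1 : R) (fun t => 1 + expR (- (k * bumpq a b t)))
    (expR (- (k * bumpq a b t)) * - (k * derive1 (bumpq a b) t)).
  rewrite (_ : (fun t => _) = (cst 1 + (expR \o (fun t => - (k * bumpq a b t))))); last first.
    by apply/funext => x.
  by apply: is_derive_eq; rewrite add0r.
have nz : 1 + expR (- (k * bumpq a b t)) != 0 by rewrite gt_eqF// bump_den_gt0.
have dv : is_derive t (1 : R) (bump a b k) _ :=
  @is_deriveV R (fun t => 1 + expR (- (k * bumpq a b t))) t _ 1 nz dd.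
apply: (is_derive_eq dv).
rewrite derive1E derive_val /GRing.scale/= /bump.
by field.
Qed.

Lemma bump_algebra_derive (a b k : R) f : bump_algebra a b k f ->
  exists2 g, bump_algebra a b k g & forall t : R, is_derive t (1 : R) f (g t).
Proof.
elim=> [c|||||| f1 f2 _ [g1 A1 d1] _ [g2 A2 d2]|f1 f2 A1' [g1 A1 d1] A2' [g2 A2 d2]].
- by exists (fun=> 0); [exact: BumpCst|move=> t; exact: is_derive_cst].
- eexists; last exact: is_derive_sinl.
  by apply: BumpM; [exact: BumpCst|exact: BumpCosl].
- eexists; last exact: is_derive_cosl.
  by apply: BumpM; [exact: BumpCst|exact: BumpSinl].
- eexists; last exact: is_derive_sinr.
  by apply: BumpM; [exact: BumpCst|exact: BumpCosr].
- eexists; last exact: is_derive_cosr.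
  by apply: BumpM; [exact: BumpCst|exact: BumpSinr].
- eexists; last exact: is_derive_bump.
  by repeat (exact: BumpCst || exact: BumpSinl || exact: BumpSinr ||
    exact: BumpCosl || exact: BumpCosr || exact: BumpBump ||
    apply: BumpM || apply: BumpD).
- exists (fun t => g1 t + g2 t); first exact: BumpD.
  by move=> t; exact: is_deriveD.
- exists (fun t => f1 t * g2 t + f2 t * g1 t).
    by apply: BumpD; exact: BumpM.
  by move=> t; exact: is_deriveM.
Qed.

Lemma sinDpiN (x : R) : sin (x + pi) = - sin x.
Proof. by rewrite sinD cospi sinpi mulrN1 mulr0 addr0. Qed.

Lemma bumpq_periodic (a b : R) : periodic (bumpq a b) 1.
Proof.
move=> t; rewrite /bumpq (_ : pi * (t + 1 - a) = pi * (t - a) + pi); last by ring.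
rewrite -[pi * (b - (t + 1))](addrK pi) sinDpiN.
rewrite (_ : pi * (b - (t + 1)) + pi = pi * (b - t)); last by ring.
by rewrite -[X in _ = _ * sin X](subrK pi) sinDpiN mulNr mulrN.
Qed.

Lemma bump_Cinfty (a b k : R) : Cinfty_S1 (bump a b k).
Proof.
split; first by move=> t; rewrite /bump bumpq_periodic.
apply: (@smooth_of_closed (bump_algebra a b k)); last exact: BumpBump.
exact: bump_algebra_derive.
Qed.

Lemma sin_pi_gt0 (x : R) : 0 < x < 1 -> 0 < sin (pi * x).
Proof.
move=> /andP[x0 x1]; apply: sin_gt0_pi.
by rewrite mulr_gt0 ?pi_gt0//= -[ltRHS]mulr1 ltr_pM2l// pi_gt0.
Qed.

Lemma bumpq_gt0 (a b t : R) : 0 <= a -> b <= 1 -> a < t < b -> 0 < bumpq a b t.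
Proof.
by move=> a0 b1 /andP[? ?]; rewrite mulr_gt0// sin_pi_gt0//; apply/andP; split; lra.
Qed.

Lemma bumpq_lt0 (a b t : R) : 0 <= a -> a <= b -> b <= 1 -> 0 < t < 1 ->
  (t < a) || (b < t) -> bumpq a b t < 0.
Proof.
move=> a0 ab b1 /andP[t0 t1] /orP[ta|bt]; rewrite /bumpq.
- rewrite -[pi * (t - a)]opprK sinN mulNr oppr_lt0 -mulrN opprB mulr_gt0//.
    by apply: sin_pi_gt0; apply/andP; split; lra.
  by apply: sin_pi_gt0; apply/andP; split; lra.
- rewrite -[pi * (b - t)]opprK sinN mulrN oppr_lt0 -mulrN opprB mulr_gt0//.
    by apply: sin_pi_gt0; apply/andP; split; lra.
  by apply: sin_pi_gt0; apply/andP; split; lra.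
Qed.

Lemma logistic_cvg1 (x : R) : 0 < x ->
  (1 + expR (- (n%:R * x)))^-1 @[n --> \oo] --> (1 : R).
Proof.
move=> x0; rewrite -[X in _ --> X]invr1; apply: cvgV; first exact: oner_neq0.
rewrite -[X in _ --> X]addr0; apply: cvgD; first exact: cvg_cst.
apply: (@cvg_comp _ _ _ (fun n : nat => n%:R * x) (fun y => expR (- y)) _ +oo);
  last exact: cvgr_expR.
apply: (@cvg_comp _ _ _ (fun n : nat => n%:R) (fun y => y * x) _ +oo _ cvgr_idn).
by apply: gt0_cvgMly => //; exact: cvg_id.
Qed.

Lemma logistic_sym (x : R) : (1 + expR x)^-1 = 1 - (1 + expR (- x))^-1.
Proof.
have := expR_gt0 x; rewrite expRN => e0.
by field; rewrite !gt_eqF// ?addr_gt0.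
Qed.

Lemma logistic_cvg0 (x : R) : x < 0 ->
  (1 + expR (- (n%:R * x)))^-1 @[n --> \oo] --> (0 : R).
Proof.
move=> x0.
rewrite (_ : (fun n : nat => _) = (fun n : nat => 1 - (1 + expR (- (n%:R * - x)))^-1)).
  rewrite -(subrr (1 : R)); apply: cvgB; first exact: cvg_cst.
  by apply: logistic_cvg1; rewrite oppr_gt0.
by apply/funext => n; rewrite logistic_sym mulrN.
Qed.

Lemma bump_le1 (a b k t : R) : `|bump a b k t| <= 1.
Proof.
have d0 := bump_den_gt0 a b k t.
rewrite /bump ger0_norm; last by rewrite invr_ge0 ltW.
by rewrite invf_le1// lerDl expR_ge0.
Qed.

Lemma measurable_bump (a b k : R) : measurable_fun [set: R] (bump a b k).
Proof.
apply: continuous_measurable_fun => t; apply: differentiable_continuous.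
by apply/derivable1_diffP; have [] := is_derive_bump a b k t.
Qed.

Lemma finite_ae (P : set R) (s : seq R) : (forall t, t \notin s -> P t) ->
  {ae mu, forall t, P t}.
Proof.
move=> sP; have cs : countable [set` s].
  by apply: finite_set_countable; exact: finite_seq.
exists [set` s]; split.
- exact: countable_measurable.
- exact: countable_lebesgue_measure0.
- by move=> t /= nP; apply: contrapT => /negP /sP.
Qed.

(** Testing against [bump a b n] and letting n tend to infinity produces the indicator of [a, b];
    the bumps are bounded by 1, so |h| dominates. *)
Lemma Cinfty_orthogonal_itv (h : R -> R) (a b : R) : L1 h ->
  (forall phi, Cinfty_S1 phi -> intS1 (fun t => h t * phi t) = 0) ->
  0 <= a -> a <= b -> b <= 1 -> \int[mu]_(t in `[a, b]) h t = 0.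
Proof.
move=> Lh hphi a0 ab b1.
have mh := L1_measurable Lh.
pose f_ (n : nat) t := (h t * bump a b n%:R t)%:E.
pose f t := (h t * \1_(`[a, b] : set R) t)%:E.
have mf_ n : measurable_fun (`[0, 1] : set R) (f_ n).
  apply/measurable_EFinP; apply: measurable_funM => //.
  by apply: measurable_funTS; exact: measurable_bump.
have mf : measurable_fun (`[0, 1] : set R) f.
  by apply/measurable_EFinP; apply: measurable_funM.
(* The four excluded points are those where the sign lemmas for [bumpq] do not apply. *)
have cvf : {ae mu, forall t, (`[0, 1]%classic : set R) t -> f_ ^~ t @ \oo --> f t}.
  apply: (@finite_ae _ [:: 0; 1; a; b]) => t.
  rewrite !inE !negb_or => /and4P[t0 t1 ta tb]; rewrite /= in_itv/= => t01.
  apply: cvg_EFin; first exact: nearW.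
  apply: cvgM; first exact: cvg_cst.
  have t01' : 0 < t < 1 by rewrite !lt_neqAle eq_sym t0 t1.
  rewrite indicE mem_setE/= in_itv/=.
  have [/andP[at_ tb_]|ntab] := boolP (a <= t <= b).
    apply: logistic_cvg1; apply: bumpq_gt0 => //.
    by rewrite !lt_neqAle eq_sym ta tb at_.
  apply: logistic_cvg0; apply: bumpq_lt0 => //.
  by move: ntab; rewrite negb_and -!ltNge.
have dom : {ae mu, forall t (n : nat), (`[0, 1]%classic : set R) t -> (`|f_ n t| <= `|h t|%:E)%E}.
  apply: aeW => t n _; rewrite lee_fin normrM ler_piMr//; exact: bump_le1.
have Lnh : mu.-integrable `[0, 1] (fun t => `|h t|%:E) by exact: L1_norm.
have [Lf _ cv] := @dominated_convergence _ (measurableTypeR R) R mu `[0, 1]%classic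
  (measurable_itv _) f_ f (fun t => `|h t|%:E) mf_ mf cvf Lnh dom.
have f0 n : (\int[mu]_(t in `[0%R, 1%R]) f_ n t = 0)%E.
  rewrite -[LHS]fineK; last first.
    apply: integrable_fin_num => //.
    apply: (@L1M _ _ _ 1) => //.
      by apply: measurable_funTS; exact: measurable_bump.
    by move=> t _; exact: bump_le1.
  by rewrite [X in X%:E]hphi//; exact: bump_Cinfty.
have : (\int[mu]_(t in `[0%R, 1%R]) f t = 0)%E.
  rewrite -(cvg_lim _ cv)// (_ : [sequence _]_n = cst 0%E) ?lim_cst//.
  by apply/funext => n /=; exact: f0.
rewrite /Rintegral => If.
rewrite (_ : `[a, b]%classic = `[0, 1] `&` `[a, b] :> set R); last first.
  apply/seteqP; split => t /=; rewrite !in_itv/=; last by case.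
  by move=> /andP[? ?]; split; [apply/andP; split; lra|apply/andP].
rewrite integral_mkcondr -[RHS](congr1 fine If); congr fine.
apply: eq_integral => t _; rewrite /f patchE indicE.
by case: (_ \in _); rewrite ?mulr1 ?mulr0.
Qed.

(** Lebesgue differentiation of the primitive of the zero extension of [h], which vanishes
    identically. *)
Lemma itv_zero_ae (h : R -> R) : L1 h ->
  (forall a b, 0 <= a -> a <= b -> b <= 1 -> \int[mu]_(t in `[a, b]) h t = 0) ->
  {ae mu, forall t, 0 <= t <= 1 -> h t = 0}.
Proof.
move=> Lh h0; pose k := h \_ `[0, 1].
have Lk : mu.-integrable [set: R] (EFin \o k).
  by rewrite /k -restrict_EFin; apply/(integrable_mkcond _ _).1.
have Lki y : mu.-integrable [set` Interval (BLeft 0) (BRight y)] (EFin \o k).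
  exact: integrableS Lk.
have F0 : (fun x => \int[mu]_(t in [set` Interval (BLeft 0) (BRight x)]) k t) = cst 0.
  apply/funext => x; rewrite -Rintegral_mkcondr.
  have [x1|x1] := leP x 1.
    have [x0|x0] := leP 0 x.
      rewrite (_ : _ `&` _ = `[0, x]%classic); first exact: h0.
      apply/seteqP; split => t /=; rewrite !in_itv/=; first by case.
      by move=> /andP[? ?]; split; apply/andP; split; lra.
    rewrite (_ : _ `&` _ = set0) ?Rintegral_set0//.
    apply/seteqP; split => t //=; rewrite !in_itv/= => -[/andP[? ?] _]; lra.
  rewrite (_ : _ `&` _ = `[0, 1]%classic); first exact: h0.
  apply/seteqP; split => t /=; rewrite !in_itv/=; first by case.
  by move=> /andP[? ?]; split; apply/andP; split; lra.
have ne0 : {ae mu, forall t : R, t != 0}.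
  by apply: (@finite_ae _ [:: 0]) => t; rewrite inE.
have := FTC1 Lki (open_integrable_locally openT Lk); rewrite /= F0.
apply: (@filterS2 _ _ (ae_filter_ringOfSetsType mu) _ _ _ _ ne0) => t t0 + t01.
have t0' : 0 < t by rewrite lt_neqAle eq_sym t0 (andP t01).1.
rewrite lte_fin => /(_ t0')[_].
by rewrite derive1_cst /k patchE mem_setE/= in_itv/= t01 => <-.
Qed.

Lemma fundamental_lemma (h : R -> R) : L1 h ->
  (forall phi, Cinfty_S1 phi -> intS1 (fun t => h t * phi t) = 0) ->
  {ae mu, forall t, 0 <= t <= 1 -> h t = 0}.
Proof.
move=> Lh hphi; apply: itv_zero_ae => // a b a0 ab b1.
exact: Cinfty_orthogonal_itv.
Qed.

End SmoothBumps.

(** * Smooth periodic functions and their antiderivatives *)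

Section PeriodicSmooth.
Context {R : realType}.
Local Notation mu := (@lebesgue_measure R).
Implicit Types f h phi psi : R -> R.

Lemma Cinfty_derivable phi (t : R) : Cinfty_S1 phi -> derivable phi t 1.
Proof. by move=> [_ /(_ 0%N t)]. Qed.

Lemma Cinfty_C phi : Cinfty_S1 phi -> C_S1 phi.
Proof.
move=> Cphi; split=> [|t]; first by case: Cphi.
by apply: differentiable_continuous; apply/derivable1_diffP; exact: Cinfty_derivable.
Qed.

Lemma Cinfty_derive1 phi : Cinfty_S1 phi -> Cinfty_S1 (derive1 phi).
Proof.
move=> [pphi dphi]; split=> [t|n t]; last by rewrite -derive1Sn; exact: dphi.
have e : phi = phi \o shift 1 by apply/funext => x /=; rewrite pphi.
by rewrite [in RHS]e !derive1E; rewrite /derive; under [in RHS]eq_fun do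
  rewrite /= -addrA.
Qed.

Lemma Cinfty_cst (c : R) : Cinfty_S1 (fun=> c).
Proof.
split=> // n t; apply: (@smooth_of_closed _ [set f | exists a : R, f = fun=> a]).
  move=> _ [a ->]; exists (fun=> 0); first by exists 0.
  by move=> x; exact: is_derive_cst.
by exists c.
Qed.

Lemma is_derive_Cinfty phi (t : R) : Cinfty_S1 phi ->
  is_derive t (1 : R) phi (derive1 phi t).
Proof.
by move=> Cphi; rewrite derive1E; apply: derivableP; exact: Cinfty_derivable.
Qed.

Lemma intS1_derive1 phi : Cinfty_S1 phi -> intS1 (derive1 phi) = 0.
Proof.
move=> Cphi; have [pphi cphi] := Cinfty_C Cphi.
have [_ cphi'] := Cinfty_C (Cinfty_derive1 Cphi).
rewrite /intS1 /Rintegral (@continuous_FTC2 _ _ phi) ?ltr01//.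
- by rewrite -[1]add0r pphi -EFinD subrr.
- exact: continuous_subspaceT.
- split.
  + by move=> t _; exact: Cinfty_derivable.
  + exact/cvg_at_right_filter/cphi.
  + exact/cvg_at_left_filter/cphi.
Qed.

(** [Cinfty_S1] asks for derivatives at every real point, and the integral over [0, t] is void for
    negative t; hence the two cases. *)
Definition signed_prim psi (t : R) : R :=
  if 0 <= t then \int[mu]_(s in `[0, t]) psi s
  else - \int[mu]_(s in `[t, 0]) psi s.

Lemma continuous_integrable psi (a b : R) : continuous psi ->
  mu.-integrable `[a, b] (EFin \o psi).
Proof.
move=> cpsi; apply: continuous_compact_integrable; first exact: segment_compact.
exact: continuous_subspaceT.
Qed.

Lemma continuous_chasles psi (a b c : R) : continuous psi -> a <= b -> b <= c ->
  \int[mu]_(t in `[a, c]) psi t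
    = \int[mu]_(t in `[a, b]) psi t + \int[mu]_(t in `[b, c]) psi t.
Proof.
move=> cpsi ab bc.
rewrite -(@Rintegral_itv_obnd_cbnd _ b); last first.
  apply: (integrableS _ _ _ (continuous_integrable b c cpsi)) => //.
  by move=> t; rewrite /= !in_itv/= => /andP[/ltW -> ->].
rewrite -(@Rintegral_itvB _ _ (BLeft a) (BRight c) b) ?bnd_simp//.
  by rewrite addrC subrK.
exact: continuous_integrable.
Qed.

Lemma is_derive_signed_prim psi (t : R) : continuous psi ->
  is_derive t (1 : R) (signed_prim psi) (psi t).
Proof.
(* A base point to the left of both 0 and t: near t, [signed_prim psi] is the primitive from [c]
   minus the constant [A 0]. *)
move=> cpsi; pose c := (if t < 0 then t else 0) - 1.
have ct : c < t by rewrite /c; case: (ltP t 0) => ?; lra.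
have c0 : c < 0 by rewrite /c; case: (ltP t 0) => ?; lra.
pose A y := \int[mu]_(s in `[c, y]) psi s.
have t1 : t < t + 1 by rewrite ltrDl.
have [dA A'] := continuous_FTC1_closed t1 (continuous_integrable _ _ cpsi) ct (cpsi t).
apply: (@near_eq_is_derive _ _ _ (fun y => A y - A 0)); last first.
  have := derivableP dA; rewrite -derive1E A' => dA'.
  apply: (is_derive_eq (is_deriveB dA' (is_derive_cst (A 0) t (1 : R)))).
  by rewrite subr0.
near=> y.
have cy : c < y by near: y; exact: lt_nbhsr.
rewrite /signed_prim; case: leP => y0.
  by rewrite /A (continuous_chasles cpsi (ltW c0) y0) addrC addKr.
by rewrite /A (continuous_chasles cpsi (ltW cy) (ltW y0)) opprD addrA subrr sub0r.
Unshelve. all: by end_near.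
Qed.

(** Removing the mean is what makes the primitive periodic, since its increment over one period is
    then zero. *)
Lemma antiderivative_Cinfty psi : Cinfty_S1 psi -> exists2 phi, Cinfty_S1 phi &
  forall t, derive1 phi t = psi t - intS1 psi.
Proof.
move=> Cpsi; pose psi0 t := psi t - intS1 psi.
have [ppsi cpsi] := Cinfty_C Cpsi.
have cpsi0 : continuous psi0 by move=> t; apply: cvgB; [exact: cpsi|exact: cvg_cst].
have dphi (t : R) := @is_derive_signed_prim psi0 t cpsi0.
have ephi : derive1 (signed_prim psi0) = psi0.
  by apply/funext => t; rewrite derive1E; have [_ ->] := dphi t.
have epsi : derive1 psi0 = derive1 psi.
  apply/funext => t; rewrite !derive1E /psi0.
  by rewrite deriveB//; [rewrite derive_cst subr0|exact: Cinfty_derivable].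
exists (signed_prim psi0); last by rewrite ephi.
split=> [t|n t]; last first.
  case: n => [|n]; first by have [] := dphi t.
  rewrite derive1Sn ephi; case: n => [|n].
    by apply: derivableB => //; exact: Cinfty_derivable.
  by rewrite derive1Sn epsi -derive1Sn; case: Cpsi.
(* The increment over a period has derivative 0, so it keeps its value at 0, which is the integral
   of [psi0]. *)
pose d t := signed_prim psi0 (t + 1) - signed_prim psi0 t.
have d0 (x : R) : is_derive x (1 : R) d 0.
  have d1 : is_derive x (1 : R) (fun t => signed_prim psi0 (t + 1)) (psi0 x).
    rewrite (_ : psi0 x = psi0 (x + 1) * 1); last by rewrite mulr1 /psi0 ppsi.
    apply: (@is_derive1_comp _ (signed_prim psi0) (fun t => t + 1)).
    by apply: is_derive_eq; rewrite addr0.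
  by apply: (is_derive_eq (is_deriveB d1 (dphi x))); rewrite subrr.
have := is_derive_0_is_cst t 0 d0.
have s0 : signed_prim psi0 0 = 0.
  by rewrite /signed_prim lexx set_itv1 Rintegral_set1.
have s1 : signed_prim psi0 1 = 0.
  rewrite /signed_prim ler01 -/(intS1 psi0) intS1B; last 2 first.
  - exact: L1_continuous.
  - exact: L1_cst.
  by rewrite intS1_cst subrr.
by rewrite /d add0r s0 s1 subrr => /eqP; rewrite subr_eq0 => /eqP.
Qed.

(** Every test function minus its mean is a derivative, so [f] minus its own mean is orthogonal to
    all test functions. *)
Lemma du_Bois_Reymond f : L2_S1 f ->
  (forall phi, Cinfty_S1 phi -> intS1 (fun t => f t * derive1 phi t) = 0) ->
  {ae mu, forall t, 0 <= t <= 1 -> f t = intS1 f}.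
Proof.
move=> Lf fphi.
have : {ae mu, forall t, 0 <= t <= 1 -> f t - intS1 f = 0}.
  apply: fundamental_lemma.
    by apply: L1B; [exact: L2_L1|exact: L1_cst].
  move=> psi Cpsi; have [phi Cphi dphi] := antiderivative_Cinfty Cpsi.
  have Lpsi : L2_S1 psi by exact/C_S1_L2/Cinfty_C.
  have := fphi phi Cphi.
  rewrite (@eq_intS1 _ _ (fun t => f t * psi t - intS1 psi * f t)); last first.
    by move=> t _; rewrite dphi; ring.
  rewrite intS1B; [|exact: L2_mul|exact/L1Z/L2_L1].
  rewrite intS1Z; last exact: L2_L1.
  rewrite mulrC -intS1Z; last exact: L2_L1.
  rewrite -intS1B; [|exact: L2_mul|exact/L1Z/L2_L1].
  by move=> <-; apply: eq_intS1 => t _; ring.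
apply: filterS; first exact: (ae_filter_ringOfSetsType mu).
by move=> t H /H /eqP; rewrite subr_eq0 => /eqP.
Qed.

End PeriodicSmooth.

(** * Weak derivatives and H^1 of the circle *)

Section WeakDerivatives.
Context {R : realType}.
Local Notation mu := (@lebesgue_measure R).
Implicit Types f h phi psi : R -> R.

(** Equality on one period only, which is all that [intS1] sees; [ae01_periodic] carries it to the
    whole line. *)
Definition ae01 f h := {ae mu, forall t, 0 <= t <= 1 -> f t = h t}.

Lemma ae01_comp2 (G : R -> R -> R -> R) f1 f2 h1 h2 : ae01 f1 f2 -> ae01 h1 h2 ->
  ae01 (fun t => G (f1 t) (h1 t) t) (fun t => G (f2 t) (h2 t) t).
Proof.
move=> fh; apply: (@filterS2 _ _ (ae_filter_ringOfSetsType mu) _ _ _ _ fh).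
by move=> t H1 H2 t01; rewrite H1// H2.
Qed.

Lemma ae01_refl f : ae01 f f.
Proof. by apply: aeW. Qed.

Lemma ae01_intS1 f h : measurable_fun (`[0, 1] : set R) f ->
  measurable_fun (`[0, 1] : set R) h -> ae01 f h -> intS1 f = intS1 h.
Proof.
move=> mf mh fh; congr fine.
apply: (@ae_eq_integral _ (measurableTypeR R) _ mu) => //.
- exact/measurable_EFinP.
- exact/measurable_EFinP.
- apply: filterS fh; first exact: (ae_filter_ringOfSetsType mu).
  by move=> t fh /=; rewrite in_itv/= => /fh ->.
Qed.

Lemma ae01_sqS1 f h : L2_S1 f -> L2_S1 h -> ae01 f h -> sqS1 f = sqS1 h.
Proof.
move=> Lf Lh fh; apply: ae01_intS1.
- by apply: L1_measurable; exact: L2_sqr.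
- by apply: L1_measurable; exact: L2_sqr.
- exact: (ae01_comp2 (fun x _ _ => x ^+ 2) fh fh).
Qed.

Lemma sqS1_eq0 f : L2_S1 f -> sqS1 f = 0 -> ae01 f (fun=> 0).
Proof.
move=> Lf f0; have Lf2 := L2_sqr Lf.
have : (\int[mu]_(t in `[0%R, 1%R]) `|(f t ^+ 2)%:E| = 0)%E.
  under eq_integral do rewrite gee0_abs ?lee_fin ?sqr_ge0//.
  rewrite -[LHS]fineK; last exact: integrable_fin_num.
  by congr EFin.
move=> /(@ae_eq_integral_abs _ (measurableTypeR R) _ mu _ (measurable_itv _) _ _).1.
move=> /(_ (measurable_int _ Lf2)); apply: filterS.
move=> t /=; rewrite in_itv/= => H /H [] /eqP.
by rewrite sqrf_eq0 => /eqP.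
Qed.

Lemma ae01_of_sqS1 f h : L2_S1 f -> L2_S1 h -> sqS1 (fun t => f t - h t) = 0 ->
  ae01 f h.
Proof.
move=> Lf Lh /(sqS1_eq0 (L2B Lf Lh)).
apply: filterS; first exact: (ae_filter_ringOfSetsType mu).
by move=> t H /H /eqP; rewrite subr_eq0 => /eqP.
Qed.

Lemma L2_Cinfty phi : Cinfty_S1 phi -> L2_S1 phi.
Proof. by move=> /Cinfty_C/C_S1_L2. Qed.

Lemma weak_unique f h1 h2 : L2_S1 h1 -> L2_S1 h2 ->
  is_weak_derivative f h1 -> is_weak_derivative f h2 -> ae01 h1 h2.
Proof.
move=> L1' L2' w1 w2.
have : {ae mu, forall t, 0 <= t <= 1 -> h1 t - h2 t = 0}.
  apply: fundamental_lemma; first by apply/L2_L1/L2B.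
  move=> phi Cphi; have Lphi := L2_Cinfty Cphi.
  rewrite (@eq_intS1 _ _ (fun t => h1 t * phi t - h2 t * phi t)); last first.
    by move=> t _; ring.
  rewrite intS1B; [|exact: L2_mul|exact: L2_mul].
  by apply/eqP; rewrite subr_eq0 -eqr_opp -w1// -w2.
apply: filterS; first exact: (ae_filter_ringOfSetsType mu).
by move=> t H /H /eqP; rewrite subr_eq0 => /eqP.
Qed.

Lemma weak_lin a f1 f2 h1 h2 : L2_S1 f1 -> L2_S1 f2 -> L2_S1 h1 -> L2_S1 h2 ->
  is_weak_derivative f1 h1 -> is_weak_derivative f2 h2 ->
  is_weak_derivative (fun t => a * f1 t + f2 t) (fun t => a * h1 t + h2 t).
Proof.
move=> Lf1 Lf2 Lh1 Lh2 w1 w2 phi Cphi.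
have Lphi := L2_Cinfty Cphi; have Lphi' := L2_Cinfty (Cinfty_derive1 Cphi).
have E f h k : L2_S1 f -> L2_S1 h -> L2_S1 k -> intS1 (fun t => (a * f t + h t) * k t)
    = a * intS1 (fun t => f t * k t) + intS1 (fun t => h t * k t).
  move=> Lf Lh Lk; rewrite -intS1Z; last exact: L2_mul.
  rewrite -intS1D; [|exact/L1Z/L2_mul|exact: L2_mul].
  by apply: eq_intS1 => t _; ring.
by rewrite !E// w1// w2//; ring.
Qed.

Lemma wderivP f : H1_S1 f -> L2_S1 (wderiv f) /\ is_weak_derivative f (wderiv f).
Proof. by move=> [_ Hh]; exact: (xgetPex (fun=> 0) Hh). Qed.

Lemma H1_L2 f : H1_S1 f -> L2_S1 f.
Proof. by case. Qed.

Lemma H1_wderiv_ae f h : L2_S1 f -> L2_S1 h -> is_weak_derivative f h ->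
  H1_S1 f /\ ae01 (wderiv f) h.
Proof.
move=> Lf Lh wh; have Hf : H1_S1 f by split=> //; exists h.
by split=> //; have [Ld wd] := wderivP Hf; exact: (weak_unique _ _ wd wh).
Qed.

Lemma H1_lin a f h : H1_S1 f -> H1_S1 h ->
  H1_S1 (fun t => a * f t + h t) /\
  ae01 (wderiv (fun t => a * f t + h t)) (fun t => a * wderiv f t + wderiv h t).
Proof.
move=> Hf Hh; have [Lf wf] := wderivP Hf; have [Lh wh] := wderivP Hh.
apply: H1_wderiv_ae.
- by apply: L2_lin; exact: H1_L2.
- exact: L2_lin.
- by apply: weak_lin => //; exact: H1_L2.
Qed.

(** In [ibp_prim] the boundary term is a multiple of the mean of [h], and the constant [c] is paired
    with a derivative of mean zero. *)
Lemma weak_primS1 c h : L2_S1 h -> intS1 h = 0 ->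
  is_weak_derivative (primS1 c h) h.
Proof.
move=> Lh h0 phi Cphi; have [_ cphi'] := Cinfty_C (Cinfty_derive1 Cphi).
have := ibp_prim (L2_L1 Lh) (fun t => is_derive_Cinfty t Cphi) cphi'.
rewrite h0 mulr0 sub0r => <-.
have Lphi' := L2_Cinfty (Cinfty_derive1 Cphi).
transitivity (intS1 (fun t => c * derive1 phi t + prim h t * derive1 phi t)).
  by apply: eq_intS1 => t t01; rewrite primS1E// mulrDl.
rewrite intS1D; last 2 first.
- exact/L1Z/L2_L1.
- apply: eq_L1 (L2_mul (L2_primS1 0 Lh) Lphi') => t t01.
  by rewrite primS1E// add0r.
rewrite intS1Z; last exact: L2_L1.
by rewrite intS1_derive1// mulr0 add0r.
Qed.

(** The test function 1 shows that [h] has mean zero. Then [f] minus the primitive of [h] has weak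
    derivative zero and is constant by [du_Bois_Reymond]. *)
Lemma weak_representation f h : L2_S1 f -> L2_S1 h -> is_weak_derivative f h ->
  intS1 h = 0 /\ exists c, ae01 f (primS1 c h).
Proof.
move=> Lf Lh wh.
have h0 : intS1 h = 0.
  have := wh _ (Cinfty_cst 1).
  rewrite (@eq_intS1 _ _ (fun=> 0)); last first.
    by move=> t _; rewrite derive1_cst mulr0.
  rewrite intS1_cst (@eq_intS1 _ (fun t => h t * 1) h); last first.
    by move=> t _; rewrite mulr1.
  by move/eqP; rewrite eq_sym oppr_eq0 => /eqP.
split=> //; have LF := L2_primS1 0 Lh; have wF := weak_primS1 0 Lh h0.
have := du_Bois_Reymond (L2B Lf LF).
set c := intS1 _ => H; exists c; move: H.
have P phi : Cinfty_S1 phi ->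
    intS1 (fun t => (f t - primS1 0 h t) * derive1 phi t) = 0.
  move=> Cphi; have Lphi' := L2_Cinfty (Cinfty_derive1 Cphi).
  rewrite (@eq_intS1 _ _ (fun t => f t * derive1 phi t
      - primS1 0 h t * derive1 phi t)); last by move=> t _; rewrite mulrBl.
  rewrite intS1B; [|exact: L2_mul|exact: L2_mul].
  by rewrite wh// wF// subrr.
move=> /(_ P); apply: filterS; first exact: (ae_filter_ringOfSetsType mu).
move=> t H t01; have := H t01; rewrite !primS1E// add0r => <-.
by rewrite subrK.
Qed.

End WeakDerivatives.

(** * Completeness of L^2 *)

Section Completeness.
Context {R : realType}.
Local Notation mu := (@lebesgue_measure R).
Local Notation TR := (measurableTypeR R).
Implicit Types f h : R -> R.

(** Young's inequality |f| <= f^2 / (2 e) + e / 2, integrated. *)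
Lemma intS1_norm_le f (e : R) : L2_S1 f -> 0 < e -> sqS1 f <= e ^+ 2 ->
  intS1 (fun t => `|f t|) <= e.
Proof.
move=> Lf e0 fe; have e0' := ltW e0; have en0 : e != 0 by rewrite gt_eqF.
apply: (@le_trans _ _ (intS1 (fun t => e^-1 / 2 * f t ^+ 2 + e / 2))).
  apply: le_intS1.
  - exact/L1_norm/L2_L1.
  - by apply: L1D; [exact/L1Z/L2_sqr|exact: L1_cst].
  - move=> t _; rewrite -subr_ge0.
    rewrite (_ : _ - _ = (`|f t| - e) ^+ 2 / (2 * e)); last first.
      by rewrite -(real_normK (num_real (f t))); field.
    by rewrite divr_ge0 ?sqr_ge0// mulr_ge0// ltW.
rewrite intS1D; [|exact/L1Z/L2_sqr|exact: L1_cst].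
rewrite [X in X + _]intS1Z; last exact: L2_sqr.
rewrite intS1_cst -/(sqS1 f).
have : e^-1 / 2 * sqS1 f <= e^-1 / 2 * e ^+ 2.
  by rewrite ler_wpM2l// divr_ge0// invr_ge0.
rewrite (_ : e^-1 / 2 * e ^+ 2 = e / 2); last by field.
by move=> ?; lra.
Qed.

(* The increments of a rapidly Cauchy subsequence are summable in L^1, hence
   absolutely summable almost everywhere. *)
Lemma rapid_cauchy_ae_cvg (f_ : nat -> R -> R) : (forall n, L2_S1 (f_ n)) ->
  (forall k, intS1 (fun t => `|f_ k.+1 t - f_ k t|) <= 1 / (2 ^ k.+1)%:R) ->
  {ae mu, forall t, 0 <= t <= 1 -> cvgn (f_ ^~ t)}.
Proof.
move=> Lf_ rapid; pose d k t := f_ k.+1 t - f_ k t.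
pose nd (k : nat) (t : TR) := `|d k t|%:E.
have Ld k : L2_S1 (d k) by exact: L2B.
have Lnd k : mu.-integrable `[0, 1] (nd k) by exact/L1_norm/L2_L1.
have mnd k : measurable_fun (`[0, 1]%classic : set TR) (nd k).
  exact: measurable_int (Lnd k).
pose G (t : TR) := (\sum_(0 <= k <oo) nd k t)%E.
have mG : measurable_fun (`[0, 1]%classic : set TR) G.
  by apply: ge0_emeasurable_sum => // k t _ _; rewrite lee_fin.
have nd0 k t : (0 <= nd k t)%E by rewrite lee_fin.
have G0 t : (0 <= G t)%E by apply: nneseries_ge0.
have IG : mu.-integrable `[0, 1] G.
  apply/integrableP; split => //.
  under eq_integral do rewrite gee0_abs//.
  rewrite integral_nneseries//.
  apply: (@le_lt_trans _ _ (\sum_(0 <= k <oo) (1 / (2 ^ k.+1)%:R)%:E)%E).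
    apply: lee_nneseries => [k _ _|k _]; first exact: integral_ge0.
    rewrite -[leLHS]fineK ?lee_fin; first exact: rapid.
    exact: integrable_fin_num.
  apply: (@le_lt_trans _ _ 1%:E); last exact: ltry.
  exact: epsilon_trick0.
have := @integrable_ae _ TR R mu `[0, 1]%classic (measurable_itv _) G IG.
apply: filterS => t; rewrite /= in_itv/= => Gt /Gt {}Gt.
have cs : cvgn (series (d ^~ t)).
  apply: normed_cvg; apply: nnseries_is_cvg => [k|]; first exact: normr_ge0.
  by have := Gt; rewrite ge0_fin_numE.
rewrite (_ : f_ ^~ t = fun n => f_ 0%N t + series (d ^~ t) n); last first.
  by apply/funext => n; rewrite /series/= telescope_sumr// addrC subrK.
by apply: is_cvgD => //; exact: is_cvg_cst.
Qed.

(** Fatou's lemma for (f_n - h)^2 bounds the distance to [h] and makes the limit square integrable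
    at the same time. *)
Lemma ae_cvg_sqS1_le (f_ : nat -> R -> R) f h (e : R) :
  (forall n, L2_S1 (f_ n)) -> periodic f 1 -> measurable_fun [set: R] f ->
  L2_S1 h -> 0 <= e ->
  {ae mu, forall t, 0 <= t <= 1 -> f_ ^~ t @ \oo --> f t} ->
  (forall n, sqS1 (fun t => f_ n t - h t) <= e) ->
  L2_S1 f /\ sqS1 (fun t => f t - h t) <= e.
Proof.
move=> Lf_ pf mf Lh e0 cf_ fe.
pose q n (t : TR) := ((f_ n t - h t) ^+ 2)%:E.
have Lq n : mu.-integrable `[0, 1] (q n) by exact: L2_sqr (L2B _ _).
have mq n : measurable_fun (`[0, 1]%classic : set TR) (q n).
  exact: measurable_int (Lq n).
have q0 n t : (0 <= q n t)%E by rewrite lee_fin sqr_ge0.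
have mfh : measurable_fun [set: R] (fun t => f t - h t).
  by apply: measurable_funB => //; exact: L2_measurable.
have If : (\int[mu]_(t in `[0%R, 1%R]) ((f t - h t) ^+ 2)%:E <= e%:E)%E.
  apply: (@le_trans _ _ (limn_einf (fun n => \int[mu]_(t in `[0%R, 1%R]) q n t)%E)).
    apply: le_trans (fatou mu (measurable_itv _) mq (fun n t _ => q0 n t)).
    apply: ae_ge0_le_integral => //.
    - by move=> t _; rewrite lee_fin sqr_ge0.
    - apply/measurable_EFinP; apply: measurable_funX; exact: measurable_funTS.
    - move=> t _; rewrite limn_einf_lim; apply: lime_ge; first exact: is_cvg_einfs.
      by apply: nearW => n; apply: le_ereal_inf_tmp => _ [m _ <-].
    (* Measurability of the lower limit, read off from the upper limit of the opposite sequence. *)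
    - rewrite (_ : (fun t => _) = (fun t => - limn_esup (-%E \o (q ^~ t)))%E); last first.
        by apply/funext => t; rewrite limn_esupN oppeK.
      apply: measurableT_comp => //.
      apply: (measurable_fun_limn_esup (f := fun n t => (- q n t)%E)) => n.
      exact: measurableT_comp.
    apply: filterS cf_; first exact: (ae_filter_ringOfSetsType mu).
    move=> t; rewrite /= in_itv/= => ct /ct {}ct.
    rewrite (cvg_limn_einf_sup (_ : q ^~ t @ \oo --> ((f t - h t) ^+ 2)%:E)).1//.
    apply: cvg_EFin; first exact: nearW.
    have cb : (f_ n t - h t) @[n --> \oo] --> f t - h t.
      by apply: cvgB => //; exact: cvg_cst.
    exact: cvgM.
  apply: (le_trans (limn_einf_sup _)); rewrite limn_esup_lim.
  apply: lime_le; first exact: is_cvg_esups.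
  apply: nearW => n; apply: ge_ereal_sup => _ [m _ <-].
  rewrite -[leLHS]fineK ?lee_fin; first exact: fe.
  exact: integrable_fin_num.
have Lfh : L2_S1 (fun t => f t - h t).
  split=> //; first by move=> t; case: Lh => ph _ _; rewrite pf ph.
  apply/integrableP; split.
    apply/measurable_EFinP; apply: measurable_funX; exact: measurable_funTS.
  under eq_integral do rewrite gee0_abs ?lee_fin ?sqr_ge0//.
  exact: le_lt_trans If (ltry _).
split; last first.
  rewrite -lee_fin; apply: le_trans If.
  by rewrite -[leRHS]fineK//; apply: integrable_fin_num => //; exact: L2_sqr.
by apply: eq_L2 (L2D Lfh Lh) => t; rewrite subrK.
Qed.

Lemma riesz_fischer (f_ : nat -> R -> R) : (forall n, L2_S1 (f_ n)) ->
  (forall e, 0 < e -> exists N, forall n m, (N <= n)%N -> (N <= m)%N ->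
     sqS1 (fun t => f_ n t - f_ m t) <= e) ->
  exists2 f, L2_S1 f & forall e, 0 < e -> exists N, forall n, (N <= n)%N ->
     sqS1 (fun t => f t - f_ n t) <= e.
Proof.
move=> Lf_ cauchy.
(* The squares of the increments of the subsequence are kept below this, so their L^1 norms have sum
   at most 1. *)
have e0 (k : nat) : 0 < (1 / (2 ^ k.+1)%:R) ^+ 2 :> R.
  by rewrite exprn_gt0// divr_gt0// ltr0n expn_gt0.
have [M_ HM] := choice (fun k => cauchy _ (e0 k)).
(* The partial sums make [s] nondecreasing and at least [M_ k]; the added k makes it unbounded. *)
pose s k := (k + \sum_(j < k.+1) M_ j)%N.
have sM k : (M_ k <= s k)%N.
  by rewrite /s big_ord_recr/= addnA leq_addl.
have sk k : (k <= s k)%N by rewrite /s leq_addr.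
have sS k : (s k <= s k.+1)%N.
  by rewrite /s [in leqRHS]big_ord_recr/= addSn leqW// leq_add2l leq_addr.
pose h k := f_ (s k).
have Lh k : L2_S1 (h k) by exact: Lf_.
have cvh : {ae mu, forall t, 0 <= t <= 1 -> cvgn (h ^~ t)}.
  apply: rapid_cauchy_ae_cvg => // k; apply: intS1_norm_le; first exact: L2B.
    by rewrite divr_gt0// ltr0n expn_gt0.
  by apply: HM => //; rewrite (leq_trans (sM k)).
(* An upper limit exists at every point and is measurable and periodic, whether or not the
   subsequence converges there. *)
pose f t := fine (limn_esup (fun k => (h k t)%:E)).
have pf : periodic f 1.
  move=> t; congr (fine (limn_esup _)); apply/funext => k.
  by have [-> _ _] := Lh k.
have mf : measurable_fun [set: R] f.
  apply: (measurableT_comp (fine_measurable measurableT)).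
  apply: measurable_fun_limn_esup => k; apply/measurable_EFinP.
  exact: L2_measurable.
have cvf : {ae mu, forall t, 0 <= t <= 1 -> h ^~ t @ \oo --> f t}.
  apply: filterS cvh; first exact: (ae_filter_ringOfSetsType mu).
  move=> t ct /ct {}ct.
  have c' : (fun k => (h k t)%:E) @ \oo --> (limn (h ^~ t))%:E.
    by apply: cvg_EFin => //; exact: nearW.
  by rewrite /f (cvg_limn_einf_sup c').2.
(* Dropping N terms leaves only indices past the Cauchy threshold, without changing the limit. *)
have shift (N : nat) : {ae mu, forall t, 0 <= t <= 1 ->
    (fun k => h (k + N)%N) ^~ t @ \oo --> f t}.
  apply: filterS cvf; first exact: (ae_filter_ringOfSetsType mu).
  by move=> t ct /ct; rewrite -(cvg_shiftn N).
have key e : 0 < e -> exists N, forall n, (N <= n)%N ->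
    L2_S1 f /\ sqS1 (fun t => f t - f_ n t) <= e.
  move=> ep; have [N HN] := cauchy e ep; exists N => n Nn.
  apply: (@ae_cvg_sqS1_le (fun k => h (k + N)%N)) => //; first exact: ltW.
  move=> k; apply: HN => //.
  by rewrite (leq_trans _ (sk _))// leq_addl.
exists f; first by have [N /(_ N (leqnn N))[]] := key 1 ltr01.
by move=> e /key[N HN]; exists N => n /HN[].
Qed.

End Completeness.

(** * Affine change of variable on the line *)

Section AffineChange.
Context {R : realType}.
Local Notation mu := (@lebesgue_measure R).
Local Notation TR := (measurableTypeR R).

Definition affine (c a : R) : TR -> TR := fun t => c * (t - a).

Lemma measurable_affine (c a : R) : measurable_fun [set: TR] (affine c a).
Proof.
apply: continuous_measurable_fun => t; apply: cvgM; first exact: cvg_cst.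
by apply: cvgB; [exact: cvg_id|exact: cvg_cst].
Qed.

(** The image of Lebesgue measure under the affine map, multiplied by c, agrees with Lebesgue
    measure on half-open intervals and so equals it. *)
Lemma ge0_integral_affine (c a : R) (f : TR -> \bar R) : 0 < c ->
  measurable_fun [set: TR] f -> (forall t, (0 <= f t)%E) ->
  (\int[mu]_t f (affine c a t) = c^-1%:E * \int[mu]_t f t)%E.
Proof.
move=> c0 mf f0.
have E : (\int[mu]_t f t = \int[mscale (NngNum (ltW c0))
    (pushforward mu (affine c a))]_t f t)%E.
  move=> m; apply: eq_measure_integral => A mA _.
  apply: lebesgue_measure_unique => //= _ [[x y]] _ <-.
  rewrite /mscale/= /pushforward.
  rewrite (_ : _ @^-1` _ = `]a + x / c, a + y / c]%classic); last first.
    apply/seteqP; split => t /=; rewrite /affine !in_itv/=.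
      by rewrite -ltrBrDl -lerBlDl ltr_pdivrMr// ler_pdivlMr// (mulrC c).
    by rewrite -ltrBrDl -lerBlDl ltr_pdivrMr// ler_pdivlMr// (mulrC c).
  rewrite !lebesgue_measure_itv/= !lte_fin ltrD2l ltr_pM2r ?invr_gt0//.
  case: ifPn => _; last by rewrite mule0.
  by rewrite -!EFinB -EFinM; congr EFin; field; rewrite gt_eqF.
rewrite (E (measurable_affine c a)) ge0_integral_mscale//=.
rewrite ge0_integral_pushforward//; last exact: measurable_affine.
by rewrite muleA -EFinM mulVf ?mul1e// gt_eqF.
Qed.

Lemma Rintegral_affine (c a : R) (f : R -> R) : 0 < c ->
  mu.-integrable [set: R] (EFin \o f) ->
  \int[mu]_t f (c * (t - a)) = c^-1 * \int[mu]_t f t.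
Proof.
move=> c0 If; have mf : measurable_fun [set: TR] (EFin \o f) := measurable_int _ If.
have fp := integrable_pos_fin_num measurableT If.
have fn := integrable_neg_fin_num measurableT If.
have P : (\int[mu]_t (fun x => (f (c * (x - a)))%:E)^\+%E t
    = c^-1%:E * \int[mu]_t (EFin \o f)^\+%E t)%E.
  transitivity (\int[mu]_t ((EFin \o f)^\+%E (affine c a t)))%E.
    by apply: eq_integral => t _; rewrite ?funeposE ?funenegE.
  by apply: (ge0_integral_affine a c0 (measurable_funepos mf)) => t; exact: funepos_ge0.
have M : (\int[mu]_t (fun x => (f (c * (x - a)))%:E)^\-%E t
    = c^-1%:E * \int[mu]_t (EFin \o f)^\-%E t)%E.
  transitivity (\int[mu]_t ((EFin \o f)^\-%E (affine c a t)))%E.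
    by apply: eq_integral => t _; rewrite ?funeposE ?funenegE.
  by apply: (ge0_integral_affine a c0 (measurable_funeneg mf)) => t; exact: funeneg_ge0.
rewrite /Rintegral integralE [in RHS]integralE.
rewrite [X in (X - _)%E]P [X in (_ - X)%E]M.
have X : forall x y : \bar R, x \is a fin_num -> y \is a fin_num ->
    fine (c^-1%:E * x - c^-1%:E * y)%E = c^-1 * fine (x - y)%E.
  by move=> [x||] [y||]//= _ _; rewrite mulrBr.
exact: X.
Qed.

End AffineChange.

(** * Uniform continuity, in particular on the circle *)

Section PeriodicContinuous.
Context {R : realType}.
Local Notation mu := (@lebesgue_measure R).
Implicit Types f h : R -> R.

Lemma periodic_frac f (t : R) : periodic f 1 -> f (fracp t) = f t.
Proof.
move=> pf; rewrite /fracp; case: (Num.floor t) => n.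
  rewrite -[(Posz n)%:~R]/(n%:R) -[t in RHS](subrK n%:R).
  by rewrite [RHS](periodicn pf n).
by rewrite NegzE mulrNz opprK -[_%:~R]/(n.+1%:R) periodicn.
Qed.

Lemma C_S1_bounded f : C_S1 f -> exists2 M : R, 0 <= M & forall t, `|f t| <= M.
Proof.
move=> [pf cf]; have [M HM] := continuous_bounded01 cf.
have HM' t : `|f t| <= M.
  rewrite -(periodic_frac t pf); apply: HM.
  by have /andP[-> /ltW ->] := fracp_itv t.
by exists M => //; exact: le_trans (HM' 0).
Qed.

(** Compactness in its near-covering form. Only [x] is confined to [A], so a perturbed argument may
    leave the compact set. *)
Lemma heine_cantor (T : pseudoMetricType R) (f : T -> R) (A : set T) (e : R) :
  compact A -> continuous f -> 0 < e ->
  exists2 d : R, 0 < d & forall x y, A x -> ball x d y -> `|f x - f y| <= e.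
Proof.
move=> cA cf e0; pose P (d : R) x := forall y, ball x d y -> `|f x - f y| <= e.
have H : \forall d \near (0 : R)^'+, A `<=` P d.
  apply: (compact_near_coveringP A).1 => // x Ax.
  have /cvgrPdist_le/(_ (e / 2)) := cf x.
  rewrite divr_gt0// => /(_ isT)/nbhs_ballP[r /= r0 Hr].
  exists (ball x (r / 2), [set d | d < r / 2]).
    split; first by apply: nbhsx_ballx; rewrite divr_gt0.
    by apply: nbhs_right_lt; rewrite divr_gt0.
  move=> [x' d]/= [xx' dr] y x'y.
  have b1 : ball x r x' by apply: le_ball xx'; lra.
  have b2 : ball x r y.
    rewrite [r]splitr; apply: ball_triangle xx' _.
    by apply: le_ball x'y; exact: ltW.
  have := Hr _ b1; have := Hr _ b2 => /= h1 h2.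
  rewrite (_ : f x' - f y = (f x - f y) - (f x - f x')); last by ring.
  by rewrite (le_trans (ler_normB _ _))//; lra.
have [d [d0 Hd]] : exists d : R, 0 < d /\ A `<=` P d.
  exact: filter_ex (filterI (nbhs_right_gt 0) H).
by exists d => // x y /Hd; apply.
Qed.

Lemma C_S1_unif f (e : R) : C_S1 f -> 0 < e ->
  exists2 d : R, 0 < d & forall x y, `|x - y| <= d -> `|f x - f y| <= e.
Proof.
move=> [pf cf] e0.
have [d d0 Hd] := heine_cantor (@segment_compact R 0 1) cf e0.
exists (d / 2); first by rewrite divr_gt0.
move=> x y xy; rewrite -(periodic_frac x pf).
(* Both points are shifted by the integer part of x; the image of y need not lie in [0, 1]. *)
rewrite (_ : f y = f (fracp x + (y - x))); last first.
  rewrite -(periodic_frac (fracp x + _) pf) -(periodic_frac y pf).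
  congr (f _); rewrite /fracp; set z := Num.floor x.
  have -> : x - z%:~R + (y - x) = y - z%:~R by ring.
  have -> : Num.floor (y - z%:~R) = Num.floor y - z.
    apply: floor_def; have /andP[y0 y1] := floor_itv y.
    move: y1; rewrite !intrD !mulrNz => y1; apply/andP; split; lra.
  by rewrite intrD mulrNz; ring.
apply: Hd.
  by rewrite /= in_itv/=; have /andP[-> /ltW ->] := fracp_itv x.
rewrite /ball/= opprD addrA subrr sub0r normrN distrC (le_lt_trans xy)//; lra.
Qed.

End PeriodicContinuous.

(** * Window averages *)

Section Sampling.
Context {R : realType}.
Local Notation mu := (@lebesgue_measure R).
Implicit Type w : R -> R.

Lemma window_facts w : admissible_window w ->
  [/\ mu.-integrable [set: R] (EFin \o w), \int[mu]_t w t = 1 &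
  exists2 A : R, 0 <= A & {ae mu, forall t, w t = 0 \/ `|t| <= A}].
Proof.
move=> [Lw [A cA wA] w1].
have [B B0 HB] : exists2 B : R, 0 <= B & forall t, A t -> `|t| <= B.
  have [B [Br HB]] := compact_bounded cA.
  exists (`|B| + 1); first by rewrite addr_ge0.
  by move=> t At; apply: HB => //; rewrite (le_lt_trans (ler_norm _))// ltrDl.
have wB : {ae mu, forall t, w t = 0 \/ `|t| <= B}.
  apply: filterS wA; first exact: (ae_filter_ringOfSetsType mu).
  move=> t Ht; have [/HB|/Ht] := pselect (A t); by [right|left].
split=> //; last by exists B.
have mw : measurable_fun [set: R] w.
  by move: Lw; rewrite inE => /andP[]; rewrite inE.
have [M M0 wM] : exists2 M : R, 0 <= M & {ae mu, forall t, `|w t| <= M}.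
  move: Lw; rewrite inE => /andP[_]; rewrite inE/= /finite_norm unlock.
  (* The sup norm is an essential supremum only on a space of positive measure, which the unit
     interval witnesses. *)
  rewrite ifT; last first.
    apply: (@lt_le_trans _ _ (mu `[0, 1]%classic)).
      by rewrite lebesgue_measure_itv/= lte_fin ltr01 -EFinB subr0 lte_fin.
    by apply: le_measure; rewrite ?inE.
  move=> /ess_supr_bounded[M HM]; exists `|M| => //.
  apply: filterS HM.
  by move=> t /= H; rewrite (le_trans H)// ler_norm.
have I0 : mu.-integrable [set: R] (EFin \o (fun t => M * \1_(`[- B, B] : set R) t)).
  exact: (integrableZl _ M (integrable_indic_itv _ _ _ _)).
apply/integrableP; split; first exact/measurable_EFinP.
move/integrableP : I0 => [mI]; apply: le_lt_trans.
apply: ae_ge0_le_integral => //.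
- by apply: measurableT_comp => //; exact/measurable_EFinP.
- exact: measurableT_comp.
- apply: (@filterS2 _ _ (ae_filter_ringOfSetsType mu) _ _ _ _ wM wB).
  move=> t Mt Bt _ /=; rewrite lee_fin.
  have [->|tB] := Bt; first by rewrite normr0.
  rewrite indicE mem_set ?mulr1 ?(le_trans Mt)// ?ler_norm//.
  by rewrite /= in_itv/= -ler_norml.
Qed.

(** The substitution s = N (t - t_i) frees the weight from N and moves the scale into the argument
    of [f]. *)
Lemma sampleE w (N : nat) (f : R -> R) (i : 'I_N) : admissible_window w ->
  (0 < N)%N -> C_S1 f ->
  sample w f i = \int[mu]_s (w s * f (grid i + s / N%:R)) /\
  mu.-integrable [set: R] (EFin \o (fun s => w s * f (grid i + s / N%:R))).
Proof.
move=> A1 N0 Cf; have N0' : 0 < N%:R :> R by rewrite ltr0n.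
have [Lw _ _] := window_facts A1.
have [M M0 fM] := C_S1_bounded Cf.
have mw : measurable_fun [set: R] w by apply/measurable_EFinP; exact: measurable_int Lw.
have mf : measurable_fun [set: R] (fun s => f (grid i + s / N%:R)).
  apply: continuous_measurable_fun => s.
  apply: (@cvg_comp _ _ _ (fun s => grid i + s / N%:R) f _ (nbhs (grid i + s / N%:R))).
    by apply: cvgD; [exact: cvg_cst|apply: cvgM; [exact: cvg_id|exact: cvg_cst]].
  by case: Cf => _; apply.
have I : mu.-integrable [set: R] (EFin \o (fun s => w s * f (grid i + s / N%:R))).
  apply: (le_integrable _ _ _ (integrableZl measurableT M (integrable_norm Lw))) => //.
    by apply/measurable_EFinP; exact: measurable_funM.
  move=> s _ /=; rewrite lee_fin !normrM normr_id (ger0_norm M0) mulrC.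
  by rewrite ler_wpM2r.
split=> //; rewrite /sample -[LHS]mulr1.
have := Rintegral_affine (grid i) N0' I.
rewrite (_ : \int[mu]_t _ = \int[mu]_t (w (N%:R * (t - grid i)) * f t)); last first.
  apply: eq_Rintegral => t _; congr (_ * f _).
  by field; rewrite gt_eqF.
by move=> ->; rewrite mulr1 mulrA divff ?mul1r// gt_eqF.
Qed.

Lemma sample_lin w (N : nat) (a : R) (f h : R -> R) (i : 'I_N) :
  admissible_window w -> (0 < N)%N -> C_S1 f -> C_S1 h ->
  sample w (fun t => a * f t + h t) i = a * sample w f i + sample w h i.
Proof.
move=> A1 N0 Cf Ch.
have Cfh : C_S1 (fun t => a * f t + h t).
  split; first by move=> t; case: Cf Ch => [-> _] [-> _].
  move=> t; apply: cvgD; last by case: Ch => _; apply.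
  by apply: cvgM; [exact: cvg_cst|case: Cf => _; apply].
have [-> _] := sampleE i A1 N0 Cfh; have [-> If] := sampleE i A1 N0 Cf.
have [-> Ih] := sampleE i A1 N0 Ch.
rewrite -RintegralZl// -RintegralD//; last exact: (integrableZl _ a If).
by apply: eq_Rintegral => t _; ring.
Qed.

(** As [w] integrates to 1, the error is the [w]-average of the increments of [f] from x. [W] is the
    L^1 norm of [w]; the radius of its support is enlarged by 1 because x may be one cell away from
    the node. *)
Lemma sample_approx w : admissible_window w -> exists A W : R, [/\ 0 <= A, 0 <= W &
  forall (N : nat) (f : R -> R) (i : 'I_N) (x o : R), (0 < N)%N -> C_S1 f -> 0 <= o ->
    `|x - grid i| <= N%:R^-1 ->
    (forall y, `|y - x| <= A / N%:R -> `|f y - f x| <= o) ->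
    `|sample w f i - f x| <= W * o].
Proof.
move=> A1; have [Lw w1 [A A0 wA]] := window_facts A1.
exists (A + 1), (\int[mu]_t `|w t|); split; first by rewrite addr_ge0.
  exact: Rintegral_ge0.
move=> N f i x o N0 Cf o0 xi fo; have N0' : 0 < N%:R :> R by rewrite ltr0n.
have [-> I] := sampleE i A1 N0 Cf.
have I1 : mu.-integrable [set: R] (EFin \o (fun s => w s * f x)).
  exact: (integrableZr _ (f x) Lw).
have -> : f x = \int[mu]_s (w s * f x) by rewrite RintegralZr// w1 mul1r.
rewrite -RintegralB//.
have I2 : mu.-integrable [set: R]
    (EFin \o (fun s => w s * f (grid i + s / N%:R) - w s * f x)).
  exact: (integrableB _ I I1).
rewrite (le_trans (le_normr_Rintegral _ I2))// -RintegralZr//; last first.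
  exact: integrable_norm.
have I3 : mu.-integrable [set: R] (EFin \o (fun s => `|w s| * o)).
  exact: (integrableZr _ o (integrable_norm Lw)).
rewrite /Rintegral fine_le//.
- by apply: integrable_fin_num => //; exact: (integrable_norm I2).
- exact: integrable_fin_num.
apply: ae_ge0_le_integral => //.
- by have := integrable_norm I2 => /measurable_int.
- by move=> s _; rewrite lee_fin mulr_ge0.
- exact: measurable_int I3.
apply: filterS wA; first exact: (ae_filter_ringOfSetsType mu).
move=> s [->|sA] _; first by rewrite !mul0r subrr normr0 mul0r.
rewrite lee_fin -mulrBr normrM ler_wpM2l//; apply: fo.
rewrite (_ : grid i + s / N%:R - x = s / N%:R - (x - grid i)); last by ring.
rewrite (le_trans (ler_normB _ _))// mulrDl mul1r lerD//.
by rewrite normrM normfV (ger0_norm (ltW N0')) ler_pM2r// invr_gt0.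
Qed.

End Sampling.

(** * The discrete H^1 norm, lifting and nodal sampling *)

Section DiscreteH1.
Context {R : realType}.
Local Notation mu := (@lebesgue_measure R).
Implicit Types f h : R -> R.

Definition Dvec (n : nat) (f : 'rV[R]_n.+1) : 'rV[R]_n.+1 := \row_i DN f i.

(** The squared discrete H^1 norm; the size n.+1 excludes the empty grid. *)
Definition sqH1N (n : nat) (f : 'rV[R]_n.+1) : R :=
  n.+1%:R^-1 * \sum_(i < n.+1) (f 0 i ^+ 2 + DN f i ^+ 2).

Lemma sqH1NE (n : nat) (f : 'rV[R]_n.+1) :
  sqH1N f = sqS1 (interpN f) + sqS1 (interpN (Dvec f)).
Proof.
rewrite !sqS1_interpN// -mulrDr -big_split/=; congr (_ * _).
by apply: eq_bigr => i _; rewrite mxE.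
Qed.

Lemma sqS1_interpN_le (n : nat) (f : 'rV[R]_n.+1) : sqS1 (interpN f) <= sqH1N f.
Proof. by rewrite sqH1NE lerDl sqS1_ge0. Qed.

Lemma sqS1_Dvec_le (n : nat) (f : 'rV[R]_n.+1) :
  sqS1 (interpN (Dvec f)) <= sqH1N f.
Proof. by rewrite sqH1NE lerDr sqS1_ge0. Qed.

(** Cyclic differences cancel after reindexing by [ordS]; this closes up the lift on the circle. *)
Lemma intS1_Dvec (n : nat) (f : 'rV[R]_n.+1) : intS1 (interpN (Dvec f)) = 0.
Proof.
rewrite (@intS1_interpN _ _ _ (fun x => x))//; last exact/L2_L1/L2_interpN.
under eq_bigr do rewrite mxE /DN.
rewrite -mulr_sumr sumrB [X in _ - X](reindex_inj (@ordS_inj n.+1))/=.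
by rewrite subrr !mulr0.
Qed.

(** The interpolant is written as a primitive, not cell by cell, so that [weak_primS1] and the
    Hoelder estimate apply as they stand; [lift_node] recovers the nodal values. *)
Definition liftS1 (n : nat) (f : 'rV[R]_n.+1) : R -> R :=
  primS1 (f 0 ord0) (interpN (Dvec f)).

Lemma cell_le (n m : nat) : (m <= n.+1)%N -> 0 <= (m%:R / n.+1%:R : R) <= 1.
Proof.
move=> mn; rewrite divr_ge0//= ler_pdivrMr ?ltr0n// mul1r ler_nat.
exact: mn.
Qed.

Lemma cell_mono (n m : nat) : m%:R / n.+1%:R <= m.+1%:R / n.+1%:R :> R.
Proof. by rewrite ler_pM2r ?invr_gt0 ?ltr0n// ler_nat. Qed.

Lemma cell_width (n m : nat) : m.+1%:R / n.+1%:R - m%:R / n.+1%:R = n.+1%:R^-1 :> R.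
Proof. by rewrite -mulrBl -natrB// subSnn mul1r. Qed.

Lemma prim_interpN_cell (n : nat) (f : 'rV[R]_n.+1) (m : 'I_n.+1) :
  \int[mu]_(t in `[m%:R / n.+1%:R, m.+1%:R / n.+1%:R]) interpN f t
    = n.+1%:R^-1 * f 0 m.
Proof.
have L := L2_L1 (L2_interpN f).
rewrite (@Rintegral_itvoo_eq _ _ (fun=> f 0 m))//.
- by rewrite Rintegral_cst// fine_mu_itv ?cell_mono// cell_width mulrC.
- exact: L1_cst.
- by have /andP[] := @cell_le n m.+1 (ltn_ord m).
- by move=> t /andP[/ltW mt tm]; apply: interpN_in => //; rewrite mt.
Qed.

Lemma lift_node (n : nat) (f : 'rV[R]_n.+1) (m : 'I_n.+1) :
  liftS1 f (m%:R / n.+1%:R) = f 0 m.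
Proof.
have L := L2_L1 (L2_interpN (Dvec f)).
rewrite /liftS1 primS1E ?intS1_Dvec//; last exact/cell_le/ltnW.
have H (k : nat) : forall kn : (k < n.+1)%N,
    prim (interpN (Dvec f)) (k%:R / n.+1%:R) = f 0 (Ordinal kn) - f 0 ord0.
  elim: k => [kn|k IH kn].
    by rewrite mul0r prim0 (_ : Ordinal kn = ord0) ?subrr//; exact/val_inj.
  have kn' := ltnW kn.
  have := primB L (andP (@cell_le n k (ltnW kn'))).1 (cell_mono n k)
    (andP (@cell_le n k.+1 kn')).2.
  rewrite IH (prim_interpN_cell _ (Ordinal kn')) mxE /DN mulrA mulVf ?mul1r//.
  have -> : ordS (Ordinal kn') = Ordinal kn.
    by apply/val_inj; rewrite /= modn_small.
  by move=> /eqP; rewrite subr_eq => /eqP ->; ring.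
by case: m => m mn; rewrite H /=; ring.
Qed.

Lemma L2_lift (n : nat) (f : 'rV[R]_n.+1) : L2_S1 (liftS1 f).
Proof. exact/L2_primS1/L2_interpN. Qed.

Lemma lift_periodic (n : nat) (f : 'rV[R]_n.+1) : periodic (liftS1 f) 1.
Proof. exact: periodic_per. Qed.

Lemma itv_cases (t : R) : 0 <= t <= 1 -> (0 <= t < 1) \/ t = 0 + 1.
Proof.
move=> /andP[t0]; rewrite le_eqVlt => /predU1P[->|t1]; first by right; rewrite add0r.
by left; rewrite t0.
Qed.

Lemma periodic_itv (P : R -> Prop) : (forall t, P (t + 1) = P t) ->
  (forall t, 0 <= t < 1 -> P t) -> forall t, 0 <= t <= 1 -> P t.
Proof.
move=> pP H t /itv_cases[/H//|->]; rewrite pP; apply: H.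
by rewrite lexx ltr01.
Qed.

(** The step function repeats the value of the lift at the left node, so the difference is an
    increment of the lift over less than a cell. *)
Lemma lift_close (n : nat) (f : 'rV[R]_n.+1) (t : R) : 0 <= t <= 1 ->
  (liftS1 f t - interpN f t) ^+ 2 <= sqH1N f / n.+1%:R.
Proof.
move: t; apply: periodic_itv => [t|t t01].
  by rewrite lift_periodic interpN_periodic.
have [m /andP[mt tm]] := @cell_exists R n.+1 t isT t01.
rewrite (@interpN_in _ _ _ m) ?mt// -lift_node.
have t01' : 0 <= t <= 1 by move: t01 => /andP[-> /ltW].
apply: le_trans (sqr_primS1B_le _ (L2_interpN _) (intS1_Dvec f) _ t01') _.
  exact/cell_le/ltnW.
rewrite mulrC ler_pM ?sqS1_ge0 ?sqS1_Dvec_le//.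
by rewrite ger0_norm ?subr_ge0// -[leRHS](cell_width n m) lerD2r ltW.
Qed.

Lemma sqS1_lift_close (n : nat) (f : 'rV[R]_n.+1) :
  sqS1 (fun t => liftS1 f t - interpN f t) <= sqH1N f / n.+1%:R.
Proof.
apply: sqS1_bounded; last exact: lift_close.
by apply: L2B; [exact: L2_lift|exact: L2_interpN].
Qed.

Lemma lift_H1 (n : nat) (f : 'rV[R]_n.+1) :
  H1_S1 (liftS1 f) /\ ae01 (wderiv (liftS1 f)) (interpN (Dvec f)).
Proof.
apply: H1_wderiv_ae; [exact: L2_lift|exact: L2_interpN|].
by apply: weak_primS1; [exact: L2_interpN|exact: intS1_Dvec].
Qed.

Lemma sqH1N_ge0 (n : nat) (f : 'rV[R]_n.+1) : 0 <= sqH1N f.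
Proof. by rewrite sqH1NE addr_ge0 ?sqS1_ge0. Qed.

Lemma sqS1_lift_le (n : nat) (f : 'rV[R]_n.+1) : sqS1 (liftS1 f) <= 4 * sqH1N f.
Proof.
have := sqS1_D_le (L2B (L2_lift f) (L2_interpN f)) (L2_interpN f).
rewrite (@eq_sqS1 _ _ (liftS1 f)); last by move=> t _; rewrite subrK.
have := sqS1_lift_close f; have := sqS1_interpN_le f; have := sqH1N_ge0 f.
have : sqH1N f / n.+1%:R <= sqH1N f.
  by rewrite ler_piMr ?sqH1N_ge0// invf_le1 ?ler1n// ltr0n.
by move: (sqH1N f / n.+1%:R) => q *; lra.
Qed.

(** The constant is 10 = 2 + 2 * 4, from [sqr_primS1_le], [sqS1_Dvec_le] and [sqS1_lift_le]; then
    |x| <= 1 + x^2. *)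
Lemma lift_sup (n : nat) (f : 'rV[R]_n.+1) (t : R) : 0 <= t <= 1 ->
  `|liftS1 f t| <= 1 + 10 * sqH1N f.
Proof.
move=> t01.
have := sqr_primS1_le (f 0 ord0) (L2_interpN _) (intS1_Dvec f) t01.
rewrite -/(liftS1 f) => H.
have := sqS1_lift_le f; have := sqS1_Dvec_le f; have := sqH1N_ge0 f => d0 d1 d2.
by rewrite ler_norml; apply/andP; split; nra.
Qed.

Definition nodes (n : nat) f : 'rV[R]_n.+1 := \row_i f (i%:R / n.+1%:R).

(** * Nodal values of an H^1 function *)

Section Recovery.
Variables (c : R) (h : R -> R).
Hypotheses (Lh : L2_S1 h) (h0 : intS1 h = 0).
Let F := primS1 c h.

Lemma nodes_close (n : nat) (t : R) : 0 <= t <= 1 ->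
  (interpN (nodes n F) t - F t) ^+ 2 <= sqS1 h / n.+1%:R.
Proof.
move: t; apply: periodic_itv => [t|t t01].
  by rewrite interpN_periodic /F [primS1 c h (t + 1)]periodic_per.
have [m /andP[mt tm]] := @cell_exists R n.+1 t isT t01.
rewrite (@interpN_in _ _ _ m) ?mt// mxE.
have t01' : 0 <= t <= 1 by move: t01 => /andP[-> /ltW].
apply: le_trans (sqr_primS1B_le _ Lh h0 t01' _) _; first exact/cell_le/ltnW.
rewrite mulrC ler_wpM2l ?sqS1_ge0// distrC.
by rewrite ger0_norm ?subr_ge0// -[leRHS](cell_width n m) lerD2r ltW.
Qed.

Lemma DN_nodes (n : nat) (i : 'I_n.+1) : DN (nodes n F) i =
  n.+1%:R * \int[mu]_(t in `[i%:R / n.+1%:R, i.+1%:R / n.+1%:R]) h t.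
Proof.
rewrite /DN !mxE; congr (_ * _).
have c1 := @cell_le n i (ltnW (ltn_ord i)); have c2 := @cell_le n i.+1 (ltn_ord i).
rewrite -primB; [|exact: L2_L1|by case/andP: c1|exact: cell_mono|by case/andP: c2].
(* For the last index the successor wraps to node 0, and F takes the same value at 0 and 1. *)
have -> : F ((ordS i)%:R / n.+1%:R) = F (i.+1%:R / n.+1%:R).
  rewrite /=; have := ltn_ord i; rewrite leq_eqVlt => /predU1P[->|i1].
    rewrite modnn mul0r divff//; apply/esym.
    by rewrite -[1]add0r /F [LHS]periodic_per.
  by rewrite modn_small.
by rewrite /F !primS1E//; ring.
Qed.

(** The difference quotients are the cell averages of [h], and averaging does not increase the L^2
    norm. *)
Lemma sqS1_Dvec_nodes (n : nat) : sqS1 (interpN (Dvec (nodes n F))) <= sqS1 h.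
Proof.
have Lh2 := L2_sqr Lh; have n0 : 0 < n.+1%:R :> R by rewrite ltr0n.
rewrite sqS1_interpN// /sqS1 (intS1_cells (ltn0Sn n) Lh2) mulr_sumr.
apply: ler_sum => i _; rewrite mxE DN_nodes exprMn.
have c1 := @cell_le n i (ltnW (ltn_ord i)); have c2 := @cell_le n i.+1 (ltn_ord i).
have := sqr_Rintegral_le (andP c1).1 (cell_mono n i) (andP c2).2 (L2_L1 Lh) Lh2.
rewrite cell_width; set I := Rintegral _ _ _; set Q := Rintegral _ _ _ => IQ.
rewrite (_ : _ * _ = n.+1%:R * I ^+ 2); last by field; rewrite gt_eqF.
by rewrite -ler_pdivlMl.
Qed.

End Recovery.

End DiscreteH1.

(** * The operator on step functions *)

Section Operator.
Context {R : realType}.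
Variable K : (R -> R) -> R -> R.
Hypotheses (K_linear : L2_linear K) (K_bounded : L2_to_C_bounded K).
Implicit Types f h : R -> R.

Lemma K_C f : L2_S1 f -> C_S1 (K f).
Proof. by case: K_bounded => H _; exact: H. Qed.

(** The bound in terms of [sqS1], with 1 added to the constant so that it can be divided by. *)
Lemma K_bound : exists2 M : R, 0 < M & forall f (e : R), L2_S1 f -> 0 <= e ->
  sqS1 f <= e ^+ 2 -> forall t, `|K f t| <= M * e.
Proof.
have [_ [M HM]] := K_bounded; exists (`|M| + 1); first by rewrite ltr_wpDl.
move=> f e Lf e0 fe t; apply: (le_trans (HM f Lf t)).
apply: (@le_trans _ _ (`|M| * e)); last by rewrite ler_wpM2r// lerDl.
apply: (@le_trans _ _ (`|M| * L2norm f)).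
  by rewrite ler_wpM2r ?sqrtr_ge0// ler_norm.
rewrite ler_wpM2l// /L2norm -/(sqS1 f) -[e]ger0_norm// -sqrtr_sqr.
by rewrite ler_wsqrtr.
Qed.

Lemma K_sub f h t : L2_S1 f -> L2_S1 h ->
  K (fun s => f s - h s) t = K f t - K h t.
Proof.
move=> Lf Lh; have := K_linear (-1) Lh Lf t; rewrite mulN1r addrC => <-.
by congr (K _ t); apply/funext => s; rewrite mulN1r addrC.
Qed.

Lemma K_zero t : K (fun=> 0) t = 0.
Proof.
have L0 := @L2_cst R 0.
have := K_linear 1 L0 L0 t.
rewrite (_ : (fun s : R => 1 * 0 + 0) = fun=> 0) => [E|]; first lra.
by apply/funext => s; rewrite mulr0 addr0.
Qed.

Lemma K_sum (I : Type) (r : seq I) (a : I -> R) (F : I -> R -> R) t :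
  (forall i, L2_S1 (F i)) ->
  L2_S1 (fun s => \sum_(i <- r) a i * F i s) /\
  K (fun s => \sum_(i <- r) a i * F i s) t = \sum_(i <- r) a i * K (F i) t.
Proof.
move=> LF; elim: r => [|i r [L IH]].
  rewrite (_ : (fun s => _) = fun=> 0); last first.
    by apply/funext => s; rewrite big_nil.
  by rewrite K_zero big_nil; split=> //; exact: L2_cst.
rewrite (_ : (fun s => _) = fun s => a i * F i s + \sum_(j <- r) a j * F j s); last first.
  by apply/funext => s; rewrite big_cons.
split; first exact: L2_lin.
by rewrite K_linear// IH big_cons.
Qed.

(** The periodic indicator of cell [j]. *)
Definition cellf (N : nat) (j : 'I_N) : R -> R := interpN (delta_mx 0 j).

Lemma interpN_cellf (N : nat) (c : 'rV[R]_N) :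
  interpN c = fun s => \sum_(j < N) c 0 j * cellf j s.
Proof.
apply/funext => s; apply: eq_bigr => j _; congr (_ * _).
rewrite /cellf /interpN (bigD1 j)//= mxE !eqxx mul1r big1 ?addr0// => i ij.
by rewrite mxE (negbTE ij) andbF mul0r.
Qed.

Lemma K_interpN (N : nat) (c : 'rV[R]_N) t :
  K (interpN c) t = \sum_(j < N) c 0 j * K (cellf j) t.
Proof.
rewrite interpN_cellf; apply: (K_sum _ _ _ _).2 => j.
exact: L2_interpN.
Qed.

Lemma cells_equicontinuous (N : nat) (e : R) : 0 < e ->
  exists2 d : R, 0 < d & forall (j : 'I_N) x y, `|x - y| <= d ->
    `|K (cellf j) x - K (cellf j) y| <= e.
Proof.
move=> e0.
have H : \forall d \near (0 : R)^'+, forall j : 'I_N, forall x y, `|x - y| <= d ->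
    `|K (cellf j) x - K (cellf j) y| <= e.
  apply: filter_forall => j.
  have [d d0 Hd] := C_S1_unif (K_C (L2_interpN (delta_mx 0 j))) e0.
  near=> d' => x y xy; apply: Hd; apply: (le_trans xy).
  by near: d'; exact: nbhs_right_le.
have [d [d0 Hd]] := filter_ex (filterI (nbhs_right_gt 0) H).
by exists d.
Unshelve. all: by end_near. Qed.

(* A bounded set of the discrete H^1 is, up to a small L^2 error, contained in
   a bounded set of a fixed finite-dimensional space of step functions. *)
Lemma KI_equicontinuous (C e : R) : 0 <= C -> 0 < e ->
  exists (d : R) (N0 : nat), 0 < d /\ forall (n : nat) (f : 'rV[R]_n.+1),
    (N0 <= n)%N -> sqH1N f <= C -> forall x y, `|x - y| <= d ->
    `|K (interpN f) x - K (interpN f) y| <= e.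
Proof.
move=> C0 e0; have [MK MK0 HK] := K_bound.
(* An L^2 error [e1] costs e / 4 after [K], once at x and once at y; the other e / 2 goes to the
   coarse step function. *)
pose e1 := e / (4 * MK); have e10 : 0 < e1 by rewrite divr_gt0// mulr_gt0.
(* The coarse grid has M + 1 cells. Fine step function to lift and lift to coarse step function each
   cost C / (M + 1), doubled by [sqS1_triangle]. *)
pose M := Num.truncn (4 * C / e1 ^+ 2).
have M0 : 0 < M.+1%:R :> R by rewrite ltr0n.
have HM : 4 * C / M.+1%:R <= e1 ^+ 2.
  by rewrite ler_pdivrMr// [leRHS]mulrC -ler_pdivrMr ?exprn_gt0// ltW// truncnS_gt.
pose B := 1 + 10 * C; have B0 : 0 < B by rewrite /B; lra.
have e20 : 0 < e / (2 * (M.+1%:R * B)) by rewrite divr_gt0// !mulr_gt0.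
have [d d0 Hd] := @cells_equicontinuous M.+1 _ e20.
exists d, M; split=> // n f Mn fC x y xy.
(* The coarse values are those of the lift, since the fine grid need not refine the coarse one. *)
pose c := nodes M (liftS1 f).
have close : sqS1 (fun t => interpN f t - interpN c t) <= e1 ^+ 2.
  apply: (le_trans (sqS1_triangle (L2_interpN f) (L2_lift f) (L2_interpN c))).
  rewrite sqS1_BC [X in _ + 2 * X]sqS1_BC.
  have h1 : sqS1 (fun t => liftS1 f t - interpN f t) <= C / M.+1%:R.
    apply: (le_trans (sqS1_lift_close f)).
    have iv : n.+1%:R^-1 <= M.+1%:R^-1 :> R.
      by rewrite lef_pV2 ?posrE ?ltr0n// ler_nat ltnS.
    apply: (@le_trans _ _ (C / n.+1%:R)); last by rewrite ler_wpM2l.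
    by rewrite ler_pM2r// invr_gt0 ltr0n.
  have h2 : sqS1 (fun t => interpN c t - liftS1 f t) <= C / M.+1%:R.
    apply: sqS1_bounded; first by apply: L2B; [exact: L2_interpN|exact: L2_lift].
    move=> t t01; apply: (le_trans (nodes_close _ (L2_interpN _) (intS1_Dvec f) _ t01)).
    rewrite ler_pM2r ?invr_gt0//; exact: le_trans (sqS1_Dvec_le f) fC.
  move: HM h1 h2; rewrite -mulrA; set q := C / M.+1%:R => *; lra.
have cB (j : 'I_M.+1) : `|c 0 j| <= B.
  rewrite mxE; apply: (le_trans (lift_sup f _)); first exact/cell_le/ltnW.
  by rewrite lerD2l ler_pM2l.
have Kc t : `|K (interpN f) t - K (interpN c) t| <= e / 4.
  rewrite -K_sub; [|exact: L2_interpN|exact: L2_interpN].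
  have := HK _ _ (L2B (L2_interpN f) (L2_interpN c)) (ltW e10) close t.
  by rewrite (_ : MK * e1 = e / 4)// /e1; field; rewrite gt_eqF.
have Kcxy : `|K (interpN c) x - K (interpN c) y| <= e / 2.
  rewrite !K_interpN -sumrB (le_trans (ler_norm_sum _ _ _))//.
  apply: (@le_trans _ _ (\sum_(j < M.+1) B * (e / (2 * (M.+1%:R * B))))).
    apply: ler_sum => j _; rewrite -mulrBr normrM ler_pM//; exact: Hd.
  rewrite sumr_const card_ord -[leLHS]mulr_natl.
  rewrite (_ : M.+1%:R * (B * (e / (2 * (M.+1%:R * B)))) = e / 2)//.
  by field; apply/andP; split; rewrite gt_eqF.
rewrite (_ : _ - _ = (K (interpN f) x - K (interpN c) x)
   + (K (interpN c) x - K (interpN c) y) - (K (interpN f) y - K (interpN c) y));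
  last by ring.
have := Kc x; have := Kc y => k1 k2.
rewrite (le_trans (ler_normB _ _))// (le_trans (lerD (ler_normD _ _) (lexx _)))//.
lra.
Qed.

End Operator.

(** * Uniform continuity of the integrand on boxes *)

Section ContinuousIntegrand.
Context {R : realType}.
Implicit Types H : R * R * R -> R.

Lemma box_unif H (P G e : R) : continuous H -> 0 < e ->
  exists2 d : R, 0 < d & forall p v t p' v' t' : R,
    `|p| <= P -> `|v| <= G -> 0 <= t <= 1 ->
    `|p - p'| <= d -> `|v - v'| <= d -> `|t - t'| <= d ->
    `|H (p, v, t) - H (p', v', t')| <= e.
Proof.
move=> cH e0.
pose A : set (R * R * R) := (`[- P, P]%classic `*` `[- G, G]%classic) `*` `[0, 1]%classic.
have cA : compact A.
  by apply: compact_setX; [apply: compact_setX|]; exact: segment_compact.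
have [d d0 Hd] := heine_cantor cA cH e0.
exists (d / 2); first by rewrite divr_gt0.
move=> p v t p' v' t' pP vG t01 pp vv tt; apply: Hd.
  by split; [split|]; rewrite /= in_itv/= -?ler_norml.
have dd : d / 2 < d by lra.
by split; [split|]; rewrite /ball/=; exact: le_lt_trans dd.
Qed.

Lemma continuous_triple H (a b : R -> R) : continuous H -> continuous a ->
  continuous b -> continuous (fun t => H (a t, b t, t)).
Proof.
move=> cH ca cb t.
have h1 : (a s, b s) @[s --> t] --> (a t, b t).
  exact: (@cvg_pair _ _ _ (nbhs t) (nbhs (a t)) (nbhs (b t)) _ _ _ a b (ca t) (cb t)).
have h2 : (a s, b s, s) @[s --> t] --> (a t, b t, t).
  exact: (@cvg_pair _ _ _ (nbhs t) (nbhs (a t, b t)) (nbhs t) _ _ _ _ _ h1 (@cvg_id _ _)).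
exact: (@cvg_comp _ _ _ (fun s => (a s, b s, s)) H (nbhs t) (nbhs (a t, b t, t))
  (nbhs (H (a t, b t, t))) h2 (cH _)).
Qed.

End ContinuousIntegrand.

(** * Consistency of the nonlinear term *)

Section Functional.
Context {R : realType}.
Variables (K : (R -> R) -> R -> R) (g w : R -> R) (Phi : R -> R -> R -> R).
Hypotheses (K_linear : L2_linear K) (K_bounded : L2_to_C_bounded K).
Hypotheses (Cg : C_S1 g) (A1 : admissible_window w).
Let H (z : R * R * R) := Phi z.1.1 z.1.2 z.2.
Hypothesis (cH : continuous H).
Hypothesis (Phi_periodic : forall p v : R, periodic (Phi p v) 1).
Implicit Types f h : R -> R.

Definition Pint f : R := intS1 (fun t => Phi (K f t) (g t) t).

Lemma Pint_continuous f : L2_S1 f -> continuous (fun t => Phi (K f t) (g t) t).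
Proof.
move=> Lf; have [_ cK] := K_C K_bounded Lf; have [_ cg] := Cg.
exact: (continuous_triple cH cK cg).
Qed.

Lemma Pint_L1 f : L2_S1 f -> L1 (fun t => Phi (K f t) (g t) t).
Proof. by move=> Lf; apply: L1_continuous; exact: Pint_continuous. Qed.

(** [K] turns L^2 closeness into uniform closeness of the first argument of [Phi]. The box has
    radius MK (1 + B) because B <= (1 + B)^2. *)
Lemma Pint_close (B e : R) : 0 <= B -> 0 < e -> exists2 d : R, 0 < d &
  forall u f, L2_S1 u -> L2_S1 f -> sqS1 u <= B ->
    sqS1 (fun t => f t - u t) <= d -> `|Pint f - Pint u| <= e.
Proof.
move=> B0 e0; have [MK MK0 HK] := K_bound K_bounded.
have [G G0 gG] := C_S1_bounded Cg.
have [d d0 Hd] := box_unif (MK * (1 + B)) G cH e0.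
exists ((d / MK) ^+ 2); first by rewrite exprn_gt0// divr_gt0.
move=> u f Lu Lf uB fu; rewrite -intS1B; [|exact: Pint_L1|exact: Pint_L1].
apply: normr_intS1_le; first by apply: L1B; exact: Pint_L1.
move=> t t01; rewrite distrC; apply: (Hd (K u t) (g t) t (K f t) (g t) t) => //.
- by apply: HK => //; [lra|nra].
- rewrite distrC -(K_sub K_linear)//.
  have dM : 0 <= d / MK by rewrite divr_ge0// ltW.
  apply: (le_trans (HK _ _ (L2B Lf Lu) dM fu t)).
  by rewrite mulrC divfK// gt_eqF.
- by rewrite subrr normr0 ltW.
- by rewrite subrr normr0 ltW.
Qed.

(** The sum is the integral of a step function; the [a i] need not be values of [phi], as the window
    averages are not. *)
Lemma riemann_sum (n : nat) (phi : R -> R) (a : 'I_n.+1 -> R) (e : R) :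
  periodic phi 1 -> L1 phi ->
  (forall (i : 'I_n.+1) t, i%:R / n.+1%:R <= t < i.+1%:R / n.+1%:R ->
     `|phi t - a i| <= e) ->
  `|n.+1%:R^-1 * \sum_(i < n.+1) a i - intS1 phi| <= e.
Proof.
move=> pphi Lphi phia; pose c : 'rV[R]_n.+1 := \row_i a i.
have Lc := L2_L1 (L2_interpN c).
have -> : n.+1%:R^-1 * \sum_(i < n.+1) a i = intS1 (interpN c).
  rewrite (@intS1_interpN _ _ _ (fun x => x))//; congr (_ * _).
  by apply: eq_bigr => i _; rewrite mxE.
rewrite distrC -intS1B//; apply: normr_intS1_le; first exact: L1B.
apply: periodic_itv => [t|t t01]; first by rewrite pphi interpN_periodic.
have [m mt] := @cell_exists R n.+1 t isT t01.
by rewrite (@interpN_in _ _ _ m)// mxE; exact: phia.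
Qed.

(** On each cell the three arguments of [Phi] are off by a window average of [K (interpN f)], a
    window average of [g], and the distance to the node. Equicontinuity over all [f] with
    [sqH1N f <= C] makes the threshold uniform. *)
Lemma consistency (C e : R) : 0 <= C -> 0 < e ->
  exists N0 : nat, forall (n : nat) (f : 'rV[R]_n.+1), (N0 <= n)%N -> sqH1N f <= C ->
    `|n.+1%:R^-1 * \sum_(i < n.+1) Phi (KN K w f i) (sample w g i) (grid i)
      - Pint (interpN f)| <= e.
Proof.
move=> C0 e0; have [MK MK0 HK] := K_bound K_bounded.
have [G G0 gG] := C_S1_bounded Cg.
have [d d0 Hd] := box_unif (MK * (1 + C)) G cH e0.
have [A [W [A0 W0 HW]]] := sample_approx A1.
(* The oscillation allowed in a window: the averaging error W o must not exceed d, and the 1 keeps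
   the divisor positive. *)
pose o := d / (W + 1); have o0 : 0 < o by rewrite divr_gt0// ltr_wpDl.
have Wo : W * o <= d.
  rewrite /o mulrA ler_pdivrMr ?ltr_wpDl//; nra.
have [d1 [N1 [d10 H1]]] := KI_equicontinuous K_linear K_bounded C0 o0.
have [d2 d20 H2] := C_S1_unif Cg o0.
pose D := Num.min d (Num.min d1 d2).
have D0 : 0 < D by rewrite !lt_min d0 d10.
(* With (A + 1) / N below D, both the window radius A / N and the mesh 1 / N are. *)
pose N2 := Num.truncn ((A + 1) / D).
exists (maxn N1 N2) => n f; rewrite geq_max => /andP[n1 n2] fC.
have n0 : 0 < n.+1%:R :> R by rewrite ltr0n.
have AD : (A + 1) / n.+1%:R <= D.
  rewrite ler_pdivrMr// mulrC -ler_pdivrMr// ltW//.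
  apply: (lt_le_trans (truncnS_gt _)); rewrite ler_nat.
  exact: n2.
have An : A / n.+1%:R <= D.
  by apply: le_trans AD; rewrite ler_pM2r ?invr_gt0// lerDl.
have n1D : n.+1%:R^-1 <= D.
  by apply: le_trans AD; rewrite mulrDl mul1r lerDr divr_ge0// ltW.
have Dd : D <= d by rewrite ge_min lexx.
have Dd1 : D <= d1 by rewrite !ge_min lexx orbT.
have Dd2 : D <= d2 by rewrite !ge_min lexx !orbT.
have LI := L2_interpN f; have CKf := K_C K_bounded LI.
apply: riemann_sum; [|exact: Pint_L1|].
  by move=> t; case: CKf Cg => [pK _] [pg _]; rewrite pK pg Phi_periodic.
move=> i t /andP[it ti].
have t01 : 0 <= t <= 1.
  have /andP[a0 _] := @cell_le R n i (ltnW (ltn_ord i)).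
  have /andP[_ a1] := @cell_le R n i.+1 (ltn_ord i).
  by rewrite (le_trans a0 it) (le_trans (ltW ti) a1).
have tg : `|t - grid i| <= n.+1%:R^-1.
  rewrite ger0_norm ?subr_ge0// -[leRHS](cell_width n i) lerD2r; exact: ltW.
apply: (Hd (K (interpN f) t) (g t) t).
- apply: HK => //; first lra.
  by have := sqS1_interpN_le f; nra.
- exact: gG.
- exact: t01.
- rewrite distrC; apply: le_trans Wo; apply: HW => //; first exact: ltW.
  move=> y yt; apply: (H1 n f n1 fC); exact: le_trans yt (le_trans An Dd1).
- rewrite distrC; apply: le_trans Wo; apply: HW => //; first exact: ltW.
  move=> y yt; apply: H2; exact: le_trans yt (le_trans An Dd2).
- exact: le_trans tg (le_trans n1D Dd).
Qed.

End Functional.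

(** * Continuity and convexity tools *)

Section Integrand.
Context {R : realType}.

Lemma locally_lipschitz_continuous (H : R * R * R -> R) :
  (forall z : R * R * R, exists2 U : set (R * R * R), nbhs z U &
     [lipschitz H x | x in U]) -> continuous H.
Proof.
move=> HL z; have [U Uz /pinfty_ex_gt0[M M0 HM]] := HL z.
apply/cvgrPdist_le => e e0.
have Ub : nbhs z (ball z (e / M)) by apply: nbhsx_ballx; rewrite divr_gt0.
near=> x.
have Ux : U x by near: x.
have bx : ball z (e / M) x by near: x.
have := HM (z, x) (conj (nbhs_singleton Uz) Ux); rewrite /= => /le_trans; apply.
rewrite -ler_pdivlMl// mulrC ltW//.
by move: bx; rewrite -ball_normE.
Unshelve. all: by end_near. Qed.

Lemma continuous_scale (T : topologicalType) (a : R) (F : T -> R) :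
  continuous F -> continuous (fun x => a * F x).
Proof.
move=> cF x; apply: (@cvgM R T (nbhs x) _ (fun=> a) F a (F x)); last exact: cF.
exact: cvg_cst.
Qed.

Lemma continuous_add (T : topologicalType) (F G : T -> R) :
  continuous F -> continuous G -> continuous (fun x => F x + G x).
Proof.
move=> cF cG x.
by apply: (@cvgD R R T (nbhs x) _ F G (F x) (G x)); [exact: cF|exact: cG].
Qed.

Lemma continuous_sqr (T : topologicalType) (F : T -> R) :
  continuous F -> continuous (fun x => F x ^+ 2).
Proof. by move=> cF x; apply: (@cvgM R T (nbhs x) _ F F (F x) (F x)); exact: cF. Qed.

Lemma convex_midpoint (phi : R -> R) (p q : R) :
  convex_function (E := R^o) setT phi ->
  phi (2^-1 * (p + q)) <= 2^-1 * (phi p + phi q).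
Proof.
move=> cphi.
have h0 : (0 : R) <= 2^-1 by rewrite invr_ge0.
have h1 : 2^-1 <= (1 : R) by rewrite invf_le1// ler1n.
have E (x y : R^o) : conv (Itv01 h0 h1) x y = 2^-1 * (x + y).
  rewrite convRE/= mulrDr; congr (_ + _ * _).
  by rewrite -[LHS]/(1 - 2^-1); field.
have := cphi (Itv01 h0 h1) p q (mem_set I) (mem_set I); rewrite E => H.
rewrite -(E p q); exact: H.
Qed.

End Integrand.

(** * The discrete minimization problems *)

Section DiscreteProblem.
Context {R : realType}.
Variables (K : (R -> R) -> R -> R) (g w : R -> R) (Phi : R -> R -> R -> R) (rho b : R).
Hypotheses (K_linear : L2_linear K) (K_bounded : L2_to_C_bounded K).
Hypotheses (A1 : admissible_window w) (rho_gt0 : 0 < rho).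
Hypothesis Phi_convex : forall v t : R, convex_function (E := R^o) setT (fun p => Phi p v t).
Hypothesis Phi_continuous : forall v t : R, continuous (fun p => Phi p v t).
Hypothesis Phi_ge : forall p v t, b <= Phi p v t.
Variable n : nat.
Implicit Types f h : 'rV[R]_n.+1.
Local Notation Psin := (@PsiN R K g w Phi rho n.+1).

Lemma PsiNE f : Psin f =
  n.+1%:R^-1 * \sum_(i < n.+1) Phi (KN K w f i) (sample w g i) (grid i)
  + rho / 2 * sqH1N f.
Proof. by rewrite /PsiN /sqH1N invfM !mulrA. Qed.

Lemma C_S1_sum (I : Type) (r : seq I) (a : I -> R) (F : I -> R -> R) (i : 'I_n.+1) :
  (forall j, C_S1 (F j)) ->
  C_S1 (fun s => \sum_(j <- r) a j * F j s) /\
  sample w (fun s => \sum_(j <- r) a j * F j s) i = \sum_(j <- r) a j * sample w (F j) i.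
Proof.
move=> CF; elim: r => [|j r [C IH]].
  rewrite (_ : (fun s => _) = fun=> 0); last first.
    by apply/funext => s; rewrite big_nil.
  have C0 : C_S1 (fun _ : R => 0 : R) by split=> // t; exact: cvg_cst.
  split=> //; rewrite big_nil.
  have := sample_lin 1 i A1 (ltn0Sn n) C0 C0.
  rewrite (_ : (fun t : R => 1 * 0 + 0) = fun=> 0) => [E|]; first lra.
  by apply/funext => s; rewrite mulr0 addr0.
rewrite (_ : (fun s => _) = fun s => a j * F j s + \sum_(k <- r) a k * F k s); last first.
  by apply/funext => s; rewrite big_cons.
split; last by rewrite (sample_lin _ _ A1)// IH big_cons.
have [pF cF] := CF j; have [pr cr] := C.
split=> [t|t]; first by rewrite pF pr.
by apply: cvgD; [apply: cvgM; [exact: cvg_cst|exact: cF]|exact: cr].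
Qed.

(** The matrix of [KN], from which continuity and compatibility with midpoints follow. *)
Lemma KNE f (i : 'I_n.+1) :
  KN K w f i = \sum_(j < n.+1) f 0 j * sample w (K (cellf j)) i.
Proof.
rewrite /KN (_ : K (interpN f) = fun s => \sum_(j < n.+1) f 0 j * K (cellf j) s).
  apply: (C_S1_sum _ _ _ _).2 => j; apply: (K_C K_bounded); exact: L2_interpN.
by apply/funext => s; rewrite K_interpN.
Qed.

Lemma KN_midpoint f h (i : 'I_n.+1) :
  KN K w (2^-1 *: (f + h)) i = 2^-1 * (KN K w f i + KN K w h i).
Proof.
rewrite !KNE -big_split/= mulr_sumr; apply: eq_bigr => j _.
by rewrite !mxE; ring.
Qed.

Lemma DN_midpoint f h (i : 'I_n.+1) :
  DN (2^-1 *: (f + h)) i = 2^-1 * (DN f i + DN h i).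
Proof. by rewrite /DN !mxE; ring. Qed.

(** Strong convexity: rho / 8 is rho / 2 times the 1/4 of the parallelogram law for the values. The
    similar gain in the difference quotients is dropped, as uniqueness needs only the values. *)
Lemma PsiN_midpoint f h : Psin (2^-1 *: (f + h)) <=
  2^-1 * (Psin f + Psin h)
    - rho / 8 * (n.+1%:R^-1 * \sum_(i < n.+1) (f 0 i - h 0 i) ^+ 2).
Proof.
rewrite !PsiNE.
set Sm := \sum_(i < _) Phi _ _ _; set Sf := \sum_(i < _) Phi _ _ _.
set Sh := \sum_(i < _) Phi _ _ _; set D := \sum_(i < _) _.
have S : n.+1%:R^-1 * Sm <= 2^-1 * (n.+1%:R^-1 * Sf + n.+1%:R^-1 * Sh).
  rewrite -mulrDr mulrCA ler_pM2l ?invr_gt0 ?ltr0n//.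
  rewrite -big_split/= mulr_sumr; apply: ler_sum => i _.
  rewrite KN_midpoint.
  exact: (convex_midpoint _ _ (Phi_convex (sample w g i) (grid i))).
have Q : sqH1N (2^-1 *: (f + h)) <=
    2^-1 * (sqH1N f + sqH1N h) - 4^-1 * (n.+1%:R^-1 * D).
  rewrite /sqH1N -mulrDr [X in _ - X]mulrCA [X in X - _]mulrCA -mulrBr.
  rewrite ler_pM2l ?invr_gt0 ?ltr0n// -big_split/= !mulr_sumr -sumrB.
  apply: ler_sum => i _; rewrite DN_midpoint !mxE.
  by have := sqr_ge0 (DN f i - DN h i); nra.
move: S Q; move: (n.+1%:R^-1 * Sm) (n.+1%:R^-1 * Sf) (n.+1%:R^-1 * Sh).
move: (n.+1%:R^-1 * D) (sqH1N _) (sqH1N f) (sqH1N h) => x d1 d2 d3 s1 s2 s3 S Q.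
have : rho * d1 <= rho * (2^-1 * (d2 + d3) - 4^-1 * x) by rewrite ler_pM2l.
by move=> *; lra.
Qed.

Lemma PsiN_unique f h : is_argmin setT Psin f -> is_argmin setT Psin h -> f = h.
Proof.
move=> [_ mf] [_ mh].
have fh : Psin f = Psin h by apply/eqP; rewrite eq_le mf// mh.
have := PsiN_midpoint f h; have := mf (2^-1 *: (f + h)) I; rewrite -fh.
set D := \sum_(i < _) _ => h1 h2.
have D0 : 0 <= D by apply: sumr_ge0 => i _; exact: sqr_ge0.
have n0 : 0 < n.+1%:R^-1 :> R by rewrite invr_gt0 ltr0n.
have Dz : n.+1%:R^-1 * D <= 0.
  have : rho / 8 * (n.+1%:R^-1 * D) <= 0.
    by move: h1 h2; move: (rho / 8 * _) (Psin f) (Psin _) => x y z; lra.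
  by rewrite pmulr_rle0// divr_gt0.
move: Dz; rewrite pmulr_rle0// => Dz.
have : D == 0 by rewrite eq_le Dz D0.
rewrite psumr_eq0 => [|i _]; last exact: sqr_ge0.
move=> /allP Dall; apply/rowP => i; apply/eqP; rewrite -subr_eq0 -sqrf_eq0.
by apply: (Dall i); rewrite mem_index_enum.
Qed.

Lemma PsiN_continuous : continuous Psin.
Proof.
have cc (j : 'I_n.+1) : continuous (fun f : 'rV[R]_n.+1 => f 0 j).
  exact: coord_continuous.
have csum (F : 'I_n.+1 -> 'rV[R]_n.+1 -> R) : (forall i, continuous (F i)) ->
    continuous (fun f => \sum_(i < n.+1) F i f).
  move=> cF; apply: continuous_big => [|i _]; last exact: cF.
  exact: add_continuous.
have cM (a : R) (F : 'rV[R]_n.+1 -> R) : continuous F -> continuous (fun f => a * F f).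
  exact: continuous_scale.
have cD (F G : 'rV[R]_n.+1 -> R) : continuous F -> continuous G ->
    continuous (fun f => F f + G f).
  exact: continuous_add.
have cX (F : 'rV[R]_n.+1 -> R) : continuous F -> continuous (fun f => F f ^+ 2).
  exact: continuous_sqr.
have cDN i : continuous (fun f => DN f i).
  apply: (cM); rewrite (_ : (fun f => _) = fun f : 'rV[R]_n.+1 => f 0 (ordS i) + -1 * f 0 i).
    by apply: cD; [exact: cc|apply: cM; exact: cc].
  by apply/funext => f; rewrite mulN1r.
have cKN i : continuous (fun f => KN K w f i).
  rewrite (_ : (fun f => _) = fun f : 'rV[R]_n.+1 =>
      \sum_(j < n.+1) sample w (K (cellf j)) i * f 0 j); last first.
    by apply/funext => f; rewrite KNE; apply: eq_bigr => j _; rewrite mulrC.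
  by apply: csum => j; apply: cM; exact: cc.
apply: (cD).
  apply: (cM); apply: (csum) => i f.
  apply: (@cvg_comp _ _ _ (fun f => KN K w f i)
    (fun p => Phi p (sample w g i) (grid i)) _ (nbhs (KN K w f i))); first exact: cKN.
  exact: Phi_continuous.
by apply: cM; apply: csum => i; apply: cD; apply: cX; [exact: cc|exact: cDN].
Qed.

Lemma PsiN_ge f : b + rho / 2 * sqH1N f <= Psin f.
Proof.
rewrite PsiNE lerD2r; apply: (@le_trans _ _ (n.+1%:R^-1 * \sum_(i < n.+1) b)).
  by rewrite sumr_const card_ord -[b *+ _]mulr_natl mulrA mulVf ?mul1r.
by rewrite ler_pM2l ?invr_gt0 ?ltr0n//; exact: ler_sum.
Qed.

Lemma PsiN_argmin_exists : exists f, is_argmin setT Psin f.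
Proof.
(* By [PsiN_ge], a coordinate whose square is at least the second summand already makes the value at
   least [Psin 0]; the 1 ensures r <= r^2. *)
pose r := 1 + 2 * n.+1%:R / rho * (Psin 0 - b).
have P0 : 0 <= Psin 0 - b.
  rewrite subr_ge0; apply: le_trans (PsiN_ge 0).
  rewrite lerDl; have := sqH1N_ge0 (0 : 'rV[R]_n.+1); move: (sqH1N _) => x x0.
  by rewrite mulr_ge0// divr_ge0// ltW.
have r0 : 0 <= r by rewrite addr_ge0// mulr_ge0// divr_ge0// ?mulr_ge0// ltW.
pose A := [set f : 'rV[R]_n.+1 | forall i, (`[- r, r]%classic : set R) (f ord0 i)].
have cA : compact A.
  apply: (@rV_compact R n.+1 (fun=> `[- r, r]%classic)) => i.
  exact: segment_compact.
have A0 : A 0.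
  by move=> i /=; rewrite mxE in_itv/= oppr_le0 r0.
have [c _ cmin] : exists2 c, c \in A & forall t, t \in A -> Psin c <= Psin t.
  apply: compact_EVT_min => //; first by exists 0.
  by apply: continuous_subspaceT; exact: PsiN_continuous.
exists c; split=> // f _.
have [Af|nAf] := pselect (A f); first by apply: cmin; rewrite inE.
apply: (@le_trans _ _ (Psin 0)); first by apply: cmin; rewrite inE.
have [i ri] : exists i, r < `|f 0 i|.
  apply: contrapT => H; apply: nAf => i /=; rewrite in_itv/= -ler_norml leNgt.
  by apply/negP => ri; apply: H; exists i.
have fi : f 0 i ^+ 2 <= n.+1%:R * sqH1N f.
  rewrite /sqH1N mulrA divff ?mul1r// (bigD1 i)//= -addrA lerDl.
  by rewrite addr_ge0 ?sqr_ge0// sumr_ge0// => j _; rewrite addr_ge0 ?sqr_ge0.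
have f2 : r <= f 0 i ^+ 2.
  have r1 : 1 <= r by rewrite lerDl mulr_ge0// divr_ge0// ?mulr_ge0// ltW.
  by rewrite -real_normK ?num_real//; nra.
apply: le_trans (PsiN_ge f); rewrite -lerBlDl.
have : 2 * n.+1%:R / rho * (Psin 0 - b) <= n.+1%:R * sqH1N f.
  by rewrite (le_trans _ (le_trans f2 fi))// /r lerDr.
rewrite (_ : 2 * n.+1%:R / rho * _ = n.+1%:R * (2 / rho * (Psin 0 - b))); last first.
  by field; rewrite gt_eqF.
rewrite ler_pM2l ?ltr0n// => H.
rewrite -(ler_pM2l (_ : 0 < 2 / rho)) ?divr_gt0//.
by rewrite (_ : 2 / rho * (rho / 2 * _) = sqH1N f)//; field; rewrite gt_eqF.
Qed.

End DiscreteProblem.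

(** * Perturbation of norms, midpoints, null sets *)

Section Preliminaries.
Context {R : realType}.
Local Notation mu := (@lebesgue_measure R).
Implicit Types f h : R -> R.

Lemma archi_div_le (x d : R) : 0 < d ->
  exists N0 : nat, forall n, (N0 <= n)%N -> x / n.+1%:R <= d.
Proof.
move=> d0; have x0 : 0 <= `|x| / d by rewrite divr_ge0// ltW.
exists (Num.Def.archi_bound (`|x| / d)) => n Nn.
rewrite ler_pdivrMr ?ltr0n// mulrC -ler_pdivrMr//.
apply: (@le_trans _ _ (`|x| / d)); first by rewrite ler_pM2r ?invr_gt0// ler_norm.
apply: ltW; apply: (lt_le_trans (archi_boundP x0)).
by rewrite ler_nat; exact: leqW.
Qed.

Lemma sqS1_close (B e : R) : 0 <= B -> 0 < e -> exists2 d : R, 0 < d &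
  forall u f, L2_S1 u -> L2_S1 f -> sqS1 u <= B ->
    sqS1 (fun t => f t - u t) <= d -> `|sqS1 f - sqS1 u| <= e.
Proof.
move=> B0 e0; have B1 : 0 < B + 1 by rewrite ltr_wpDl.
(* The difference of the squared norms is D + 2 I, with D the squared distance and I an inner
   product: D <= e / 2, and Cauchy-Schwarz gives I^2 <= D (B + 1) <= (e / 4)^2. *)
exists (Num.min (e / 2) (e ^+ 2 / (16 * (B + 1)))).
  by rewrite lt_min !divr_gt0 ?exprn_gt0// mulr_gt0.
move=> u f Lu Lf uB; rewrite le_min => /andP[d1 d2].
have := sqS1_lin 1 (L2B Lf Lu) Lu; have := cauchy_schwarz (L2B Lf Lu) Lu.
rewrite (@eq_sqS1 _ (fun t => 1 * _ + _) f); last by move=> t _; rewrite mul1r subrK.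
have D0 := sqS1_ge0 (fun t => f t - u t); have U0 := sqS1_ge0 u.
move: D0 d1 d2; move: (sqS1 _) (intS1 _) => D I D0 d1 d2 CS ->.
have I2 : I ^+ 2 <= (e / 4) ^+ 2.
  apply: (le_trans CS); apply: (@le_trans _ _ (D * (B + 1))).
    by rewrite ler_wpM2l// (le_trans uB)// lerDl.
  by move: d2; rewrite ler_pdivlMr ?mulr_gt0//; lra.
have : `|I| <= e / 4.
  have e4 : 0 <= e / 4 by rewrite divr_ge0// ltW.
  by rewrite -ler_sqr ?nnegrE// real_normK ?num_real.
rewrite !ler_norml => /andP[I1 I3]; apply/andP; split; lra.
Qed.

(** The midpoint is written with two steps of the form a f + h, the shape handled by [L2_lin],
    [weak_lin] and [K_linear]. *)
Lemma sqS1_midpoint f h : L2_S1 f -> L2_S1 h ->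
  sqS1 (fun t => 2^-1 * (-1 * h t + f t) + h t)
    = 2^-1 * (sqS1 f + sqS1 h) - 4^-1 * sqS1 (fun t => f t - h t).
Proof.
move=> Lf Lh; have Ld := L2_lin (-1) Lh Lf.
have := sqS1_lin 1 Ld Lh; have := sqS1_lin 2^-1 Ld Lh => ->.
rewrite (@eq_sqS1 _ (fun t => 1 * _ + _) f); last by move=> t _; ring.
rewrite (@eq_sqS1 _ (fun t => f t - h t) (fun t => -1 * h t + f t)); last first.
  by move=> t _; ring.
by move=> ->; field.
Qed.

(** Translation invariance, as the case c = 1 of the affine change of variable applied to an
    indicator. *)
Lemma null_translate (A : set R) (a : R) : measurable (A : set (measurableTypeR R)) ->
  mu A = 0%E -> mu.-negligible [set t : R | A (t - a)].
Proof.
move=> mA A0.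
have mB : measurable ([set t : R | A (t - a)] : set (measurableTypeR R)).
  have mf : measurable_fun [set: measurableTypeR R] (fun t : R => t - a : measurableTypeR R).
    by apply: measurable_funB.
  by have := mf measurableT _ mA; rewrite setTI.
exists [set t : R | A (t - a)]; split=> //.
have E := @integral_indic _ (measurableTypeR R) R mu setT measurableT.
have := @ge0_integral_affine R 1 a (fun t => (\1_A t)%:E) ltr01.
have EA : (\int[mu]_(t in [set: measurableTypeR R]) (\1_A t)%:E = 0)%E.
  by rewrite (E A mA) setIT; exact: A0.
rewrite EA mule0 => <-; last 2 first.
- by apply/measurable_EFinP; exact: measurable_indic.
- by move=> t; rewrite lee_fin.
rewrite -[LHS]/(mu [set t : R | A (t - a)]) -[X in mu X]setIT.
rewrite -(E _ mB).
apply: eq_integral => t _; rewrite !indicE /affine mul1r.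
by congr ((_%:R)%:E); apply/idP/idP; rewrite !inE.
Qed.

(** The exceptional set is covered by the countably many integer translates of a null set, split by
    the sign of the integer part. *)
Lemma ae01_periodic f h : periodic f 1 -> periodic h 1 -> ae01 f h ->
  f = h %[ae mu].
Proof.
move=> pf ph [A [mA A0 HA]].
pose P := \bigcup_n [set t : R | A (t - n%:R)].
pose N := \bigcup_n [set t : R | A (t - (- n.+1%:R))].
have : mu.-negligible (P `|` N).
  by apply: negligibleU; apply: negligible_bigcup => k; exact: null_translate.
apply: negligibleS => t /= ft.
have At : A (fracp t).
  apply: HA => /= H; apply: ft => _.
  rewrite -(periodic_frac t pf) -(periodic_frac t ph); apply: H.
  by have /andP[-> /ltW] := fracp_itv t.
move: At; rewrite /fracp; case: (Num.floor t) => k At.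
  by left; exists k.
by right; exists k => //=; move: At; rewrite NegzE mulrNz.
Qed.

End Preliminaries.

(** * Comparison of the discrete and continuous functionals *)

Section ContinuousProblem.
Context {R : realType}.
Local Notation mu := (@lebesgue_measure R).
Variables (K : (R -> R) -> R -> R) (g w : R -> R) (Phi : R -> R -> R -> R) (rho b : R).
Hypotheses (K_linear : L2_linear K) (K_bounded : L2_to_C_bounded K).
Hypotheses (Cg : C_S1 g) (A1 : admissible_window w) (rho_gt0 : 0 < rho).
Hypothesis cH : continuous (fun z : R * R * R => Phi z.1.1 z.1.2 z.2).
Hypothesis Phi_periodic : forall p v : R, periodic (Phi p v) 1.
Hypothesis Phi_convex : forall v t : R, convex_function (E := R^o) setT (fun p => Phi p v t).
Hypothesis Phi_ge : forall p v t, b <= Phi p v t.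
Implicit Types f h u v : R -> R.
Local Notation PsiF := (Psi K g Phi rho).
Local Notation PintF := (Pint K g Phi).

Lemma K_ae f h t : L2_S1 f -> L2_S1 h -> ae01 f h -> K f t = K h t.
Proof.
move=> Lf Lh fh; have [M M0 KM] := K_bound K_bounded.
have Lfh := L2B Lf Lh.
have : sqS1 (fun t => f t - h t) = 0.
  rewrite (ae01_sqS1 Lfh (L2B Lh Lh)); last first.
    exact: (@ae01_comp2 _ (fun x y _ => x - y) f h h h fh (ae01_refl h)).
  rewrite (@eq_sqS1 _ _ (fun=> 0)); last by move=> s _; rewrite subrr.
  by rewrite /sqS1 intS1_cst expr0n.
move=> E; have := KM _ 0 Lfh (lexx 0) _ t.
rewrite E expr0n lexx mulr0 normr_le0 K_sub// subr_eq0 => /(_ isT) /eqP; exact.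
Qed.

(** [wderiv] is a chosen representative; this form of [Psi] accepts any other, such as the step
    function of a lift. *)
Lemma PsiE f h : H1_S1 f -> L2_S1 h -> ae01 (wderiv f) h ->
  PsiF f = PintF f + rho / 2 * (sqS1 f + sqS1 h).
Proof.
move=> Hf Lh fh; have [Lw _] := wderivP Hf; have Lf := H1_L2 Hf.
by rewrite /Psi intS1D; [rewrite -(ae01_sqS1 Lw Lh fh)|exact: L2_sqr..].
Qed.

Lemma Pint_ge f : L2_S1 f -> b <= PintF f.
Proof.
move=> Lf; rewrite -[leLHS](intS1_cst b); apply: le_intS1 => //; first exact: L1_cst.
exact: (Pint_L1 K_bounded Cg cH).
Qed.

Lemma Psi_ge f : H1_S1 f -> b <= PsiF f.
Proof.
move=> Hf; have [Lw _] := wderivP Hf.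
rewrite (PsiE Hf Lw (ae01_refl _)) (le_trans (Pint_ge (H1_L2 Hf)))// lerDl.
by rewrite mulr_ge0 ?addr_ge0 ?sqS1_ge0// divr_ge0// ltW.
Qed.

(** The derivative terms agree exactly. The consistency error, the passage from step function to
    lift in [Pint], and the same passage in the squared norm cost e / 4 each. *)
Lemma Psi_lift_le (C e : R) : 0 <= C -> 0 < e -> exists N0 : nat,
  forall n (f : 'rV[R]_n.+1), (N0 <= n)%N -> sqH1N f <= C ->
    PsiF (liftS1 f) <= PsiN K g w Phi rho f + e.
Proof.
move=> C0 e0; have e4 : 0 < e / 4 by rewrite divr_gt0.
have er : 0 < e / (2 * rho) by rewrite divr_gt0// mulr_gt0.
have [N1 HN1] := consistency K_linear K_bounded Cg A1 cH Phi_periodic C0 e4.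
have [d1 d10 Hd1] := Pint_close K_linear K_bounded Cg cH C0 e4.
have [d2 d20 Hd2] := sqS1_close C0 er.
have [N2 HN2] := @archi_div_le R C (Num.min d1 d2) ltac:(by rewrite lt_min d10).
exists (maxn N1 N2) => n f; rewrite geq_max => /andP[n1 n2] fC.
have [Hl wl] := lift_H1 f; have Li := L2_interpN f; have Ll := L2_lift f.
have fB := le_trans (sqS1_interpN_le f) fC.
have : sqS1 (fun t => liftS1 f t - interpN f t) <= Num.min d1 d2.
  apply: (le_trans (sqS1_lift_close f)); apply: le_trans (HN2 n n2).
  by rewrite ler_pM2r ?invr_gt0 ?ltr0n.
rewrite le_min => /andP[D1 D2].
have := Hd1 _ _ Li Ll fB D1; have := Hd2 _ _ Li Ll fB D2; have := HN1 n f n1 fC.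
rewrite (PsiE Hl (L2_interpN _) wl) PsiNE sqH1NE.
move: (_ * \sum_(i < _) _) (PintF _) (PintF _) => S P1 P2.
move: (sqS1 (interpN f)) (sqS1 (liftS1 f)) (sqS1 (interpN (Dvec f))) => q1 q2 q3.
rewrite !ler_norml => /andP[H1 _] /andP[_ H2] /andP[H3 H4].
have : rho * (q2 - q1) <= rho * (e / (2 * rho)) by rewrite ler_pM2l.
rewrite (_ : rho * (e / (2 * rho)) = e / 2); last by field; rewrite gt_eqF.
by move: H1 H3 H4 => *; lra.
Qed.

(** The vectors are the nodal values of the continuous representative [F]; their derivative term is
    at most that of [f] by [sqS1_Dvec_nodes], and the other terms are compared as for lifts. *)
Lemma recovery f (e : R) : H1_S1 f -> 0 < e ->
  exists (a : forall n : nat, 'rV[R]_n.+1) (N0 : nat), forall n, (N0 <= n)%N ->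
    PsiN K g w Phi rho (a n) <= PsiF f + e.
Proof.
move=> Hf e0; have [Lh wh] := wderivP Hf; have Lf := H1_L2 Hf.
have [h0 [c fF]] := weak_representation Lf Lh wh.
set h := wderiv f in Lh wh h0 fF *; pose F := primS1 c h.
have LF : L2_S1 F by exact: L2_primS1.
have PF : PintF f = PintF F.
  by apply: eq_intS1 => t _; rewrite (K_ae _ Lf LF fF).
have sF : sqS1 f = sqS1 F := ae01_sqS1 Lf LF fF.
exists (fun n => nodes n F).
have e4 : 0 < e / 4 by rewrite divr_gt0.
have er : 0 < e / (2 * rho) by rewrite divr_gt0// mulr_gt0.
have F0 := sqS1_ge0 F; have q0 := sqS1_ge0 h.
(* The values contribute at most twice the norm of [F] plus twice the nodal error, the latter below
   the norm of [h]; the difference quotients add one more norm of [h]. *)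
pose C := 2 * sqS1 F + 3 * sqS1 h.
have C0 : 0 <= C by rewrite /C; lra.
have [N1 HN1] := consistency K_linear K_bounded Cg A1 cH Phi_periodic C0 e4.
have [d1 d10 Hd1] := Pint_close K_linear K_bounded Cg cH F0 e4.
have [d2 d20 Hd2] := sqS1_close F0 er.
have [N2 HN2] := @archi_div_le R (sqS1 h) (Num.min d1 d2) ltac:(by rewrite lt_min d10).
exists (maxn N1 N2) => n; rewrite geq_max => /andP[n1 n2].
have Li := L2_interpN (nodes n F).
have cl : sqS1 (fun t => interpN (nodes n F) t - F t) <= sqS1 h / n.+1%:R.
  by apply: sqS1_bounded; [exact: L2B|move=> t; exact: nodes_close].
have Dn := @sqS1_Dvec_nodes R c h Lh h0 n.
have fC : sqH1N (nodes n F) <= C.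
  have := sqS1_D_le (L2B Li LF) LF; rewrite sqH1NE.
  rewrite (@eq_sqS1 _ _ (interpN (nodes n F))); last by move=> t _; rewrite subrK.
  have : sqS1 h / n.+1%:R <= sqS1 h by rewrite ler_pdivrMr ?ltr0n// ler_peMr// ler1n.
  move: cl Dn; rewrite /C -/F; move: (_ / _) => q *; lra.
have : sqS1 (fun t => interpN (nodes n F) t - F t) <= Num.min d1 d2.
  exact: (le_trans cl (HN2 n n2)).
rewrite le_min => /andP[D1 D2].
have := Hd1 _ _ LF Li (lexx _) D1; have := Hd2 _ _ LF Li (lexx _) D2.
have := HN1 n _ n1 fC.
rewrite (PsiE Hf Lh (ae01_refl _)) PsiNE sqH1NE PF sF -/F in Dn *.
move: Dn; move: (_ * \sum_(i < _) _) (PintF _) (PintF _) => S P1 P2.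
move: (sqS1 F) (sqS1 (interpN (nodes n F))) (sqS1 h) (sqS1 _) => q1 q2 q3 q4 H0.
rewrite !ler_norml => /andP[_ H1] /andP[_ H2] /andP[H3 H4].
have : rho * (q2 - q1) <= rho * (e / (2 * rho)) by rewrite ler_pM2l.
rewrite (_ : rho * (e / (2 * rho)) = e / 2); last by field; rewrite gt_eqF.
have : rho * q4 <= rho * q3 by rewrite ler_pM2l.
by move: H1 H3 H4 => *; lra.
Qed.

(** Convexity of [Phi] and the parallelogram law for both quadratic terms. The gain in the
    derivatives is kept here, because the Cauchy property is needed in H^1. *)
Lemma Psi_midpoint f h : H1_S1 f -> H1_S1 h ->
  exists2 m, H1_S1 m & PsiF m <= 2^-1 * (PsiF f + PsiF h)
    - rho / 8 * (sqS1 (fun t => f t - h t) + sqS1 (fun t => wderiv f t - wderiv h t)).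
Proof.
move=> Hf Hh; have [Lf' wf] := wderivP Hf; have [Lh' wh] := wderivP Hh.
have Lf := H1_L2 Hf; have Lh := H1_L2 Hh.
have Ld := L2_lin (-1) Lh Lf; have Ld' := L2_lin (-1) Lh' Lf'.
have Lm := L2_lin 2^-1 Ld Lh; have Lm' := L2_lin 2^-1 Ld' Lh'.
have [Hm mw] := H1_wderiv_ae Lm Lm'
  (weak_lin 2^-1 Ld Lh Ld' Lh' (weak_lin (-1) Lh Lf Lh' Lf' wh wf) wh).
exists (fun t => 2^-1 * (-1 * h t + f t) + h t) => //.
rewrite (PsiE Hm Lm' mw) (PsiE Hf Lf' (ae01_refl _)) (PsiE Hh Lh' (ae01_refl _)).
rewrite !sqS1_midpoint//.
have PL := Pint_L1 K_bounded Cg cH.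
have : PintF (fun t => 2^-1 * (-1 * h t + f t) + h t) <= 2^-1 * (PintF f + PintF h).
  rewrite /Pint -intS1D; [|exact: PL..].
  rewrite -intS1Z; last by apply: L1D; exact: PL.
  apply: le_intS1; [exact: PL|by apply: L1Z; apply: L1D; exact: PL|move=> t _].
  rewrite K_linear// K_linear//.
  rewrite (_ : 2^-1 * _ + _ = 2^-1 * (K f t + K h t)); last by field.
  exact: (convex_midpoint _ _ (Phi_convex (g t) t)).
move: (PintF _) (PintF f) (PintF h) => P P1 P2.
by move: (sqS1 f) (sqS1 h) (sqS1 _) (sqS1 _) (sqS1 _) (sqS1 _) => *; lra.
Qed.

End ContinuousProblem.

(** * Closedness of the weak derivative *)

Section WeakClosed.
Context {R : realType}.

(** By Cauchy-Schwarz both sides of the defining identity are continuous in L^2 for a fixed test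
    function. *)
Lemma weak_closed (v_ w_ : nat -> R -> R) (u h : R -> R) :
  (forall n, L2_S1 (v_ n)) -> (forall n, L2_S1 (w_ n)) -> L2_S1 u -> L2_S1 h ->
  (forall n, is_weak_derivative (v_ n) (w_ n)) ->
  (forall e : R, 0 < e -> exists N : nat, forall n, (N <= n)%N ->
    sqS1 (fun t => u t - v_ n t) <= e /\ sqS1 (fun t => h t - w_ n t) <= e) ->
  is_weak_derivative u h.
Proof.
move=> Lv Lw Lu Lh wv close.
move=> phi Cphi; have Lp := L2_Cinfty Cphi.
have Lp' := L2_Cinfty (Cinfty_derive1 Cphi).
set x := intS1 _; set y := intS1 _; apply/eqP; rewrite -subr_eq0 opprK.
rewrite -sqrf_eq0 eq_le sqr_ge0 andbT; apply/ler_addgt0Pl => e e0; rewrite addr0.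
set a := derive1 phi in x Lp' *.
have A0 := sqS1_ge0 a; have B0 := sqS1_ge0 phi.
(* Chosen so that the two squared errors, doubled, stay below e; the 1 excludes a zero divisor. *)
pose d := e / (2 * (sqS1 a + sqS1 phi + 1)).
have c0 : 0 < 2 * (sqS1 a + sqS1 phi + 1) by lra.
have d0 : 0 < d by rewrite divr_gt0.
have [N /(_ N (leqnn _))[D1 D2]] := close d d0.
have := cauchy_schwarz (L2B Lu (Lv N)) Lp'.
have := cauchy_schwarz (L2B Lh (Lw N)) Lp.
have := wv N phi Cphi; rewrite -/a.
rewrite (@eq_intS1 _ (fun t => (u t - v_ N t) * a t)
  (fun t => u t * a t - v_ N t * a t)); last by move=> t _; rewrite mulrBl.
rewrite (@eq_intS1 _ (fun t => (h t - w_ N t) * phi t)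
  (fun t => h t * phi t - w_ N t * phi t)); last by move=> t _; rewrite mulrBl.
rewrite intS1B ?intS1B; [|exact: L2_mul..]; rewrite -/x -/y => -> E1 E2.
set z := intS1 _ in E1 E2.
have F1 := ler_pM (sqS1_ge0 _) A0 D1 (lexx (sqS1 a)).
have F2 := ler_pM (sqS1_ge0 _) B0 D2 (lexx (sqS1 phi)).
have de : 2 * (d * sqS1 a + d * sqS1 phi) <= e.
  have -> : e = d * (2 * (sqS1 a + sqS1 phi + 1)) by rewrite divfK// gt_eqF.
  by move: d0; lra.
have G : (x + y) ^+ 2 <= 2 * ((x - - z) ^+ 2 + (y - z) ^+ 2).
  by move: x y z {E1 E2} => x y z; have := sqr_ge0 ((x - - z) - (y - z)); nra.
move: G (le_trans E1 F2) (le_trans E2 F1) de.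
move=> {E1 E2 F1 F2 D1 D2}.
by move: (d * _) (d * _) (_ ^+ 2) (_ ^+ 2) (_ ^+ 2) => *; lra.
Qed.

End WeakClosed.

(** * Uniqueness for the continuous problem *)

Section Minimization.
Context {R : realType}.
Local Notation mu := (@lebesgue_measure R).
Variables (K : (R -> R) -> R -> R) (g w : R -> R) (Phi : R -> R -> R -> R) (rho b : R).
Hypotheses (K_linear : L2_linear K) (K_bounded : L2_to_C_bounded K).
Hypotheses (Cg : C_S1 g) (A1 : admissible_window w) (rho_gt0 : 0 < rho).
Hypothesis cH : continuous (fun z : R * R * R => Phi z.1.1 z.1.2 z.2).
Hypothesis Phi_periodic : forall p v : R, periodic (Phi p v) 1.
Hypothesis Phi_convex : forall v t : R, convex_function (E := R^o) setT (fun p => Phi p v t).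
Hypothesis Phi_ge : forall p v t, b <= Phi p v t.
Implicit Types f h u : R -> R.
Local Notation PsiF := (Psi K g Phi rho).
Local Notation PintF := (Pint K g Phi).
Let mid f h Hf Hh := @Psi_midpoint R K g Phi rho K_linear K_bounded Cg cH Phi_convex f h Hf Hh.

Lemma Psi_unique u v : is_argmin H1_S1 PsiF u -> is_argmin H1_S1 PsiF v ->
  v = u %[ae mu].
Proof.
move=> [Hu mu_] [Hv mv].
have [Lu Lv] := (H1_L2 Hu, H1_L2 Hv).
have [m Hm] := mid Hv Hu.
have uv : PsiF u = PsiF v by apply/le_anti/andP; split; [exact: mu_|exact: mv].
have := mu_ m Hm; rewrite -uv {uv}.
have := sqS1_ge0 (fun t => v t - u t).
have := sqS1_ge0 (fun t => wderiv v t - wderiv u t).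
move Ex : (sqS1 _) => x; move Ey : (sqS1 _) => y x0 y0 h1 h2.
have : rho * (y + x) <= 0 by move: h1 h2; move: (PsiF _) (PsiF u) => *; lra.
rewrite pmulr_rle0// => xy.
apply: ae01_periodic; [by case: Lv|by case: Lu|apply: ae01_of_sqS1 => //].
by rewrite Ey; move: x0 y0 xy {h1 h2}; lra.
Qed.

(** * Minimizing sequences of [Psi] *)

Section MinimizingSequence.
Variable v : nat -> R -> R.
Hypothesis Hv : forall n, H1_S1 (v n).
Hypothesis v_min : forall f (e : R), H1_S1 f -> 0 < e ->
  exists N : nat, forall n, (N <= n)%N -> PsiF (v n) <= PsiF f + e.

Lemma minimizing_cauchy (e : R) : 0 < e -> exists N : nat, forall n m,
  (N <= n)%N -> (N <= m)%N ->
  sqS1 (fun t => v n t - v m t)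
    + sqS1 (fun t => wderiv (v n) t - wderiv (v m) t) <= e.
Proof.
move=> e0; pose E := [set PsiF f | f in H1_S1].
have hlE : has_lbound E.
  by exists b => _ [f Hf <-]; exact: (Psi_ge K_bounded Cg rho_gt0 cH Phi_ge).
have hE : has_inf E by split=> //; exists (PsiF (v 0)); exists (v 0).
(* [f] is this close to the infimum and the sequence this close to [f]; the sum rho e / 8 matches
   the factor rho / 8 of [Psi_midpoint]. *)
have d0 : 0 < rho * e / 16 by rewrite divr_gt0// mulr_gt0.
have [_ [f Hf <-] fE] := inf_adherent d0 hE.
have [N HN] := v_min Hf d0; exists N => n m Nn Nm.
have [p Hp] := mid (Hv n) (Hv m).
have : inf E <= PsiF p by apply: ge_inf => //; exists p.
have := HN n Nn; have := HN m Nm; move: fE.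
move: (PsiF _) (PsiF _) (PsiF _) (PsiF p) (inf E) => p1 p2 p3 p4 i.
move: (sqS1 _) (sqS1 _) => x y *.
rewrite -(ler_pM2l rho_gt0); lra.
Qed.

Lemma minimizing_limit : exists2 u, is_argmin H1_S1 PsiF u &
  forall e : R, 0 < e -> exists N : nat, forall n, (N <= n)%N ->
    sqS1 (fun t => u t - v n t) <= e.
Proof.
have Lv n := H1_L2 (Hv n); have Lw n := (wderivP (Hv n)).1.
have [u Lu cu] : exists2 u, L2_S1 u & forall e : R, 0 < e ->
    exists N : nat, forall n, (N <= n)%N -> sqS1 (fun t => u t - v n t) <= e.
  apply: riesz_fischer => // e /minimizing_cauchy[N HN]; exists N => n m Nn Nm.
  by apply: le_trans (HN n m Nn Nm); rewrite lerDl sqS1_ge0.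
have [h Lh ch] : exists2 h, L2_S1 h & forall e : R, 0 < e ->
    exists N : nat, forall n, (N <= n)%N -> sqS1 (fun t => h t - wderiv (v n) t) <= e.
  apply: (riesz_fischer Lw) => e /minimizing_cauchy[N HN]; exists N => n m Nn Nm.
  by apply: le_trans (HN n m Nn Nm); rewrite lerDr sqS1_ge0.
have close e : 0 < e -> exists N : nat, forall n, (N <= n)%N ->
    sqS1 (fun t => u t - v n t) <= e /\ sqS1 (fun t => h t - wderiv (v n) t) <= e.
  move=> e0; have [N1 H1] := cu e e0; have [N2 H2] := ch e e0.
  exists (maxn N1 N2) => n; rewrite geq_max => /andP[n1 n2].
  by split; [exact: H1|exact: H2].
have wh : is_weak_derivative u h.
  by apply: (weak_closed Lv Lw Lu Lh) => // n; exact: (wderivP (Hv n)).2.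
have [Hu wu] := H1_wderiv_ae Lu Lh wh.
exists u; last exact: cu.
split; first exact: Hu.
move=> f Hf; apply/ler_addgt0Pr => e e0.
(* Four errors of e / 4: almost minimality, [Pint], and the two squared norms, whose tolerance e /
   (2 rho) is multiplied by rho / 2. *)
have e4 : 0 < e / 4 by rewrite divr_gt0.
have er : 0 < e / (2 * rho) by rewrite divr_gt0// mulr_gt0.
have [d1 d10 Hd1] := Pint_close K_linear K_bounded Cg cH (sqS1_ge0 u) e4.
have [d2 d20 Hd2] := sqS1_close (sqS1_ge0 u) er.
have [d3 d30 Hd3] := sqS1_close (sqS1_ge0 h) er.
pose d := Num.min d1 (Num.min d2 d3).
have d0 : 0 < d by rewrite !lt_min d10 d20.
have [N1 HN1] := close d d0; have [N2 HN2] := v_min Hf e4.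
have /HN1[] : (N1 <= maxn N1 N2)%N by exact: leq_maxl.
have /HN2 : (N2 <= maxn N1 N2)%N by exact: leq_maxr.
move: (maxn _ _) => n Pn; rewrite !le_min => /and3P[a1 a2 _] /and3P[_ _ b3].
rewrite sqS1_BC in a1; rewrite sqS1_BC in a2; rewrite sqS1_BC in b3.
have := Hd1 _ _ Lu (Lv n) (lexx _) a1; have := Hd2 _ _ Lu (Lv n) (lexx _) a2.
have := Hd3 _ _ Lh (Lw n) (lexx _) b3; move: Pn.
rewrite (PsiE K g Phi rho (Hv n) (Lw n) (ae01_refl _)) (PsiE K g Phi rho Hu Lh wu).
move: (sqS1 h) (sqS1 u) (sqS1 (v n)) (sqS1 (wderiv (v n))) => q1 q2 q3 q4.
move: (PsiF f) (PintF u) (PintF (v n)) => p1 p2 p3 Pn.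
rewrite !ler_norml => /andP[H1 _] /andP[H2 _] /andP[H3 _].
have E : rho * (e / (2 * rho)) = e / 2 by field; rewrite gt_eqF.
have : rho * (- (e / (2 * rho))) <= rho * (q4 - q1) by rewrite ler_pM2l.
have : rho * (- (e / (2 * rho))) <= rho * (q3 - q2) by rewrite ler_pM2l.
by rewrite mulrN E; move: Pn H3 => *; lra.
Qed.

End MinimizingSequence.

(** * Convergence of the discrete minimizers *)

Variable U : forall n : nat, 'rV[R]_n.+1.
Hypothesis HU : forall n, is_argmin setT (@PsiN R K g w Phi rho n.+1) (U n).

(** A minimizer does no worse than the recovery vectors of the zero function with tolerance 1, and
    [PsiN_ge] converts this into a norm bound. *)
Lemma argmin_sqH1N_bounded : exists2 C : R, 0 <= C & exists N : nat,
  forall n, (N <= n)%N -> sqH1N (U n) <= C.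
Proof.
have H0 : H1_S1 (fun _ : R => 0 : R).
  split; first exact: L2_cst.
  exists (fun=> 0); split; first exact: L2_cst.
  move=> phi _; rewrite (@eq_intS1 _ _ (fun=> 0)); last by move=> t _; rewrite mul0r.
  rewrite [in RHS](@eq_intS1 _ _ (fun=> 0)); last by move=> t _; rewrite mul0r.
  by rewrite intS1_cst oppr0.
have P0 := Psi_ge K_bounded Cg rho_gt0 cH Phi_ge H0.
have [a [N HN]] := recovery K_linear K_bounded Cg A1 rho_gt0 cH Phi_periodic H0 ltr01.
exists (2 / rho * (PsiF (fun=> 0) + 1 - b)).
  by rewrite mulr_ge0// ?divr_ge0// ?(ltW rho_gt0)//; move: P0; move: (PsiF _) => *; lra.
exists N => n /HN an; have := (HU n).2 (a n) I.
have := @PsiN_ge R K g w Phi rho b Phi_ge n (U n) => h1 h2.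
have : rho / 2 * sqH1N (U n) <= PsiF (fun=> 0) + 1 - b.
  by move: (PsiN _ _ _ _ _ _) (PsiN _ _ _ _ _ _) (PsiF _) an h1 h2 => *; lra.
have r2 : 0 < 2 / rho by rewrite divr_gt0.
rewrite -(ler_pM2l r2) (_ : 2 / rho * (rho / 2 * _) = sqH1N (U n))//.
by field; rewrite gt_eqF.
Qed.

(** The value at the lift exceeds that of [U n] by at most e / 2, [U n] beats the recovery vector of
    [f], and recovery costs another e / 2. *)
Lemma lift_minimizing f (e : R) : H1_S1 f -> 0 < e ->
  exists N : nat, forall n, (N <= n)%N -> PsiF (liftS1 (U n)) <= PsiF f + e.
Proof.
move=> Hf e0; have e2 : 0 < e / 2 by rewrite divr_gt0.
have [C C0 [N1 HN1]] := argmin_sqH1N_bounded.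
have [N2 HN2] := Psi_lift_le K_linear K_bounded Cg A1 rho_gt0 cH Phi_periodic C0 e2.
have [a [N3 HN3]] := recovery K_linear K_bounded Cg A1 rho_gt0 cH Phi_periodic Hf e2.
exists (maxn N1 (maxn N2 N3)) => n; rewrite !geq_max => /and3P[n1 n2 n3].
have := HN2 n (U n) n2 (HN1 n n1); have := HN3 n n3; have := (HU n).2 (a n) I.
by move: (PsiN _ _ _ _ _ _) (PsiN _ _ _ _ _ _) (PsiF _) (PsiF _) => *; lra.
Qed.

Lemma argmin_exists_cvg : exists2 u, is_argmin H1_S1 PsiF u &
  forall e : R, 0 < e -> exists N : nat, forall n, (N <= n)%N ->
    sqS1 (fun t => interpN (U n) t - u t) <= e.
Proof.
have [u um cu] := @minimizing_limit (fun n => liftS1 (U n))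
  (fun n => (lift_H1 (U n)).1) lift_minimizing.
exists u => // e e0; have e4 : 0 < e / 4 by rewrite divr_gt0.
have [C C0 [N1 HN1]] := argmin_sqH1N_bounded.
have [N2 HN2] := cu _ e4; have [N3 HN3] := archi_div_le C e4.
exists (maxn N1 (maxn N2 N3)) => n; rewrite !geq_max => /and3P[n1 n2 n3].
have Lu := H1_L2 um.1.
have := sqS1_triangle (L2_interpN (U n)) (L2_lift (U n)) Lu.
rewrite sqS1_BC [X in _ + _ * X]sqS1_BC.
have := HN2 n n2; have := sqS1_lift_close (U n).
have : sqH1N (U n) / n.+1%:R <= C / n.+1%:R by rewrite ler_pM2r ?invr_gt0 ?ltr0n//; exact: HN1.
have := HN3 n n3; rewrite sqS1_BC.
by move: (sqS1 _) (sqS1 _) (sqS1 _) (C / _) (sqH1N _ / _) => *; lra.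
Qed.

End Minimization.

(** * The Euler-Lagrange equation *)

Section EulerLagrange.
Context {R : realType}.

(** By the mean value theorem the remainder is controlled by the oscillation of the derivative,
    which is what can be made uniform in t. *)
Lemma derive1_remainder (F : R -> R) (a y e : R) :
  (forall x : R, derivable F x 1) ->
  (forall x, `|x - a| <= `|y| -> `|derive1 F x - derive1 F a| <= e) ->
  `|F (a + y) - F a - y * derive1 F a| <= e * `|y|.
Proof.
move=> dF H.
have isd (x : R) : is_derive x (1 : R) F (derive1 F x).
  by rewrite derive1E; apply: derivableP.
have cF (p q : R) : {within `[p, q], continuous F}.
  by apply: derivable_within_continuous => x _; exact: dF.
have [c ca E] : exists2 c, `|c - a| <= `|y| & F (a + y) - F a = derive1 F c * y.
  have [y0|y0] := leP 0 y.
    have [|c cI E] := @MVT_segment R F (derive1 F) a (a + y) _ (fun x _ => isd x) (cF _ _).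
      by rewrite lerDl.
    exists c; last by rewrite E addrC addKr.
    by move: cI; rewrite in_itv/= => /andP[? ?]; rewrite !ger0_norm; lra.
  have [|c cI E] := @MVT_segment R F (derive1 F) (a + y) a _ (fun x _ => isd x) (cF _ _).
    by rewrite gerDl ltW.
  exists c; last by move: E; nra.
  by move: cI; rewrite in_itv/= => /andP[? ?]; rewrite (ltr0_norm y0) ler0_norm; lra.
rewrite E (_ : _ - _ = (derive1 F c - derive1 F a) * y); last by ring.
by rewrite normrM ler_wpM2r//; exact: H.
Qed.

Variables (K : (R -> R) -> R -> R) (g : R -> R) (Phi : R -> R -> R -> R) (rho : R).
Hypotheses (K_linear : L2_linear K) (K_bounded : L2_to_C_bounded K).
Hypotheses (Cg : C_S1 g) (rho_gt0 : 0 < rho).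
Hypothesis cH : continuous (fun z : R * R * R => Phi z.1.1 z.1.2 z.2).
Hypothesis Phi_derivable : forall p v t : R, derivable (fun q => Phi q v t) p 1.
Hypothesis d1_continuous : continuous (fun z : R * R * R => d1 Phi 1 z.1.1 z.1.2 z.2).
Implicit Types f h u phi : R -> R.
Local Notation PsiF := (Psi K g Phi rho).
Local Notation PintF := (Pint K g Phi).

Lemma Pint_derivative u phi (e : R) : L2_S1 u -> L2_S1 phi -> 0 < e ->
  exists2 d : R, 0 < d & forall s, `|s| <= d ->
    `|PintF (fun t => s * phi t + u t) - PintF u
      - s * intS1 (fun t => d1 Phi 1 (K u t) (g t) t * K phi t)| <= e * `|s|.
Proof.
move=> Lu Lp e0.
have CKu := K_C K_bounded Lu; have CKp := K_C K_bounded Lp.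
have [P P0 uP] := C_S1_bounded CKu; have [Q Q0 pQ] := C_S1_bounded CKp.
have [G G0 gG] := C_S1_bounded Cg.
have Q1 : 0 < Q + 1 by rewrite ltr_wpDl.
have e1 : 0 < e / (Q + 1) by rewrite divr_gt0.
have [d d0 Hd] := box_unif P G d1_continuous e1.
(* Keeps s [K phi] below d at every point, [Q] being the sup bound of [K phi]; the 1 covers a null
   [Q]. *)
exists (d / (Q + 1)); first by rewrite divr_gt0.
move=> s; rewrite ler_pdivlMr// => sd.
have PL := Pint_L1 K_bounded Cg cH.
have LD : L1 (fun t => d1 Phi 1 (K u t) (g t) t * K phi t).
  apply: L1_continuous => t; apply: cvgM; last exact: CKp.2.
  exact: (continuous_triple d1_continuous CKu.2 Cg.2).
have Ls := L2_lin s Lp Lu.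
rewrite /Pint -intS1B; [|exact: PL..].
rewrite -intS1Z// -intS1B; [|by apply: L1B; exact: PL|exact: L1Z].
apply: normr_intS1_le => [|t t01]; first by apply: L1B; [apply: L1B; exact: PL|exact: L1Z].
rewrite K_linear// [s * K phi t + _]addrC.
have sq : `|s * K phi t| <= `|s| * Q by rewrite normrM ler_wpM2l.
have R1 : `|Phi (K u t + s * K phi t) (g t) t - Phi (K u t) (g t) t
    - s * K phi t * d1 Phi 1 (K u t) (g t) t| <= e / (Q + 1) * `|s * K phi t|.
  apply: (@derive1_remainder (fun q => Phi q (g t) t)) => [x|x xs].
    exact: Phi_derivable.
  rewrite distrC; apply: (Hd (K u t) (g t) t x (g t) t) => //.
  - by rewrite distrC (le_trans xs)// (le_trans sq)// (le_trans _ sd)// ler_wpM2l// lerDl.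
  - by rewrite subrr normr0 ltW.
  - by rewrite subrr normr0 ltW.
rewrite [X in _ - X](_ : _ = s * K phi t * d1 Phi 1 (K u t) (g t) t); last by ring.
apply: (le_trans R1); apply: (@le_trans _ _ (e / (Q + 1) * (`|s| * (Q + 1)))).
  by rewrite ler_pM2l// (le_trans sq)// ler_wpM2l// lerDl.
by rewrite mulrCA divfK ?gt_eqF// mulrC.
Qed.

Lemma euler_lagrange u phi : is_argmin H1_S1 PsiF u -> H1_S1 phi ->
  intS1 (fun t => d1 Phi 1 (K u t) (g t) t * K phi t)
  + rho * (intS1 (fun t => phi t * u t) + intS1 (fun t => wderiv phi t * wderiv u t)) = 0.
Proof.
move=> [Hu um] Hp; have Lu := H1_L2 Hu; have Lp := H1_L2 Hp.
have [Lu' wu] := wderivP Hu; have [Lp' wp] := wderivP Hp.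
set A := intS1 _; set B := intS1 _ + intS1 _; set L := A + rho * B.
pose S := sqS1 phi + sqS1 (wderiv phi).
have S0 : 0 <= S by rewrite addr_ge0 ?sqS1_ge0.
(* Minimality against u + s phi, with the quadratic part expanded exactly; both signs of s are used
   below. *)
have key (s : R) : 0 <= PintF (fun t => s * phi t + u t) - PintF u
    + rho * s * B + rho / 2 * s ^+ 2 * S.
  have [Hs ws] := H1_lin s Hp Hu.
  have := um _ Hs.
  rewrite (PsiE K g Phi rho Hs (L2_lin s Lp' Lu') ws).
  rewrite (PsiE K g Phi rho Hu Lu' (ae01_refl _)) !sqS1_lin// /B /S.
  move: (PintF _) (PintF u) => p1 p2.
  by move: (sqS1 _) (sqS1 _) (sqS1 _) (sqS1 _) (intS1 _) (intS1 _) => *; lra.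
have bound (e : R) : 0 < e -> `|L| <= e.
  move=> e0; have e2 : 0 < e / 2 by rewrite divr_gt0.
  have [d d0 Hd] := Pint_derivative Lu Lp e2.
  (* The first bound admits the derivative estimate with error s e / 2; the second keeps the
     quadratic remainder rho s^2 S / 2 below s e / 2. *)
  pose s := Num.min d (e / (rho * (S + 1))).
  have r1 : 0 < rho * (S + 1) by rewrite mulr_gt0// ltr_wpDl.
  have s0 : 0 < s by rewrite lt_min d0 divr_gt0.
  have sd : s <= d by rewrite ge_min lexx.
  have se : rho * s * S <= e.
    have : s <= e / (rho * (S + 1)) by rewrite ge_min lexx orbT.
    rewrite ler_pdivlMr// => h; apply: le_trans h.
    by rewrite -mulrA mulrCA ler_pM2l// ler_pM2l// lerDl.
  have := Hd s; have := Hd (- s); rewrite normrN (gtr0_norm s0) -/A.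
  move=> /(_ sd) + /(_ sd); have := key s; have := key (- s).
  rewrite /L; move: (PintF _) (PintF _) (PintF u) => p1 p2 p3.
  move: s s0 se {sd} => s s0 se k1 k2; rewrite !ler_norml => /andP[a1 a2] /andP[b1 b2].
  rewrite -(ler_pM2l s0) -[in X in _ && X](ler_pM2l s0).
  have := ler_wpM2l (ltW s0) se.
  move: a1 a2 b1 b2 k1 k2 => *; apply/andP; split; nra.
apply/eqP; rewrite -normr_le0; apply/ler_addgt0Pl => e e0; rewrite addr0; exact: bound.
Qed.

End EulerLagrange.

(** * Minimizers, convergence and optimality condition assembled *)

Theorem lemma5p2 (R : realType) (K Kadj : (R -> R) -> R -> R) (g w : R -> R)
    (Phi : R -> R -> R -> R) (rho : R)
    (rho_gt0 : 0 < rho)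
    (Phi_periodic : forall p v : R, periodic (Phi p v) 1)
    (A0 : convex_bounded_below Phi)
    (A1 : admissible_window w)
    (K_linear : L2_linear K)
    (Kadj_adjoint : L2_adjoint K Kadj)
    (A2 : [/\ L2_to_C_bounded K, L2_to_C_bounded Kadj & C_S1 g])
    (A3 : nonneg_near_data g Phi)
    (A4 : regular_integrand Phi)
    (A5 : third_derivative_bound K g w Phi rho) :
  exists (uN : forall N : nat, 'rV[R]_N) (u : R -> R),
    [/\ forall N : nat, (0 < N)%N ->
          is_argmin setT (@PsiN R K g w Phi rho N) (uN N) /\
          (forall v : 'rV[R]_N,
             is_argmin setT (@PsiN R K g w Phi rho N) v -> v = uN N),
        is_argmin H1_S1 (Psi K g Phi rho) u /\
          (forall v : R -> R, is_argmin H1_S1 (Psi K g Phi rho) v ->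
             v = u %[ae (@lebesgue_measure R)]),
        L2norm (fun t => interpN (uN N) t - u t) @[N --> \oo] --> (0 : R) &
        Hm1_zero (fun phi : R -> R =>
          Hm1_fun (Kadj (fun t => d1 Phi 1 (K u t) (g t) t)) phi
          + rho * (- Hm1_dt (wderiv u) phi + Hm1_fun u phi))].
Proof.
have [Phi_convex Phi_continuous [b Phi_ge]] := A0.
have [K_bounded Kadj_bounded Cg] := A2.
have [Phi_lip Phi_derivable _ d1_continuous _] := A4.
have cH : continuous (fun z : R * R * R => Phi z.1.1 z.1.2 z.2).
  exact: locally_lipschitz_continuous.
have [U HU] : {U : forall n : nat, 'rV[R]_n.+1 |
    forall n, is_argmin setT (@PsiN R K g w Phi rho n.+1) (U n)}.
  have ex := @PsiN_argmin_exists R K g w Phi rho b K_linear K_bounded A1 rho_gt0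
    Phi_continuous Phi_ge.
  exists (fun n => sval (cid (ex n))) => n; exact: svalP (cid (ex n)).
have [u um cu] := argmin_exists_cvg K_linear K_bounded Cg A1 rho_gt0 cH
  Phi_periodic Phi_convex Phi_ge HU.
(* The value at N = 0 is a placeholder: the claims concern 0 < N and the limit. *)
pose uN (N : nat) : 'rV[R]_N := if N is n.+1 then U n else 0.
exists uN, u; split.
- case=> // n _; split; first exact: HU.
  by move=> v vm; apply: PsiN_unique vm (HU n).
- split; first exact: um.
  move=> v vm; exact: (Psi_unique K_linear K_bounded Cg rho_gt0 cH Phi_convex um vm).
- apply/cvgrPdist_le => e e0.
  have e2 : 0 < e ^+ 2 by rewrite exprn_gt0.
  (* The threshold moves up by one because [uN] at n.+1 is [U n]. *)
  have [N HN] := cu _ e2; exists N.+1 => //= -[//|n] /= Nn.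
  rewrite sub0r normrN ger0_norm ?sqrtr_ge0// -(ger0_norm (ltW e0)) -sqrtr_sqr.
  by rewrite ler_wsqrtr//; exact: HN.
- move=> phi Hphi; have := euler_lagrange K_linear K_bounded Cg rho_gt0 cH
    Phi_derivable d1_continuous um Hphi.
  have Lu := H1_L2 um.1; have Lphi := H1_L2 Hphi.
  set hh := fun t => d1 Phi 1 (K u t) (g t) t.
  have CKu := K_C K_bounded Lu.
  (* The adjoint relation is stated on L^2; continuity and periodicity, inherited from [Phi] in t,
     put [hh] there. *)
  have Lhh : L2_S1 hh.
    apply: C_S1_L2; split=> [t|]; last first.
      exact: (continuous_triple d1_continuous CKu.2 Cg.2).
    rewrite /hh CKu.1 Cg.1 /d1; congr (derive1n 1 _ _).
    by apply/funext => q; exact: Phi_periodic.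
  have := Kadj_adjoint _ _ Lphi Lhh.
  rewrite /Hm1_fun /Hm1_dt opprK.
  rewrite (@eq_intS1 _ (fun t => K phi t * hh t) (fun t => hh t * K phi t)); last first.
    by move=> t _; rewrite mulrC.
  rewrite (@eq_intS1 _ (fun t => phi t * Kadj hh t) (fun t => Kadj hh t * phi t)); last first.
    by move=> t _; rewrite mulrC.
  rewrite (@eq_intS1 _ (fun t => phi t * u t) (fun t => u t * phi t)); last first.
    by move=> t _; rewrite mulrC.
  rewrite (@eq_intS1 _ (fun t => wderiv phi t * wderiv u t)
    (fun t => wderiv u t * wderiv phi t)); last by move=> t _; rewrite mulrC.
  by move=> <- <-; congr (_ + _ * _); rewrite addrC.
Qed.
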